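(* Let $\mathbf T$ be a filtered tannakian category over a field $K$ of characteristic $0$, $k\geq 2$, and let $A=\bigoplus_{r=1}^kA_r$ with $A_r$ nonzero pure of weight $p_r$, $p_1<\cdots<p_k$. Let $2\le\ell\le k-1$, $\epsilon\in S_{\ell-1}(A)$, and let $\epsilon'\in S'_{\ell-1}(A)$ be a lift of $\epsilon$. Suppose $\epsilon$ is totally nonsplit. Then the action of $\Gamma(\epsilon')$ on $\Theta_\ell^{-1}(\epsilon')$ is trivial, and the map $S'_\ell(A)\to S_\ell(A)$ restricts to a bijection $$\Theta_\ell^{-1}(\epsilon')\cong\Theta_\ell^{-1}(\epsilon).$$ In particular, the choice of $\epsilon'$ above $\epsilon$ makes $\Theta_\ell^{-1}(\epsilon)$ (when nonempty) a torsor for $\prod_{r=1}^{k-\ell}Ext^1(A_{r+\ell},A_r)$.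
   Context: **Filtered tannakian category.** A neutral tannakian category $\mathbf T$ over $K$ with $K$-linear exact functors $W_n:\mathbf T\to\mathbf T$ ($n\in\mathbb Z$) such that the $W_nX$ form an increasing filtration of $X$ by subobjects, natural in $X$, with $W_nX=0$ for $n\ll0$, $W_nX=X$ for $n\gg0$, and $W_n(X\otimes Y)=\sum_{p+q=n}W_pX\otimes W_qY$. $X$ is pure of weight $n$ if $W_{n-1}X=0$, $W_nX=X$. $\underline{Hom}$ is internal Hom, $\mathbb 1$ the unit object. **Totally nonsplit extensions.** An extension (class) of $\mathbb 1$ by $X$ is totally nonsplit if for every proper subobject $X'\subsetneq X$ its pushforward along $X\to X/X'$ is nonsplit. An extension (class) of $Y$ by $X$ is totally nonsplit if the corresponding class under $Ext^1(Y,X)\cong Ext^1(\mathbb 1,\underline{Hom}(Y,X))$ is totally nonsplit. **Generalized extensions.** For $1\le\ell\le k-1$, a generalized extension of level $\ell$ of $A$ consists of objects $X_{m,n}$ for $0\le m<n\le k$, $n-m\le\ell+1$, with $X_{r-1,r}=A_r$, together with, for $n-m\ge2$, an epimorphism $X_{m,n}\to X_{m+1,n}$ and a monomorphism $X_{m,n-1}\to X_{m,n}$, such that: (i) for $n-m\ge3$ the square formed by $X_{m,n-1},X_{m+1,n-1},X_{m,n},X_{m+1,n}$ commutes; (ii) for $n-m\ge2$, $0\to X_{m,n-1}\to X_{m,n}\to A_n\to0$ is exact, where $X_{m,n}\to A_n$ is the composite $X_{m,n}\to X_{m+1,n}\to\cdots\to X_{n-1,n}=A_n$. Morphisms are collections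 $f_{m,n}:X_{m,n}\to X'_{m,n}$ commuting with all structure arrows ($f_{r-1,r}:A_r\to A_r$ arbitrary); the category is $D_\ell(A)$. The sequence in (ii) is denoted $\mathcal X^v_{m,n}$; one also has exact sequences $\mathcal X^h_{m,n}:0\to A_{m+1}\to X_{m,n}\to X_{m+1,n}\to0$ (first map the composite of monomorphisms $X_{m,m+1}\to\cdots\to X_{m,n}$). $S_\ell(A)$ is the set of isomorphism classes of $D_\ell(A)$; $S'_\ell(A)$ is the set of classes for the finer relation $\sim'$ of being isomorphic via an isomorphism with all $f_{r-1,r}=\mathrm{Id}$. Truncation $\Theta_\ell:D_\ell(A)\to D_{\ell-1}(A)$ ($2\le\ell\le k-1$) erases the objects $X_{r-1,r+\ell}$ and all arrows into and out of them; it induces maps, also denoted $\Theta_\ell$, $S_\ell(A)\to S_{\ell-1}(A)$ and $S'_\ell(A)\to S'_{\ell-1}(A)$. A generalized extension is totally nonsplit if $\mathcal X^v_{m,n}$ and $\mathcal X^h_{m,n}$ are totally nonsplit for all $(m,n)$ in range with $n-m\ge2$; this is a property of isomorphism classes. **$\Gamma(\epsilon')$.** Any two representatives of $\epsilon'\in S'_{\ell-1}(A)$ are related by a unique isomorphism that is the identity on all $A_r$; conjugation by these identifies their automorphism groups in $D_{\ell-1}(A)$ compatibly, and $\Gamma(\epsilon')=\lim_{(X_{\bullet,\bullet})\in\epsilon'}Aut((X_{\bullet,\bullet}))$, isomorphic to $Aut((X_{\bullet,\bullet}))$ for each representative. Fix a representative $(X_{\bullet,\bullet})$ and let $\Theta_\ell^{-1}((X_{\bullet,\bullet}))\subset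 D_\ell(A)$ be the collection of objects truncating to $(X_{\bullet,\bullet})$; the natural map $\Theta_\ell^{-1}((X_{\bullet,\bullet}))/\sim'\to\Theta_\ell^{-1}(\epsilon')$ is bijective. $\sigma\in Aut((X_{\bullet,\bullet}))$ acts on $(Y_{\bullet,\bullet})\in\Theta_\ell^{-1}((X_{\bullet,\bullet}))$ by composing each arrow $Y_{r-1,r+\ell}\to X_{r,r+\ell}$ with $\sigma_{r,r+\ell}$ and precomposing each arrow $X_{r-1,r+\ell-1}\to Y_{r-1,r+\ell}$ with $\sigma_{r-1,r+\ell-1}^{-1}$, the rest unchanged. This descends to the action of $\Gamma(\epsilon')$ on $\Theta_\ell^{-1}(\epsilon')$, which does not depend on the representative. **Torsor structure.** When nonempty, $\Theta_\ell^{-1}(\epsilon')$ is a torsor for $\prod_rExt^1(A_{r+\ell},A_r)$: $(\mathcal E_r)$ acts on the class of $(Y_{\bullet,\bullet})\in\Theta_\ell^{-1}((X_{\bullet,\bullet}))$ by replacing, for each $r$, the extension $\mathcal Y^h_{r-1,r+\ell}\in Ext^1(X_{r,r+\ell},A_r)$ by the Baer sum $\mathcal Y^h_{r-1,r+\ell}+\omega_r^*\mathcal E_r$, where $\omega_r:X_{r,r+\ell}\to A_{r+\ell}$ is the structure map (with the inclusion of $X_{r-1,r+\ell-1}$ into its middle object coming from the canonical identification of its pullback to $X_{r,r+\ell-1}$ with $\mathcal X^h_{r-1,r+\ell-1}$). The torsor structure on $\Theta_\ell^{-1}(\epsilon)$ is the one transferred along the bijection of the claim. *)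

(* Defs.v *)
From mathcomp Require Import all_boot all_order all_algebra.
From mathcomp Require Import zify.
From mathcomp Require Import boolp classical_sets functions.

Set Implicit Arguments.
Unset Strict Implicit.
Unset Printing Implicit Defensive.

Import Order.TTheory GRing.Theory Num.Theory.
Local Open Scope ring_scope.

Reserved Notation "g ∘ f" (at level 40, left associativity).
Reserved Notation "X ⊗ Y" (at level 40, left associativity).
Reserved Notation "f ⊗' g" (at level 40, left associativity).

Record linCat (K : fieldType) := LinCat {
  ob :> Type;
  hom : ob -> ob -> lmodType K;
  idm : forall X, hom X X;
  comp : forall X Y Z, hom Y Z -> hom X Y -> hom X Z;
  compA : forall X Y Z W (h : hom Z W) (g : hom Y Z) (f : hom X Y),
    comp h (comp g f) = comp (comp h g) f;
  comp1m : forall X Y (f : hom X Y), comp (idm Y) f = f;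
  compm1 : forall X Y (f : hom X Y), comp f (idm X) = f;
  comp_linear_l : forall X Y Z (f : hom X Y), linear (fun g : hom Y Z => comp g f);
  comp_linear_r : forall X Y Z (g : hom Y Z), linear (fun f : hom X Y => comp g f)
}.

Arguments hom {K l} X Y.
Arguments idm {K l} X.
Arguments comp {K l X Y Z} g f.
Notation "g ∘ f" := (comp g f).

Section LinCatNotions.
Variables (K : fieldType) (C : linCat K).
Implicit Types X Y Z : C.

Lemma comp0m X Y Z (f : hom X Y) : (0 : hom Y Z) ∘ f = 0.
Proof.
have := comp_linear_l f (-1) (0 : hom Y Z) 0.
by rewrite /= scaler0 addr0 scaleN1r addNr.
Qed.

Lemma compm0 X Y Z (g : hom Y Z) : g ∘ (0 : hom X Y) = 0.
Proof.
have := comp_linear_r g (-1) (0 : hom X Y) 0.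
by rewrite /= scaler0 addr0 scaleN1r addNr.
Qed.

Definition is_zero X := idm X = 0.

Definition is_mono X Y (f : hom X Y) :=
  forall Z (u v : hom Z X), f ∘ u = f ∘ v -> u = v.

Definition is_epi X Y (f : hom X Y) :=
  forall Z (u v : hom Y Z), u ∘ f = v ∘ f -> u = v.

Definition mutually_inverse X Y (f : hom X Y) (g : hom Y X) :=
  g ∘ f = idm X /\ f ∘ g = idm Y.

Definition is_iso X Y (f : hom X Y) := exists g, mutually_inverse f g.

Definition is_kernel X Y N (i : hom N X) (f : hom X Y) :=
  f ∘ i = 0 /\
  forall Z (t : hom Z X), f ∘ t = 0 -> exists! u : hom Z N, i ∘ u = t.

Definition is_cokernel X Y Q (q : hom Y Q) (f : hom X Y) :=
  q ∘ f = 0 /\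
  forall Z (t : hom Y Z), t ∘ f = 0 -> exists! u : hom Q Z, u ∘ q = t.

Definition short_exact X E Y (i : hom X E) (p : hom E Y) :=
  is_kernel i p /\ is_cokernel p i.

Lemma short_exact_iso X' X E Y Y' (i : hom X E) (p : hom E Y)
    (u : hom X' X) (a : hom Y Y') :
  is_iso u -> is_iso a -> short_exact i p -> short_exact (i ∘ u) (a ∘ p).
Proof.
move=> [v [vu uv]] [b [ba ab]] [[pi0 ker] [ip0 coker]].
have api0 : a ∘ p ∘ (i ∘ u) = 0.
  by rewrite -compA [p ∘ _]compA pi0 comp0m compm0.
split; split=> // Z t.
- rewrite -compA => /(congr1 (comp b)); rewrite compA ba comp1m compm0.
  move=> /ker [w [wE wU]]; exists (v ∘ w); split.
    by rewrite -compA [u ∘ _]compA uv comp1m.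
  by move=> w'; rewrite -compA => /wU ->; rewrite compA vu comp1m.
- rewrite compA => /(congr1 (comp^~ v)).
  rewrite -compA uv compm1 comp0m.
  move=> /coker [w [wE wU]]; exists (w ∘ b); split.
    by rewrite -compA [b ∘ _]compA ba comp1m.
  by move=> w'; rewrite compA => /wU ->; rewrite -compA ab compm1.
Qed.

End LinCatNotions.

Record abCat (K : fieldType) := AbCat {
  ab_lin :> linCat K;
  zob : ab_lin;
  zobP : is_zero zob;
  bip : ab_lin -> ab_lin -> ab_lin;
  inl_ : forall X Y, hom X (bip X Y);
  inr_ : forall X Y, hom Y (bip X Y);
  prl : forall X Y, hom (bip X Y) X;
  prr : forall X Y, hom (bip X Y) Y;
  prl_inl : forall X Y, prl X Y ∘ inl_ X Y = idm X;
  prr_inr : forall X Y, prr X Y ∘ inr_ X Y = idm Y;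
  prl_inr : forall X Y, prl X Y ∘ inr_ X Y = 0;
  prr_inl : forall X Y, prr X Y ∘ inl_ X Y = 0;
  bip_id : forall X Y,
    inl_ X Y ∘ prl X Y + inr_ X Y ∘ prr X Y = idm (bip X Y);
  has_kernel : forall (X Y : ab_lin) (f : hom X Y),
    exists (N : ab_lin) (i : hom N X), is_kernel i f;
  has_cokernel : forall (X Y : ab_lin) (f : hom X Y),
    exists (Q : ab_lin) (q : hom Y Q), is_cokernel q f;
  mono_normal : forall (X Y : ab_lin) (f : hom X Y), is_mono f ->
    exists (Z : ab_lin) (g : hom Y Z), is_kernel f g;
  epi_normal : forall (X Y : ab_lin) (f : hom X Y), is_epi f ->
    exists (Z : ab_lin) (g : hom Z X), is_cokernel f g
}.

Arguments inl_ {K a X Y}.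
Arguments inr_ {K a X Y}.
Arguments prl {K a X Y}.
Arguments prr {K a X Y}.

Section Biproduct.
Variables (K : fieldType) (C : abCat K).

Definition bipm (X X' Y Y' : C) (f : hom X X') (g : hom Y Y') :
    hom (bip X Y) (bip X' Y') :=
  inl_ ∘ f ∘ prl + inr_ ∘ g ∘ prr.

Definition diag (X : C) : hom X (bip X X) := inl_ + inr_.

Definition codiag (X : C) : hom (bip X X) X := prl + prr.

End Biproduct.

(* Rigid symmetric monoidal abelian category with End(1) = K and bilinear     *)
(* tensor product.                                                            *)
Record tensCat (K : fieldType) := TensCat {
  tens_ab :> abCat K;
  tens : tens_ab -> tens_ab -> tens_ab;
  tensm : forall X X' Y Y' : tens_ab,
    hom X X' -> hom Y Y' -> hom (tens X Y) (tens X' Y');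
  tensm_id : forall X Y, tensm (idm X) (idm Y) = idm (tens X Y);
  tensm_comp : forall X X' X'' Y Y' Y'' (f' : hom X' X'') (f : hom X X')
      (g' : hom Y' Y'') (g : hom Y Y'),
    tensm (f' ∘ f) (g' ∘ g) = tensm f' g' ∘ tensm f g;
  tensm_linear_l : forall X X' Y Y' (g : hom Y Y'),
    linear (fun f : hom X X' => tensm f g);
  tensm_linear_r : forall X X' Y Y' (f : hom X X'),
    linear (fun g : hom Y Y' => tensm f g);
  one_ : tens_ab;
  assoc : forall X Y Z, hom (tens (tens X Y) Z) (tens X (tens Y Z));
  associ : forall X Y Z, hom (tens X (tens Y Z)) (tens (tens X Y) Z);
  assoc_inv : forall X Y Z, mutually_inverse (assoc X Y Z) (associ X Y Z);
  assoc_nat : forall X X' Y Y' Z Z' (f : hom X X') (g : hom Y Y') (h : hom Z Z'),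
    assoc X' Y' Z' ∘ tensm (tensm f g) h = tensm f (tensm g h) ∘ assoc X Y Z;
  lunit : forall X, hom (tens one_ X) X;
  lunit_iso : forall X, is_iso (lunit X);
  lunit_nat : forall X X' (f : hom X X'),
    lunit X' ∘ tensm (idm one_) f = f ∘ lunit X;
  runit : forall X, hom (tens X one_) X;
  runit_iso : forall X, is_iso (runit X);
  runit_nat : forall X X' (f : hom X X'),
    runit X' ∘ tensm f (idm one_) = f ∘ runit X;
  braid : forall X Y, hom (tens X Y) (tens Y X);
  braid_nat : forall X X' Y Y' (f : hom X X') (g : hom Y Y'),
    braid X' Y' ∘ tensm f g = tensm g f ∘ braid X Y;
  braid_sym : forall X Y, braid Y X ∘ braid X Y = idm (tens X Y);
  pentagon : forall W X Y Z,
    assoc W X (tens Y Z) ∘ assoc (tens W X) Y Z =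
    tensm (idm W) (assoc X Y Z) ∘ assoc W (tens X Y) Z
      ∘ tensm (assoc W X Y) (idm Z);
  triangle : forall X Y,
    tensm (idm X) (lunit Y) ∘ assoc X one_ Y = tensm (runit X) (idm Y);
  hexagon : forall X Y Z,
    assoc Y Z X ∘ braid X (tens Y Z) ∘ assoc X Y Z =
    tensm (idm Y) (braid X Z) ∘ assoc Y X Z ∘ tensm (braid X Y) (idm Z);
  dual : tens_ab -> tens_ab;
  ev : forall X, hom (tens (dual X) X) one_;
  coev : forall X, hom one_ (tens X (dual X));
  zigzag : forall X,
    runit X ∘ tensm (idm X) (ev X) ∘ assoc X (dual X) X
      ∘ tensm (coev X) (idm X) = lunit X;
  zigzag_dual : forall X,
    lunit (dual X) ∘ tensm (ev X) (idm (dual X)) ∘ associ (dual X) X (dual X)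
      ∘ tensm (idm (dual X)) (coev X) = runit (dual X);
  end_one : forall f : hom one_ one_, exists! c : K, f = c *: idm one_
}.

Arguments one_ {K}.
Arguments coev {K t} X.
Notation "X ⊗ Y" := (tens X Y).
Notation "f ⊗' g" := (tensm f g).

(* K-linear exact faithful symmetric monoidal functor to finite-dimensional   *)
(* K-vector spaces.  MathComp has no tensor product of vector spaces: the     *)
(* monoidal structure isomorphism of the functor is given as a universal      *)
(* bilinear map fmul, i.e. fob (X ⊗ Y) is a tensor product of fob X and fob Y.*)
Record fiberFunctor (K : fieldType) (C : tensCat K) := FiberFunctor {
  fob : C -> vectType K;
  fmor : forall X Y : C, hom X Y -> 'Hom(fob X, fob Y);
  fmor_id : forall X, fmor (idm X) = \1%VF;
  fmor_comp : forall X Y Z (g : hom Y Z) (f : hom X Y),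
    fmor (g ∘ f) = (fmor g \o fmor f)%VF;
  fmor_linear : forall X Y, linear (@fmor X Y);
  fmor_faithful : forall X Y, injective (@fmor X Y);
  fmor_exact : forall X E Y (i : hom X E) (p : hom E Y), short_exact i p ->
    [/\ lker (fmor i) = 0%VS, limg (fmor i) = lker (fmor p)
      & limg (fmor p) = fullv];
  fmul : forall X Y, fob X -> fob Y -> fob (X ⊗ Y);
  fmul_linear_l : forall X Y (y : fob Y), linear (fun x : fob X => fmul x y);
  fmul_linear_r : forall X Y (x : fob X), linear (fun y : fob Y => fmul x y);
  fmul_universal : forall X Y (W : vectType K) (b : fob X -> fob Y -> W),
    (forall y, linear (fun x => b x y)) -> (forall x, linear (b x)) ->
    exists! f : 'Hom(fob (X ⊗ Y), W), forall x y, f (fmul x y) = b x y;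
  fmul_nat : forall X X' Y Y' (f : hom X X') (g : hom Y Y') x y,
    fmor (f ⊗' g) (fmul x y) = fmul (fmor f x) (fmor g y);
  fone : fob (one_ C);
  fone_basis : forall v : fob (one_ C), exists! c : K, v = c *: fone;
  fmul_lunit : forall X (x : fob X), fmor (lunit X) (fmul fone x) = x;
  fmul_runit : forall X (x : fob X), fmor (runit X) (fmul x fone) = x;
  fmul_assoc : forall X Y Z (x : fob X) (y : fob Y) (z : fob Z),
    fmor (assoc X Y Z) (fmul (fmul x y) z) = fmul x (fmul y z);
  fmul_braid : forall X Y (x : fob X) (y : fob Y),
    fmor (braid X Y) (fmul x y) = fmul y x
}.

Record neutralTannakian (K : fieldType) := NeutralTannakian {
  tann_tens :> tensCat K;
  tann_fiber : inhabited (fiberFunctor tann_tens)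
}.

Record filteredTannakian (K : fieldType) := FilteredTannakian {
  filt_tann :> neutralTannakian K;
  W : int -> filt_tann -> filt_tann;
  Wm : forall n (X Y : filt_tann), hom X Y -> hom (W n X) (W n Y);
  Wm_id : forall n X, Wm n (idm X) = idm (W n X);
  Wm_comp : forall n X Y Z (g : hom Y Z) (f : hom X Y),
    Wm n (g ∘ f) = Wm n g ∘ Wm n f;
  Wm_linear : forall n X Y, linear (@Wm n X Y);
  Wm_exact : forall n X E Y (i : hom X E) (p : hom E Y),
    short_exact i p -> short_exact (Wm n i) (Wm n p);
  Wi : forall n X, hom (W n X) X;
  Wi_mono : forall n X, is_mono (Wi n X);
  Wi_nat : forall n X Y (f : hom X Y), Wi n Y ∘ Wm n f = f ∘ Wi n X;
  W_increasing : forall n X,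
    exists j : hom (W n X) (W (n + 1) X), Wi (n + 1) X ∘ j = Wi n X;
  W_low : forall X, exists N : int, forall n, n <= N -> is_zero (W n X);
  W_high : forall X, exists N : int, forall n, N <= n -> is_iso (Wi n X);
  (* W_n(X ⊗ Y) is the sum, i.e. the least upper bound among subobjects of    *)
  (* X ⊗ Y, of the W_p X ⊗ W_q Y with p + q = n.                              *)
  W_tens_ge : forall n X Y p q, p + q = n ->
    exists j : hom (W p X ⊗ W q Y) (W n (X ⊗ Y)),
      Wi n (X ⊗ Y) ∘ j = Wi p X ⊗' Wi q Y;
  W_tens_le : forall n X Y S (s : hom S (X ⊗ Y)), is_mono s ->
    (forall p q, p + q = n ->
       exists j : hom (W p X ⊗ W q Y) S, s ∘ j = Wi p X ⊗' Wi q Y) ->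
    exists j : hom (W n (X ⊗ Y)) S, s ∘ j = Wi n (X ⊗ Y)
}.

Definition pure (K : fieldType) (T : filteredTannakian K) (n : int) (X : T) :=
  is_zero (W (n - 1) X) /\ is_iso (Wi n X).

Section Extensions.
Variables (K : fieldType) (C : abCat K).

(* Candidate extension of Y by X; exactness is the separate predicate [exact].*)
Record extSeq (Y X : C) := ExtSeq {
  mid : C;
  inc : hom X mid;
  prj : hom mid Y
}.

Definition exact Y X (E : extSeq Y X) := short_exact (inc E) (prj E).

Record ext (Y X : C) := Ext {
  ext_seq :> extSeq Y X;
  ext_exact : exact ext_seq
}.

Definition ext_mor Y X Y' X' (E : extSeq Y X) (E' : extSeq Y' X')
    (a : hom X X') (b : hom Y Y') (h : hom (mid E) (mid E')) :=
  h ∘ inc E = inc E' ∘ a /\ prj E' ∘ h = b ∘ prj E.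

Arguments ext_mor {Y X Y' X'} E E' a b h.

Definition ext_equiv Y X (E E' : ext Y X) :=
  exists h, is_iso h /\ ext_mor E E' (idm X) (idm Y) h.

(* a_* E and b^* E are characterised, up to equivalence of extensions, by the *)
(* existence of a morphism of extensions (a, h, 1) : E -> a_* E, respectively *)
(* (1, h, b) : b^* E -> E.                                                    *)
Definition is_pushforward Y X X' (a : hom X X') (E : extSeq Y X)
    (E' : extSeq Y X') :=
  exact E' /\ exists h, ext_mor E E' a (idm Y) h.

Definition split Y X (E : extSeq Y X) := exists s, prj E ∘ s = idm Y.

Definition ext_sum Y X (E E' : extSeq Y X) : extSeq (bip Y Y) (bip X X) :=
  ExtSeq (bipm (inc E) (inc E')) (bipm (prj E) (prj E')).

(* E3 is the Baer sum codiag_* diag^* (E1 + E2). *)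
Definition is_baer_sum Y X (E1 E2 E3 : extSeq Y X) :=
  exists (P : extSeq Y (bip X X)) h q,
    [/\ exact P,
        ext_mor P (ext_sum E1 E2) (idm (bip X X)) (diag Y) h
      & ext_mor P E3 (codiag X) (idm Y) q].

End Extensions.

Arguments ext_mor {K C Y X Y' X'} E E' a b h.

Section TotallyNonsplit.
Variables (K : fieldType) (C : tensCat K).

(* Pushforward along X -> X/X', for every proper subobject X' of X. *)
Definition totally_nonsplit1 (X : C) (E : extSeq (one_ C) X) :=
  forall X' (j : hom X' X) Q (q : hom X Q) (E' : extSeq (one_ C) Q),
    is_mono j -> ~ is_iso j -> is_cokernel q j ->
    is_pushforward q E E' -> ~ split E'.

(* Internal Hom; it represents Z |-> hom (Z ⊗ Y) X by ev and coev. *)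
Definition ihom (Y X : C) : C := X ⊗ dual Y.

(* E' corresponds to E under Ext^1(Y, X) = Ext^1(1, ihom Y X): it is the      *)
(* pullback of E ⊗ dual Y along coev : 1 -> Y ⊗ dual Y.                       *)
Definition corresponds (Y X : C) (E : extSeq Y X)
    (E' : extSeq (one_ C) (ihom Y X)) :=
  exact E' /\
  exists h, ext_mor E'
    (ExtSeq (inc E ⊗' idm (dual Y)) (prj E ⊗' idm (dual Y)))
    (idm (ihom Y X)) (coev Y) h.

Definition totally_nonsplit (Y X : C) (E : extSeq Y X) :=
  forall E', corresponds E E' -> totally_nonsplit1 E'.

End TotallyNonsplit.

Local Open Scope classical_set_scope.

Definition is_equiv U (R : U -> U -> Prop) :=
  [/\ forall x, R x x, forall x y, R x y -> R y x
    & forall x y z, R x y -> R y z -> R x z].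

Definition classes U (R : U -> U -> Prop) :=
  {c : set U | exists x, c = [set y | R x y]}.

Lemma classes_eq U (R : U -> U -> Prop) (c c' : classes R) :
  sval c = sval c' -> c = c'.
Proof. by case: c c' => [c cP] [c' c'P] /= E; exact: eq_exist. Qed.

Lemma classes_image_subproof U V (R : U -> U -> Prop) (R' : V -> V -> Prop)
    (F : U -> V) (eR : is_equiv R) (eR' : is_equiv R')
    (FP : forall x y, R x y -> R' (F x) (F y)) (c : classes R) :
  exists z, [set y | exists2 x, sval c x & R' (F x) y] = [set y | R' z y].
Proof.
case: eR => rR _ _; case: eR' => _ _ tR'.
case: c => c [x /= ->]; exists (F x); apply/seteqP; split=> y /=.
  by case=> x' xx'; apply: tR'; exact: FP.
by exists x.
Qed.

Definition classes_image U V (R : U -> U -> Prop) (R' : V -> V -> Prop)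
    (F : U -> V) eR eR' FP (c : classes R) : classes R' :=
  exist _ _ (@classes_image_subproof U V R R' F eR eR' FP c).

Definition Ext1 (K : fieldType) (C : abCat K) (Y X : C) :=
  classes (@ext_equiv K C Y X).

Definition baer (K : fieldType) (C : abCat K) (Y X : C) (x y z : Ext1 Y X) :=
  exists E1 E2 E3,
    [/\ sval x E1, sval y E2, sval z E3 & is_baer_sum E1 E2 E3].

(* [add] is (the graph of) a commutative group law on G, [act] restricts to   *)
(* (the graph of) an action of this group on the subset S of U, and that      *)
(* action is simply transitive on the nonempty set S.                         *)
Definition is_torsor (G : Type) (add : G -> G -> G -> Prop)
    (U : Type) (act : G -> U -> U -> Prop) (S : set U) :=
  exists (op : G -> G -> G) (e : G) (inv : G -> G) (f : G -> U -> U),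
    [/\ forall a b c, add a b c <-> op a b = c,
        [/\ associative op, commutative op, left_id e op & left_inverse e inv op],
        forall g s, S s -> S (f g s) /\ forall t, act g s t <-> f g s = t,
        (forall s, S s -> f e s = s) /\
        (forall g h s, S s -> f (op g h) s = f g (f h s))
      & S !=set0 /\ forall s t, S s -> S t -> exists! g, f g s = t].

Section GeneralizedExtensions.
Variables (K : fieldType) (C : tensCat K) (k : nat) (A : nat -> C).

(* The object X_{m,n} (0 <= m < n <= k, n - m <= l + 1) is indexed by m and   *)
(* d := n - m - 1, and written X m d below; thus X_{r-1,r} is X r.-1 0 = A r, *)
(* definitionally.  Objects and arrows are total in m and d, but only those   *)
(* in range are subject to any condition, and no notion below looks at the    *)
(* others.                                                                    *)
Definition in_range (l m d : nat) := (d <= l)%N && (m + d < k)%N.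

Definition gob (B : nat -> nat -> C) (m d : nat) : C :=
  if d is d'.+1 then B m d' else A m.+1.

(* The index n = m + d + 1, computed along X_{m,n} -> X_{m+1,n} -> ... *)
Fixpoint top (m d : nat) : nat := if d is d'.+1 then top m.+1 d' else m.+1.

Lemma topE m d : top m d = (m + d).+1.
Proof. by elim: d m => [|d IHd] m /=; rewrite ?addn0 // IHd addSnnS. Qed.

(* The composite X_{m,n} -> X_{m+1,n} -> ... -> X_{n-1,n} = A_n. *)
Fixpoint to_top B (epi : forall m d, hom (gob B m d.+1) (gob B m.+1 d))
    (m d : nat) {struct d} : hom (gob B m d) (A (top m d)) :=
  match d with
  | 0 => idm (A m.+1)
  | d'.+1 => to_top epi m.+1 d' ∘ epi m d'
  end.

(* The composite A_{m+1} = X_{m,m+1} -> X_{m,m+2} -> ... -> X_{m,n}. *)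
Fixpoint from_bot B (mono : forall m d, hom (gob B m d) (gob B m d.+1))
    (m d : nat) {struct d} : hom (A m.+1) (gob B m d) :=
  match d with
  | 0 => idm (A m.+1)
  | d'.+1 => mono m d' ∘ from_bot mono m d'
  end.

(* Objects of D_l(A). *)
Record gext (l : nat) := GExt {
  upper : nat -> nat -> C;
  epi : forall m d, hom (gob upper m d.+1) (gob upper m.+1 d);
  mono : forall m d, hom (gob upper m d) (gob upper m d.+1);
  epiP : forall m d, in_range l m d.+1 -> is_epi (epi m d);
  monoP : forall m d, in_range l m d.+1 -> is_mono (mono m d);
  squareP : forall m d, in_range l m d.+2 ->
    epi m d.+1 ∘ mono m d.+1 = mono m.+1 d ∘ epi m d;
  vexactP : forall m d, in_range l m d.+1 ->
    short_exact (mono m d) (to_top epi m d.+1)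
}.

Arguments epiP {l} g {m d} _.
Arguments monoP {l} g {m d} _.
Arguments squareP {l} g {m d} _.
Arguments vexactP {l} g {m d} _.

Definition gX l (X : gext l) := gob (upper X).

(* The sequences X^v_{m,n} and X^h_{m,n}, for n = m + d + 2. *)
Definition vseq l (X : gext l) m d : extSeq (A (top m d.+1)) (gX X m d) :=
  ExtSeq (mono X m d) (to_top (epi X) m d.+1).

Definition hseq l (X : gext l) m d : extSeq (gX X m.+1 d) (A m.+1) :=
  ExtSeq (from_bot (mono X) m d.+1) (epi X m d).

Definition gext_totally_nonsplit l (X : gext l) :=
  forall m d, in_range l m d.+1 ->
    totally_nonsplit (vseq X m d) /\ totally_nonsplit (hseq X m d).

Definition gfam l (X X' : gext l) := forall m d, hom (gX X m d) (gX X' m d).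

Definition is_gmor l (X X' : gext l) (f : gfam X X') :=
  forall m d, in_range l m d.+1 ->
    epi X' m d ∘ f m d.+1 = f m.+1 d ∘ epi X m d /\
    mono X' m d ∘ f m d = f m d.+1 ∘ mono X m d.

Record giso l (X X' : gext l) := GIso {
  gfun : gfam X X';
  ginv : gfam X' X;
  gfun_mor : is_gmor gfun;
  ginv_mor : is_gmor ginv;
  gfunK : forall m d, in_range l m d -> mutually_inverse (gfun m d) (ginv m d)
}.

Definition gaut l (X : gext l) := giso X X.

Definition id_on_A l (X X' : gext l) (f : giso X X') :=
  forall m, (m < k)%N -> gfun f m 0 = idm (A m.+1).

Definition gisom l (X X' : gext l) : Prop := inhabited (giso X X').

Definition gisom' l (X X' : gext l) := exists f : giso X X', id_on_A f.

Definition giso_id l (X : gext l) : giso X X.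
Proof.
by exists (fun m d => idm (gX X m d)) (fun m d => idm (gX X m d)) => m d _;
  rewrite /mutually_inverse ?compm1 ?comp1m.
Defined.

Definition giso_sym l (X X' : gext l) (f : giso X X') : giso X' X.
Proof.
by case: f => f g fP gP fK; exists g f => // m d /fK [].
Defined.

Definition giso_comp l (X X' X'' : gext l) (g : giso X' X'') (f : giso X X') :
  giso X X''.
Proof.
exists (fun m d => gfun g m d ∘ gfun f m d) (fun m d => ginv f m d ∘ ginv g m d).
- move=> m d r; have [fe fm] := gfun_mor f r; have [ge gm] := gfun_mor g r.
  by split; rewrite compA ?ge ?gm -[LHS]compA ?fe ?fm compA.
- move=> m d r; have [fe fm] := ginv_mor f r; have [ge gm] := ginv_mor g r.
  by split; rewrite compA ?fe ?fm -[LHS]compA ?ge ?gm compA.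
- move=> m d r; have [f1 f2] := gfunK f r; have [g1 g2] := gfunK g r; split.
    by rewrite compA -[X in X ∘ _]compA g1 compm1.
  by rewrite compA -[X in X ∘ _]compA f2 compm1.
Defined.

Lemma gisom_equiv l : is_equiv (@gisom l).
Proof.
split; first by move=> X; split; exact: giso_id.
  by move=> X Y [f]; split; exact: giso_sym.
by move=> X Y Z [f] [g]; split; exact: (giso_comp g f).
Qed.

Lemma gisom'_equiv l : is_equiv (@gisom' l).
Proof.
split; first by move=> X; exists (giso_id X).
  move=> X Y [f f1]; exists (giso_sym f) => m mk.
  have r : in_range l m 0 by rewrite /in_range addn0.
  have [] := gfunK f r; move: (f1 m mk) => /= ->; case: f {f1} => f g /= _ _ _.
  by rewrite compm1.
move=> X Y Z [f f1] [g g1]; exists (giso_comp g f) => m mk /=.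
by rewrite f1 // g1 //; exact: comp1m.
Qed.

Definition gS l := classes (@gisom l).
Definition gS' l := classes (@gisom' l).

Lemma gisom'W l (X X' : gext l) : gisom' X X' -> gisom X X'.
Proof. by case=> f _; split. Qed.

(* The natural map S'_l(A) -> S_l(A). *)
Definition forget l : gS' l -> gS l :=
  classes_image (gisom'_equiv l) (gisom_equiv l) (@gisom'W l).

Lemma in_rangeW l m d : in_range l.-1 m d -> in_range l m d.
Proof.
by case/andP=> dl mk; apply/andP; split=> //; exact: leq_trans (leq_pred _).
Qed.

(* Truncation: the objects X_{r-1,r+l} are no longer in range. *)
Definition trunc l (X : gext l) : gext l.-1 :=
  @GExt l.-1 (upper X) (epi X) (mono X)
    (fun m d r => epiP X (in_rangeW r))
    (fun m d r => monoP X (in_rangeW r))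
    (fun m d r => squareP X (in_rangeW r)) (fun m d r => vexactP X (in_rangeW r)).

Definition trunc_iso l (X X' : gext l) (f : giso X X') :
    giso (trunc X) (trunc X') :=
  @GIso _ (trunc X) (trunc X') (gfun f) (ginv f)
    (fun m d r => gfun_mor f (in_rangeW r)) (fun m d r => ginv_mor f (in_rangeW r))
    (fun m d r => gfunK f (in_rangeW r)).

Lemma trunc_isom l (X X' : gext l) : gisom X X' -> gisom (trunc X) (trunc X').
Proof. by case=> f; split; exact: trunc_iso. Qed.

Lemma trunc_isom' l (X X' : gext l) : gisom' X X' -> gisom' (trunc X) (trunc X').
Proof. by case=> f f1; exists (trunc_iso f). Qed.

Definition Theta l : gS l -> gS l.-1 :=
  classes_image (gisom_equiv l) (gisom_equiv l.-1) (@trunc_isom l).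

Definition Theta' l : gS' l -> gS' l.-1 :=
  classes_image (gisom'_equiv l) (gisom'_equiv l.-1) (@trunc_isom' l).

Definition class_totally_nonsplit l (c : gS l) :=
  forall X, sval c X -> gext_totally_nonsplit X.

Section Twist.
Variables (l : nat) (Y : gext l) (s : gaut (trunc Y)).

Definition twist_epi m d : hom (gX Y m d.+1) (gX Y m.+1 d) :=
  if d.+1 == l then gfun s m.+1 d ∘ epi Y m d else epi Y m d.

Definition twist_mono m d : hom (gX Y m d) (gX Y m d.+1) :=
  if d.+1 == l then mono Y m d ∘ ginv s m d else mono Y m d.

Lemma twist_epiP m d : in_range l m d.+1 -> is_epi (twist_epi m d).
Proof.
move=> r; rewrite /twist_epi; case: ifP => [/eqP dl|_]; last exact: epiP.
have r' : in_range l.-1 m.+1 d by move: r; rewrite /in_range; lia.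
have [_ gK] := gfunK s r' => Z u v; rewrite !compA => /(epiP Y r) uv.
by rewrite -(compm1 u) -(compm1 v) -gK !compA uv.
Qed.

Lemma twist_monoP m d : in_range l m d.+1 -> is_mono (twist_mono m d).
Proof.
move=> r; rewrite /twist_mono; case: ifP => [/eqP dl|_]; last exact: monoP.
have r' : in_range l.-1 m d by move: r; rewrite /in_range; lia.
have [_ gK] := gfunK s r' => Z u v; rewrite -!compA => /(monoP Y r) uv.
by rewrite -(comp1m u) -(comp1m v) -gK -!compA uv.
Qed.

Lemma twist_squareP m d : in_range l m d.+2 ->
  twist_epi m d.+1 ∘ twist_mono m d.+1 = twist_mono m.+1 d ∘ twist_epi m d.
Proof.
move=> r; have sq := squareP Y r; rewrite /twist_epi /twist_mono.
have -> : (d.+1 == l) = false by move: r; rewrite /in_range; lia.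
case: eqP => // dl.
have r' : in_range l.-1 m d.+1 by move: r; rewrite /in_range; lia.
have r'' : in_range l.-1 m.+1 d.+1 by move: r; rewrite /in_range; lia.
have [_ gK] := gfunK s r'; have [se _] := gfun_mor s r'.
have [_ sm] := gfun_mor s r''; move: gK se sm => /= gK se sm.
rewrite -compA [X in _ ∘ X]compA sq !compA -sm -[X in X ∘ _]compA -se.
by rewrite -!compA gK compm1.
Qed.

Lemma twist_to_top m d : (d < l)%N ->
  to_top twist_epi m d = to_top (epi Y) m d.
Proof.
elim: d m => [|d IHd] m //= dl; rewrite IHd ?(ltnW dl) //.
by rewrite /twist_epi (ltn_eqF dl).
Qed.

Lemma gmor_to_top m d : in_range l.-1 m d ->
  exists2 a, is_iso a & to_top (epi Y) m d ∘ gfun s m d = a ∘ to_top (epi Y) m d.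
Proof.
elim: d m => [|d IHd] m r /=.
  exists (gfun s m 0); last by rewrite compm1 comp1m.
  by exists (ginv s m 0); exact: (gfunK s r).
have [|a ia ea] := IHd m.+1; first by move: r; rewrite /in_range; lia.
exists a => //; have [/= se _] := gfun_mor s r.
by rewrite -compA se !compA ea.
Qed.

Lemma twist_vexactP m d : in_range l m d.+1 ->
  short_exact (twist_mono m d) (to_top twist_epi m d.+1).
Proof.
move=> r; have := vexactP Y r; rewrite /= twist_to_top; last first.
  by move: r; rewrite /in_range; lia.
rewrite /twist_mono /twist_epi; case: eqP => // dl.
have r1 : in_range l.-1 m d by move: r; rewrite /in_range; lia.
have [|a ia ea] := @gmor_to_top m.+1 d.
  by move: r; rewrite /in_range; lia.
rewrite [X in _ -> short_exact _ X]compA ea -compA.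
apply: short_exact_iso ia; exists (gfun s m d).
by have [] := gfunK s r1.
Qed.

(* The object obtained from Y by letting s act on its top arrows. *)
Definition twist : gext l :=
  GExt twist_epiP twist_monoP twist_squareP twist_vexactP.

Lemma trunc_twist : gisom' (trunc Y) (trunc twist).
Proof.
have tE m d : in_range l.-1 m d.+1 ->
    epi twist m d = epi Y m d /\ mono twist m d = mono Y m d.
  move=> r; rewrite /= /twist_epi /twist_mono.
  by have -> : (d.+1 == l) = false by move: r; rewrite /in_range; lia.
unshelve eexists (@GIso _ (trunc Y) (trunc twist)
  (fun m d => idm (gX Y m d)) (fun m d => idm (gX Y m d)) _ _ _) => // m d r.
- by have [/= -> ->] := tE _ _ r; rewrite !compm1 !comp1m.
- by have [/= -> ->] := tE _ _ r; rewrite !compm1 !comp1m.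
- by split; rewrite comp1m.
Qed.

End Twist.

Definition conjugates l (X X' : gext l) (f : giso X X') (s : gaut X)
    (s' : gaut X') :=
  forall m d, in_range l m d -> gfun s' m d ∘ gfun f m d = gfun f m d ∘ gfun s m d.

Lemma twist_isom' l (Y Y' : gext l) (f : giso Y Y') (s : gaut (trunc Y))
    (s' : gaut (trunc Y')) :
  id_on_A f -> conjugates (trunc_iso f) s s' -> gisom' (twist s) (twist s').
Proof.
move=> f1 fs.
have fs1 m d : in_range l.-1 m d ->
    ginv s' m d ∘ gfun f m d = gfun f m d ∘ ginv s m d.
  move=> r; have /= [s1 s2] := gfunK s r; have /= [s1' s2'] := gfunK s' r.
  move: (fs m d r) => /= E.
  by rewrite -[LHS]compm1 -s2 compA -[X in X ∘ _]compA -E compA s1' comp1m.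
have sf m d : in_range l.-1 m d ->
    gfun s m d ∘ ginv f m d = ginv f m d ∘ gfun s' m d.
  move=> r; have /= [f2 f3] := gfunK f (in_rangeW r).
  move: (fs m d r) => /= E.
  by rewrite -[LHS]comp1m -f2 compA -[X in X ∘ _]compA -E -!compA f3 compm1.
have sf1 m d : in_range l.-1 m d ->
    ginv s m d ∘ ginv f m d = ginv f m d ∘ ginv s' m d.
  move=> r; have /= [f2 f3] := gfunK f (in_rangeW r).
  move: (fs1 m d r) => /= E.
  by rewrite -[LHS]comp1m -f2 compA -[X in X ∘ _]compA -E -!compA f3 compm1.
have rg m d : in_range l m d.+1 -> d.+1 = l ->
    in_range l.-1 m.+1 d /\ in_range l.-1 m d by rewrite /in_range; lia.
unshelve eexists (@GIso _ (twist s) (twist s') (gfun f) (ginv f) _ _ _).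
- move=> m d r; have [fe fm] := gfun_mor f r.
  rewrite /= /twist_epi /twist_mono; case: eqP => // dl.
  have [r1 r2] := rg _ _ r dl; split.
    by rewrite -compA fe compA (fs _ _ r1) -compA.
  by rewrite -compA fs1 // compA fm compA.
- move=> m d r; have [fe fm] := ginv_mor f r.
  rewrite /= /twist_epi /twist_mono; case: eqP => // dl.
  have [r1 r2] := rg _ _ r dl; split.
    by rewrite -compA fe compA sf // -compA.
  by rewrite -compA sf1 // compA fm compA.
- by move=> m d r; exact: (gfunK f r).
- by move=> m mk; exact: (f1 m mk).
Qed.

(* Gamma(c): compatible families of automorphisms of the representatives of   *)
(* c, i.e. the limit of the groups Aut(X) along the unique isomorphisms that  *)
(* are the identity on all A r.                                               *)
Record Gamma l (c : gS' l) := GammaElt {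
  gam : forall X, sval c X -> gaut X;
  gam_compat : forall X X' (cX : sval c X) (cX' : sval c X') (f : giso X X'),
    id_on_A f -> conjugates f (gam cX) (gam cX')
}.

Definition fiber' l (e : gS' l.-1) := {c : gS' l | Theta' c = e}.

Section GammaAction.
Variables (l : nat) (e : gS' l.-1) (g : Gamma e).

Lemma fiber'_trunc (c : fiber' e) Y : sval (sval c) Y -> sval e (trunc Y).
Proof.
case: c => c /= <- cY; exists Y => //.
by have [r _ _] := gisom'_equiv l.-1; exact: r.
Qed.

Definition Gamma_act_set (c : fiber' e) : set (gext l) :=
  [set Z | exists Y (cY : sval (sval c) Y),
             gisom' (twist (gam g (fiber'_trunc cY))) Z].

Lemma Gamma_act_class c : exists X, Gamma_act_set c = [set Y | gisom' X Y].
Proof.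
have [r s t] := gisom'_equiv l.
have [Y cYE] := svalP (sval c); have cY : sval (sval c) Y by rewrite cYE; exact: r.
exists (twist (gam g (fiber'_trunc cY))); apply/seteqP; split=> Z /=; last first.
  by move=> YZ; exists Y, cY.
case=> Y' [cY']; apply: t.
have [f f1] : gisom' Y Y' by move: (cY'); rewrite cYE.
by apply: (twist_isom' f1); exact: gam_compat.
Qed.

Lemma Gamma_act_fiber c :
  Theta' (exist _ _ (Gamma_act_class c) : gS' l) = e.
Proof.
have [r s t] := gisom'_equiv l; have [r' s' t'] := gisom'_equiv l.-1.
have [Y cYE] := svalP (sval c); have cY : sval (sval c) Y by rewrite cYE; exact: r.
have eY := fiber'_trunc cY.
apply: classes_eq => /=; have [X eE] := svalP e.
have XY : gisom' X (trunc Y) by move: eY; rewrite eE.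
rewrite eE; apply/seteqP; split=> Z /=.
  case=> Z' [Y' [cY' YZ']] Z'Z; apply: (t' _ _ _ _ Z'Z).
  apply: (t' _ _ _ _ (trunc_isom' YZ')); apply: (t' _ _ _ _ (trunc_twist _)).
  by have := fiber'_trunc cY'; rewrite eE.
move=> XZ; exists (twist (gam g (fiber'_trunc cY))).
  by exists Y, cY; exact: r.
apply: (t' _ _ _ _ XZ); apply: (t' _ _ _ _ (s' _ _ XY)); apply: s'.
exact: trunc_twist.
Qed.

(* An element of the fiber is represented by some Y; Gamma acts on it through *)
(* the automorphisms of the representative trunc Y of e.                      *)
Definition Gamma_act (c : fiber' e) : fiber' e :=
  exist _ _ (Gamma_act_fiber c).

End GammaAction.

(* Translation at the top object X_{m,m+1+l} (d = l - 1), for the index       *)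
(* r = m + 1, of Y by the extension E of A_{r+l} by A_r: Y' is the result,    *)
(* where f identifies the truncations of Y and Y'.  Here F is the pullback of *)
(* E along omega : X_{m+1,m+1+l} -> A_{r+l}, the extension Y'^h is the Baer   *)
(* sum codiag_* diag^* (Y^h + F), and u is the inclusion of X_{m,m+l} into    *)
(* diag^* (Y^h + F) with components the inclusion into Y and the canonical    *)
(* section t of F over X_{m,m+l} -> X_{m+1,m+l} -> X_{m+1,m+1+l}, i.e. the    *)
(* one which is 0 in E.                                                       *)
Definition top_translate l (Y Y' : gext l) (f : giso (trunc Y) (trunc Y'))
    (m d : nat) (E : ext (A (top m.+1 d)) (A m.+1)) :=
  exists (F : extSeq (gX Y m.+1 d) (A m.+1)) (hF : hom (mid F) (mid E))
      (P : extSeq (gX Y m.+1 d) (bip (A m.+1) (A m.+1)))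
      (h : hom (mid P) (mid (ext_sum (hseq Y m d) F)))
      (q : hom (mid P) (mid (hseq Y' m d)))
      (t : hom (gX Y m d) (mid F)) (u : hom (gX Y m d) (mid P)),
    [/\ exact F /\ ext_mor F E (idm (A m.+1)) (to_top (epi Y) m.+1 d) hF,
        exact P /\ ext_mor P (ext_sum (hseq Y m d) F) (idm _) (diag _) h,
        ext_mor P (hseq Y' m d) (codiag _) (gfun f m.+1 d) q,
        prj F ∘ t = epi Y m d ∘ mono Y m d /\ hF ∘ t = 0
      & h ∘ u = inl_ ∘ mono Y m d + inr_ ∘ t /\
        q ∘ u = mono Y' m d ∘ gfun f m d].

(* The product of the groups Ext^1(A_{r+l}, A_r), r = m + 1 = 1, ..., k - l.  *)
Definition prodExt1 l :=
  forall m : 'I_(k - l), Ext1 (A (top m.+1 l.-1)) (A m.+1).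

Definition prodExt1_add l (x y z : prodExt1 l) := forall m, baer (x m) (y m) (z m).

(* x . c = c', for classes c, c' in the same fiber of Theta'. *)
Definition torsor_act' l (x : prodExt1 l) (c c' : gS' l) :=
  exists (Y Y' : gext l) (f : giso (trunc Y) (trunc Y')),
    [/\ sval c Y, sval c' Y', id_on_A f
      & forall m : 'I_(k - l), exists2 E, sval (x m) E & top_translate f E].

(* The same action, transferred along [forget] from the fiber of Theta' over  *)
(* e to the fiber of Theta.                                                   *)
Definition torsor_act l (e : gS' l.-1) (x : prodExt1 l) (c c' : gS l) :=
  exists b b', [/\ Theta' b = e, forget b = c, forget b' = c' & torsor_act' x b b'].

End GeneralizedExtensions.

(* Main.v *)
(* Work inside a fibre functor F, so that kernels, images and exactness are
   tested on elements.  Let E be a totally nonsplit extension of Y by X, where X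
   has weights below the weight of Y.  An endomorphism of E inducing a on X and b
   on Y makes phi = a (x) 1 - 1 (x) b^t on Hom(Y, X) kill the class of E; as
   Hom(1, coker phi) = 0 for weight reasons the class dies in the quotient im phi
   of Hom(Y, X), so phi = 0, and a, b are the same scalar.  Applied to the
   sequences X^v this shows that a totally nonsplit generalized extension has only
   scalar automorphisms.  Twisting by a scalar gives an equivalent object, and
   two lifts that are isomorphic differ by a scalar from being isomorphic by the
   identity on all A_r; this is the triviality of the action and the bijection.
   For the torsor: over a fixed truncation, the missing objects are independent
   blended extensions, on which Ext^1 acts simply transitively by Baer sum; the
   group law of Ext^1 itself is the special case of an extension regarded as
   a blended one. *)
From HB Require Import structures.
From mathcomp Require Import all_boot all_order all_algebra.
From mathcomp Require Import zify.
From mathcomp Require Import boolp classical_sets functions.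
Require Import Defs.

Set Implicit Arguments.
Unset Strict Implicit.
Unset Printing Implicit Defensive.

Import Order.TTheory GRing.Theory Num.Theory.
Local Open Scope ring_scope.

(** * Elements of a fibre functor *)

Section Abelian.
Variables (K : fieldType) (C : abCat K).
Implicit Types X Y Z : C.

(** Weights enter rigidity twice, both times through [hom_eq0]: a map from the unit to a quotient of
    [X ⊗ dual Y] vanishes, and so does a map [Y -> X]. The first use needs the weight of the unit,
    which is not part of the structure and is derived from [1 ⊗ 1 ≅ 1]. What shapes the torsor half
    is that objects are only comparable up to isomorphism. Two objects of one fibre have isomorphic,
    not equal, truncations, so their top objects are compared after conjugation by an identification
    [f] of the truncations; and since [gX Y m 0] is [A m.+1] by conversion, changing objects goes
    through a model whose bottom pieces are merely isomorphic to the [A r]. Sums are relations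
    witnessed by any object covering a fibre product: witnesses can then be composed and transported
    without comparing chosen pullbacks. Functions appear only at the end, by choice, once every
    relation is known to be total and single-valued. Rigidity returns there: it makes [f] unique, so
    that the action on classes is free. *)

Lemma compDl X Y Z (f : hom X Y) (g h : hom Y Z) : (g + h) ∘ f = g ∘ f + h ∘ f.
Proof. by have := comp_linear_l f 1 g h; rewrite /= !scale1r. Qed.

Lemma compDr X Y Z (g : hom Y Z) (f h : hom X Y) : g ∘ (f + h) = g ∘ f + g ∘ h.
Proof. by have := comp_linear_r g 1 f h; rewrite /= !scale1r. Qed.

Lemma compZl X Y Z c (f : hom X Y) (g : hom Y Z) : (c *: g) ∘ f = c *: (g ∘ f).
Proof. by have := comp_linear_l f c g 0; rewrite /= comp0m !addr0. Qed.

Lemma compZr X Y Z c (g : hom Y Z) (f : hom X Y) : g ∘ (c *: f) = c *: (g ∘ f).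
Proof. by have := comp_linear_r g c f 0; rewrite /= compm0 !addr0. Qed.

Lemma compNl X Y Z (f : hom X Y) (g : hom Y Z) : (- g) ∘ f = - (g ∘ f).
Proof. by rewrite -!scaleN1r compZl. Qed.

Lemma compNr X Y Z (g : hom Y Z) (f : hom X Y) : g ∘ (- f) = - (g ∘ f).
Proof. by rewrite -!scaleN1r compZr. Qed.

Lemma is_monoP X Y (f : hom X Y) :
  (forall Z (u : hom Z X), f ∘ u = 0 -> u = 0) -> is_mono f.
Proof.
move=> H Z u v uv; apply/eqP; rewrite -subr_eq0; apply/eqP/H.
by rewrite compDr compNr uv subrr.
Qed.

Lemma is_epiP X Y (f : hom X Y) :
  (forall Z (u : hom Y Z), u ∘ f = 0 -> u = 0) -> is_epi f.
Proof.
move=> H Z u v uv; apply/eqP; rewrite -subr_eq0; apply/eqP/H.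
by rewrite compDl compNl uv subrr.
Qed.

Lemma kernel_mono X Y N (i : hom N X) (f : hom X Y) : is_kernel i f -> is_mono i.
Proof.
move=> [fi0 ker] Z u v uv.
have [w [_ wU]] := ker Z (i ∘ u) (ltac:(by rewrite compA fi0 comp0m)).
by rewrite -(wU u erefl) (wU v).
Qed.

Lemma cokernel_epi X Y Q (q : hom Y Q) (f : hom X Y) : is_cokernel q f -> is_epi q.
Proof.
move=> [qf0 coker] Z u v uv.
have [w [_ wU]] := coker Z (u ∘ q) (ltac:(by rewrite -compA qf0 compm0)).
by rewrite -(wU u erefl) (wU v).
Qed.

(** [f] factors through the cokernel [q] of [i], so whatever [q] kills is killed by [f] and hence
    factors through [i]. *)
Lemma kernel_cokernel X Y Z Q (i : hom X Y) (f : hom Y Z) (q : hom Y Q) :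
  is_kernel i f -> is_cokernel q i -> is_kernel i q.
Proof.
move=> [fi0 ker] [qi0 coker]; split=> // V t qt0; apply: ker.
by have [m [<- _]] := coker _ f fi0; rewrite -compA qt0 compm0.
Qed.

Lemma cokernel_kernel X Y Z N (f : hom X Y) (q : hom Y Z) (i : hom N Y) :
  is_cokernel q f -> is_kernel i q -> is_cokernel q i.
Proof.
move=> [qf0 coker] [qi0 ker]; split=> // V t ti0; apply: coker.
by have [m [<- _]] := ker _ f qf0; rewrite compA ti0 comp0m.
Qed.

Lemma mono_exact X Y (f : hom X Y) : is_mono f ->
  exists Q (q : hom Y Q), short_exact f q.
Proof.
move=> /mono_normal [Z [g kg]]; have [Q [q cq]] := has_cokernel f.
by exists Q, q; split=> //; exact: kernel_cokernel kg cq.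
Qed.

Lemma epi_exact X Y (f : hom X Y) : is_epi f ->
  exists N (i : hom N X), short_exact i f.
Proof.
move=> /epi_normal [Z [g kg]]; have [N [i ki]] := has_kernel f.
by exists N, i; split=> //; exact: cokernel_kernel kg ki.
Qed.

(** The image is taken to be the coimage [Q], the cokernel of the kernel. To see that [m] is mono,
    let [c] be the cokernel of an [x] with [m ∘ x = 0]. The epi [c ∘ q] is the cokernel of some [g];
    since [f ∘ g = 0], [g] factors through the kernel [i], so [q] kills [g] and factors through
    [c ∘ q]. Thus [c] has a left inverse and [x = 0]. *)
Lemma epi_mono_factor X Y (f : hom X Y) :
  exists I (e : hom X I) (m : hom I Y), [/\ is_epi e, is_mono m & m ∘ e = f].
Proof.
have [N [i ki]] := has_kernel f; have [Q [q cq]] := has_cokernel i.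
have [fi0 ker] := ki; have [qi0 coker] := cq; have eq_ := cokernel_epi cq.
have [m [mq _]] := coker _ _ fi0.
exists Q, q, m; split=> //; apply: is_monoP => Z x mx0.
have [Q' [c cc]] := has_cokernel x; have [cx0 cU] := cc.
have [m' [m'c _]] := cU _ _ mx0.
have /epi_normal [G [g [cqg0 cg]]] : is_epi (c ∘ q).
  move=> V u v; rewrite !compA => /eq_; exact: (cokernel_epi cc).
have [g' [g'E _]] : exists! g', i ∘ g' = g.
  by apply: ker; rewrite -mq -m'c -[m' ∘ c ∘ q]compA -compA cqg0 compm0.
have [w [wE _]] : exists! w, w ∘ (c ∘ q) = q.
  by apply: cg; rewrite -g'E compA qi0 comp0m.
have wc : w ∘ c = idm Q by apply: eq_; rewrite -compA wE comp1m.
by rewrite -(comp1m x) -wc -compA cx0 compm0.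
Qed.

End Abelian.

Section Elements.
Variables (K : fieldType) (C : tensCat K) (F : fiberFunctor C).
Implicit Types X Y Z : C.

Lemma elD X Y (f g : hom X Y) x : fmor F (f + g) x = fmor F f x + fmor F g x.
Proof.
have := fmor_linear F 1 f g; rewrite !scale1r => ->.
by rewrite add_lfunE.
Qed.

Lemma el0 X Y x : fmor F (0 : hom X Y) x = 0.
Proof. by have := elD 0 (0 : hom X Y) x; rewrite addr0 -[LHS]addr0 => /addrI <-. Qed.

Lemma elZ X Y c (f : hom X Y) x : fmor F (c *: f) x = c *: fmor F f x.
Proof.
have := fmor_linear F c f 0; rewrite addr0 => ->.
by rewrite add_lfunE scale_lfunE el0 addr0.
Qed.

Lemma elN X Y (f : hom X Y) x : fmor F (- f) x = - fmor F f x.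
Proof. by rewrite -!scaleN1r elZ. Qed.

Lemma elB X Y (f g : hom X Y) x : fmor F (f - g) x = fmor F f x - fmor F g x.
Proof. by rewrite elD elN. Qed.

Lemma elM X Y Z (g : hom Y Z) (f : hom X Y) x :
  fmor F (g ∘ f) x = fmor F g (fmor F f x).
Proof. by rewrite fmor_comp comp_lfunE. Qed.

Lemma el1 X x : fmor F (idm X) x = x.
Proof. by rewrite fmor_id id_lfunE. Qed.

Lemma apD X Y (f : hom X Y) x y : fmor F f (x + y) = fmor F f x + fmor F f y.
Proof. exact: linearD. Qed.

Lemma apB X Y (f : hom X Y) x y : fmor F f (x - y) = fmor F f x - fmor F f y.
Proof. exact: linearB. Qed.

Lemma apN X Y (f : hom X Y) x : fmor F f (- x) = - fmor F f x.
Proof. exact: linearN. Qed.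

Lemma apZ X Y (f : hom X Y) c x : fmor F f (c *: x) = c *: fmor F f x.
Proof. exact: linearZ. Qed.

Lemma ap0 X Y (f : hom X Y) : fmor F f 0 = 0.
Proof. exact: linear0. Qed.

Definition elE := (elB, elD, elN, elZ, elM, el1, el0, apB, apD, apN, apZ, ap0).

Lemma el_eq X Y (f g : hom X Y) : (forall x, fmor F f x = fmor F g x) -> f = g.
Proof. by move=> fg; apply: (@fmor_faithful _ _ F); apply/lfunP. Qed.

Lemma el_congr X Y (f g : hom X Y) x : f = g -> fmor F f x = fmor F g x.
Proof. by move=> ->. Qed.

Lemma is_zeroP X : is_zero X <-> forall x : fob F X, x = 0.
Proof.
split=> [X0 x|X0]; first by rewrite -[x]el1 X0 el0.
by apply: el_eq => x; rewrite (X0 x) !linear0.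
Qed.

Definition inj X Y (f : hom X Y) := forall x, fmor F f x = 0 -> x = 0.
Definition surj X Y (f : hom X Y) := forall y, exists x, fmor F f x = y.
Definition el_exact X Y Z (i : hom X Y) (p : hom Y Z) :=
  (forall x, fmor F p (fmor F i x) = 0) /\
  (forall y, fmor F p y = 0 -> exists x, fmor F i x = y).

Lemma injE X Y (f : hom X Y) : inj f -> forall x y, fmor F f x = fmor F f y -> x = y.
Proof.
move=> fi x y xy; apply/eqP; rewrite -subr_eq0; apply/eqP/fi.
by rewrite linearB /= xy subrr.
Qed.

Lemma exact_diff X Y Z (i : hom X Y) (p : hom Y Z) :
  (forall y, fmor F p y = 0 -> exists x, fmor F i x = y) ->
  forall y y', fmor F p y = fmor F p y' -> exists x, y = y' + fmor F i x.
Proof.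
move=> pE y y' yy'; have [|x xE] := pE (y - y').
  by rewrite linearB /= yy' subrr.
by exists x; rewrite xE addrC subrK.
Qed.

Lemma short_exact_el X Y Z (i : hom X Y) (p : hom Y Z) :
  short_exact i p -> [/\ inj i, surj p & el_exact i p].
Proof.
move=> /(fmor_exact F) [i0 ip pT]; split.
- by move=> x /eqP; rewrite -memv_ker i0 memv0 => /eqP.
- move=> y; have : y \in limg (fmor F p) by rewrite pT memvf.
  by case/memv_imgP => x _ ->; exists x.
split=> [x|y /eqP].
  by apply/eqP; rewrite -memv_ker -ip; apply: memv_img; rewrite memvf.
by rewrite -memv_ker -ip => /memv_imgP [x _ ->]; exists x.
Qed.

Lemma is_mono_el X Y (f : hom X Y) : is_mono f <-> inj f.
Proof.
split; first by move=> /mono_exact [Q [q /short_exact_el [] //]].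
move=> fi; apply: is_monoP => Z u fu0; apply: el_eq => z; rewrite el0; apply: fi.
by rewrite -elM fu0 el0.
Qed.

Lemma is_epi_el X Y (f : hom X Y) : is_epi f <-> surj f.
Proof.
split; first by move=> /epi_exact [Q [q /short_exact_el [] //]].
move=> fs; apply: is_epiP => Z u uf0; apply: el_eq => z; have [x <-] := fs z.
by rewrite -elM uf0 !el0.
Qed.

(** [fmor_exact] speaks only of short exact sequences, so [f] is replaced by the epi [e] of its
    image factorisation, which has the same kernel. *)
Lemma kernel_el X Y N (i : hom N X) (f : hom X Y) :
  is_kernel i f -> inj i /\ el_exact i f.
Proof.
move=> ki; split; first exact/is_mono_el/(kernel_mono ki).
have [I [e [m [ee /is_mono_el mi mef]]]] := epi_mono_factor f.
have ke : short_exact i e.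
  have ke : is_kernel i e.
    have [fi0 ker] := ki; split.
      by apply: el_eq => x; rewrite el0; apply: mi; rewrite -!elM compA mef fi0 el0.
    by move=> Z t et0; apply: ker; rewrite -mef -compA et0 compm0.
  split=> //; have [Z [g ce]] := epi_normal ee; exact: cokernel_kernel ce ke.
have [_ _ [e0 eE]] := short_exact_el ke; split=> [x|y].
  by rewrite -mef elM e0 linear0.
by rewrite -mef elM => /mi; exact: eE.
Qed.

Lemma cokernel_el X Y Q (q : hom Y Q) (f : hom X Y) :
  is_cokernel q f -> surj q /\ el_exact f q.
Proof.
move=> cq; split; first exact/is_epi_el/(cokernel_epi cq).
have [I [e [m [/is_epi_el es mm mef]]]] := epi_mono_factor f.
have cm : is_cokernel q m.
  have [qf0 coker] := cq; split.
    by apply: el_eq => x; have [y <-] := es x; rewrite -elM -compA mef qf0 !el0.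
  by move=> Z t tm0; apply: coker; rewrite -mef compA tm0 comp0m.
have sm : short_exact m q.
  split=> //; have [Z [g km]] := mono_normal mm; exact: kernel_cokernel km cm.
have [_ _ [q0 qE]] := short_exact_el sm; split=> [x|y].
  by rewrite -mef elM q0.
by move=> /qE [x <-]; have [y' <-] := es x; exists y'; rewrite -mef elM.
Qed.

(** Pointwise preimages suffice, without any compatibility between them: [i] is the kernel of its
    cokernel [q], and [q ∘ t = 0] is tested on elements. Together with the dual [desc], this is how
    arrows of the category are obtained from computations with elements. *)
Lemma lift X Y Z (i : hom X Y) (t : hom Z Y) : inj i ->
  (forall z, exists x, fmor F i x = fmor F t z) -> exists u, i ∘ u = t.
Proof.
move=> /is_mono_el /mono_exact [Q [q se]] H; have [[_ ker] _] := se.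
have [_ _ [qi _]] := short_exact_el se.
have [|u [uE _]] := ker _ t; last by exists u.
by apply: el_eq => z; rewrite elM; have [x <-] := H z; rewrite qi el0.
Qed.

Lemma desc X Y Z (q : hom X Y) (t : hom X Z) : surj q ->
  (forall x, fmor F q x = 0 -> fmor F t x = 0) -> exists u, u ∘ q = t.
Proof.
move=> /is_epi_el /epi_exact [N [i se]] H; have [_ [_ coker]] := se.
have [_ _ [qi _]] := short_exact_el se.
have [|u [uE _]] := coker _ t; last by exists u.
by apply: el_eq => z; rewrite elM el0; apply: H; rewrite qi.
Qed.

Lemma el_short_exact X Y Z (i : hom X Y) (p : hom Y Z) :
  inj i -> surj p -> el_exact i p -> short_exact i p.
Proof.
move=> ii ps [pi0 pE].
have pi0' : p ∘ i = 0 by apply: el_eq => x; rewrite elM pi0 el0.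
split; split=> // V t t0.
- have [|u uE] := @lift _ _ _ i t ii.
    by move=> v; apply: pE; rewrite -elM t0 el0.
  exists u; split=> // u' u'E; move/is_mono_el: ii; apply.
  by rewrite uE u'E.
- have [|u uE] := @desc _ _ _ p t ps.
    by move=> v /pE [x <-]; rewrite -elM t0 el0.
  exists u; split=> // u' u'E; move/is_epi_el: ps; apply.
  by rewrite uE u'E.
Qed.

Lemma is_iso_el X Y (f : hom X Y) : is_iso f <-> inj f /\ surj f.
Proof.
split=> [[g [gf fg]]|[fi fs]].
  split=> [x fx0|y]; first by rewrite -[x]el1 -gf elM fx0 linear0.
  by exists (fmor F g y); rewrite -elM fg el1.
have [|g fg] := @lift _ _ _ f (idm Y) fi; first by move=> z; rewrite el1.
exists g; split=> //; apply: el_eq => x; apply: (injE fi).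
by rewrite -elM compA fg comp1m el1.
Qed.

Lemma el_bip X Y (x : fob F (bip X Y)) :
  x = fmor F inl_ (fmor F prl x) + fmor F inr_ (fmor F prr x).
Proof. by rewrite -!elM -elD bip_id el1. Qed.

Lemma el_prl_inl X Y x : fmor F prl (fmor F (@inl_ _ _ X Y) x) = x.
Proof. by rewrite -elM prl_inl el1. Qed.
Lemma el_prr_inr X Y x : fmor F prr (fmor F (@inr_ _ _ X Y) x) = x.
Proof. by rewrite -elM prr_inr el1. Qed.
Lemma el_prr_inl X Y x : fmor F prr (fmor F (@inl_ _ _ X Y) x) = 0.
Proof. by rewrite -elM prr_inl el0. Qed.
Lemma el_prl_inr X Y x : fmor F prl (fmor F (@inr_ _ _ X Y) x) = 0.
Proof. by rewrite -elM prl_inr el0. Qed.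

Definition bipE :=
  (el_prl_inl, el_prr_inr, el_prr_inl, el_prl_inr, ap0, addr0, add0r, oppr0).

(** The kernel of the difference on the biproduct. The fibre product is recorded both on elements,
    for computing, and by its universal property, for producing arrows. *)
Lemma pullback X Y Z (f : hom X Z) (g : hom Y Z) :
  exists P (a : hom P X) (b : hom P Y),
    [/\ f ∘ a = g ∘ b,
        forall x y, fmor F f x = fmor F g y ->
          exists p, fmor F a p = x /\ fmor F b p = y,
        forall p q, fmor F a p = fmor F a q -> fmor F b p = fmor F b q -> p = q
      & forall V (u : hom V X) (v : hom V Y), f ∘ u = g ∘ v ->
          exists w, a ∘ w = u /\ b ∘ w = v].
Proof.
have [P [i ki]] := has_kernel (f ∘ prl - g ∘ prr : hom (bip X Y) Z).
have [ii [iE0 iE]] := kernel_el ki; have [ki0 ku] := ki.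
exists P, (prl ∘ i), (prr ∘ i); split.
- apply/eqP; rewrite -subr_eq0 !compA; apply/eqP.
  by rewrite -ki0 compDl compNl.
- move=> x y xy.
  have [|p pE] := iE (fmor F inl_ x + fmor F inr_ y).
    by rewrite !elE !bipE xy subrr.
  by exists p; rewrite !elM pE !elE !bipE.
- move=> p q; rewrite !elM => p1 p2; apply: (injE ii).
  by rewrite [LHS]el_bip [RHS]el_bip p1 p2.
- move=> V u v uv.
  have [|w [wE _]] := ku _ (inl_ ∘ u + inr_ ∘ v).
    apply: el_eq => z.
    by rewrite !elE !bipE -!elM uv subrr.
  by exists w; rewrite -!compA wE; split; apply: el_eq => z;
    rewrite !elE !bipE.
Qed.

End Elements.

(** * Tensor products and duals on elements *)

Section Tensor.
Variables (K : fieldType) (C : tensCat K) (F : fiberFunctor C).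
Implicit Types X Y Z : C.

Lemma lfun_of_linear (U V : vectType K) (f : U -> V) :
  linear f -> exists g : 'Hom(U, V), g =1 f.
Proof.
move=> fl; pose fL : {linear U -> V} := HB.pack f (GRing.isLinear.Build _ _ _ _ f fl).
by exists (linfun fL) => x; rewrite lfunE.
Qed.

Lemma fmulDl X Y (x x' : fob F X) (y : fob F Y) :
  fmul (x + x') y = fmul x y + fmul x' y.
Proof. by have := fmul_linear_l y 1 x x'; rewrite !scale1r. Qed.

Lemma fmulDr X Y (x : fob F X) (y y' : fob F Y) :
  fmul x (y + y') = fmul x y + fmul x y'.
Proof. by have := fmul_linear_r x 1 y y'; rewrite !scale1r. Qed.

Lemma fmul0l X Y (y : fob F Y) : fmul (0 : fob F X) y = 0.
Proof. by have := fmulDl (0 : fob F X) 0 y; rewrite addr0 -[LHS]addr0 => /addrI <-. Qed.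

Lemma fmul0r X Y (x : fob F X) : fmul x (0 : fob F Y) = 0.
Proof. by have := fmulDr x (0 : fob F Y) 0; rewrite addr0 -[LHS]addr0 => /addrI <-. Qed.

Lemma fmulZl X Y c (x : fob F X) (y : fob F Y) : fmul (c *: x) y = c *: fmul x y.
Proof. by have := fmul_linear_l y c x 0; rewrite /= fmul0l !addr0. Qed.

Lemma fmulZr X Y c (x : fob F X) (y : fob F Y) : fmul x (c *: y) = c *: fmul x y.
Proof. by have := fmul_linear_r x c y 0; rewrite /= fmul0r !addr0. Qed.

Lemma fmul_suml X Y (I : finType) (x : I -> fob F X) (y : fob F Y) :
  fmul (\sum_i x i) y = \sum_i fmul (x i) y.
Proof.
elim/big_ind2: _ => //; first exact: fmul0l.
by move=> x1 x2 y1 y2 <- <-; rewrite fmulDl.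
Qed.

Lemma fmul_sumr X Y (I : finType) (x : fob F X) (y : I -> fob F Y) :
  fmul x (\sum_i y i) = \sum_i fmul x (y i).
Proof.
elim/big_ind2: _ => //; first exact: fmul0r.
by move=> x1 x2 y1 y2 <- <-; rewrite fmulDr.
Qed.

Lemma ap_sum X Y (f : hom X Y) (I : finType) (x : I -> fob F X) :
  fmor F f (\sum_i x i) = \sum_i fmor F f (x i).
Proof. exact: linear_sum. Qed.

Lemma tens_ext X Y (V : vectType K) (f g : 'Hom(fob F (X ⊗ Y), V)) :
  (forall x y, f (fmul x y) = g (fmul x y)) -> f = g.
Proof.
move=> fg; have [||h [_ hU]] := @fmul_universal _ _ F X Y V (fun x y => f (fmul x y)).
- by move=> y c x x'; rewrite fmulDl fmulZl linearP.
- by move=> x c y y'; rewrite fmulDr fmulZr linearP.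
by rewrite -(hU f) // -(hU g).
Qed.

(** Contracting the first factor with the i-th coordinate and tensoring back with the i-th basis
    vector, summed over i, is the identity of [fob F (X ⊗ Y)]: by [tens_ext] this need only be seen
    on pure tensors. *)
Lemma tens_decomp X Y (t : fob F (X ⊗ Y)) :
  exists n (x : 'I_n -> fob F X) (y : 'I_n -> fob F Y),
    t = \sum_i fmul (x i) (y i).
Proof.
pose b := vbasis {:fob F X}.
have bb : basis_of {:fob F X} b by exact: vbasisP.
have kE i : exists g : 'Hom(fob F (X ⊗ Y), fob F Y),
    forall x y, g (fmul x y) = coord b i x *: y.
  have [|x c y y'|g [gE _]] := @fmul_universal _ _ F X Y _ (fun x y => coord b i x *: y).
  - by move=> y c x x'; rewrite linearP /= scalerDl scalerA.
  - by rewrite scalerDr !scalerA mulrC.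
  by exists g.
have [k {}kE] := choice kE.
have mE (i : 'I_(\dim {:fob F X})) : exists g : 'Hom(fob F Y, fob F (X ⊗ Y)), g =1 fmul b`_i.
  by apply: lfun_of_linear => c y y'; rewrite fmulDr fmulZr.
have [m {}mE] := choice mE.
exists (\dim {:fob F X}), (fun i => b`_i), (fun i => k i t).
have : \1%VF = (\sum_i (m i \o k i)%VF) :> 'Hom(fob F (X ⊗ Y), _).
  apply: tens_ext => x y; rewrite id_lfunE sum_lfunE.
  rewrite [in LHS](coord_basis bb (memvf x)) fmul_suml; apply: eq_bigr => i _.
  by rewrite comp_lfunE mE kE fmulZl fmulZr.
move/lfunP/(_ t); rewrite id_lfunE sum_lfunE => {1}->.
by apply: eq_bigr => i _; rewrite comp_lfunE mE.
Qed.

Lemma tens_eq X Y Z (f g : hom (X ⊗ Y) Z) :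
  (forall x y, fmor F f (fmul x y) = fmor F g (fmul x y)) -> f = g.
Proof. by move=> fg; apply: (@fmor_faithful _ _ F); apply: tens_ext. Qed.

Lemma surj_tens X X' Y Y' (f : hom X X') (g : hom Y Y') :
  surj F f -> surj F g -> surj F (f ⊗' g).
Proof.
move=> fs gs t; have [n [x [y ->]]] := tens_decomp t.
have [x' x'E] := choice (fun i => fs (x i)).
have [y' y'E] := choice (fun i => gs (y i)).
exists (\sum_i fmul (x' i) (y' i)); rewrite ap_sum.
by apply: eq_bigr => i _; rewrite fmul_nat x'E y'E.
Qed.

Lemma lfun_tensl X X' Y (a : 'Hom(fob F X, fob F X')) :
  exists g : 'Hom(fob F (X ⊗ Y), fob F (X' ⊗ Y)),
    forall x y, g (fmul x y) = fmul (a x) y.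
Proof.
have [||g [gE _]] := @fmul_universal _ _ F X Y _ (fun x y => fmul (a x) y).
- by move=> y c x x'; rewrite linearP /= fmulDl fmulZl.
- by move=> x c y y'; rewrite fmulDr fmulZr.
by exists g.
Qed.

(** The sequence need not split in the category, but its fibres do: a linear section [s] and
    retraction [r'] tensor to linear maps [S] and [R], which prove exactness on elements. *)
Lemma tens_exact X E Y D (i : hom X E) (p : hom E Y) : short_exact i p ->
  short_exact (i ⊗' idm D) (p ⊗' idm D).
Proof.
move=> /(short_exact_el F) [ii ps [pi0 pE]].
pose s := ((fmor F p)^-1)%VF.
have sK y : fmor F p (s y) = y.
  by apply: (limg_lfunVK (f := fmor F p)); have [x <-] := ps y; rewrite memv_img ?memvf.
pose r := ((fmor F i)^-1)%VF.
have rK x : r (fmor F i x) = x by apply: (injE ii); apply: limg_lfunVK; rewrite memv_img ?memvf.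
(* [r] inverts [i] only on its image; precomposing with [1 - s p], which lands in that image, gives
   [i r' + s p = 1]. *)
pose r' := (r \o (\1 - (s \o fmor F p)))%VF.
have irsp e : fmor F i (r' e) + s (fmor F p e) = e.
  have [|x xE] := pE (e - s (fmor F p e)); first by rewrite apB sK subrr.
  rewrite /r' !comp_lfunE add_lfunE id_lfunE opp_lfunE comp_lfunE -xE rK xE.
  by rewrite subrK.
have [R RE] := lfun_tensl D r'; have [S SE] := lfun_tensl D s.
have r'K x : r' (fmor F i x) = x.
  by rewrite /r' !comp_lfunE add_lfunE id_lfunE opp_lfunE comp_lfunE pi0 linear0 subr0 rK.
have RSE t : fmor F (i ⊗' idm D) (R t) + S (fmor F (p ⊗' idm D) t) = t.
  have [n [x [y ->]]] := tens_decomp t.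
  rewrite !(linear_sum, ap_sum) -big_split; apply: eq_bigr => j _ /=.
  by rewrite fmul_nat el1 SE RE fmul_nat el1 -fmulDl irsp.
apply: (@el_short_exact _ _ F).
- move=> t t0; rewrite -(linear0 R) -t0; have [n [x [y ->]]] := tens_decomp t.
  rewrite ap_sum linear_sum; apply: eq_bigr => j _ /=.
  by rewrite fmul_nat RE r'K el1.
- by apply: surj_tens => // y; exists y; rewrite el1.
split=> [t|t t0].
  have [n [x [y ->]]] := tens_decomp t; rewrite !ap_sum big1 // => j _.
  by rewrite !fmul_nat pi0 fmul0l.
by exists (R t); rewrite -[RHS]RSE t0 linear0 addr0.
Qed.

Lemma braid_swap X X' Y Y' (f : hom X X') (g : hom Y Y') :
  braid Y' X' ∘ (g ⊗' f) ∘ braid X Y = f ⊗' g.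
Proof. by rewrite braid_nat -compA braid_sym compm1. Qed.

Lemma inj_tensl X X' D (i : hom X X') : inj F i -> inj F (i ⊗' idm D).
Proof.
move=> /is_mono_el /mono_exact [Q [q se]].
by have [] := short_exact_el F (tens_exact D se).
Qed.

Lemma inj_tensr X X' D (i : hom X X') : inj F i -> inj F (idm D ⊗' i).
Proof.
move=> ii t; rewrite -braid_swap !elM => t0.
have bi Y Z : inj F (braid Y Z) by move=> u u0; rewrite -[u]el1 -braid_sym elM u0 ap0.
exact/bi/(inj_tensl ii)/bi.
Qed.

Lemma functional (V : vectType K) (x : V) : x <> 0 ->
  exists l : V -> K^o, linear l /\ l x = 1.
Proof.
move=> x0; have [i xi] : exists i, coord (vbasis {:V}) i x != 0.
  apply: contrapT => H; apply: x0.
  rewrite (coord_basis (vbasisP _) (memvf x)) big1 // => i _.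
  have /negP := fun h => H (ex_intro _ i h).
  by rewrite negbK => /eqP ->; rewrite scale0r.
exists (fun z => (coord (vbasis {:V}) i x)^-1 * coord (vbasis {:V}) i z).
split; last by rewrite mulVf.
by move=> c u v; rewrite linearP /= mulrDr mulrCA.
Qed.

Lemma fmul_eq0 X Y (x : fob F X) (y : fob F Y) : fmul x y = 0 -> x <> 0 -> y = 0.
Proof.
move=> xy0 /functional [l [ll lx1]].
have [||g [gE _]] := @fmul_universal _ _ F X Y _ (fun x y => l x *: y).
- by move=> z c u v; rewrite ll scalerDl -scalerA.
- by move=> z c u v; rewrite scalerDr !scalerA mulrC.
by have := gE x y; rewrite xy0 linear0 lx1 scale1r.
Qed.

(** Contract the second factor with a functional [l] such that [l d = 1]: the hypothesis at [d]
    becomes [a x = l (b d) *: x]. *)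
Lemma fmul_scalar X D (a : fob F X -> fob F X) (b : fob F D -> fob F D) (d : fob F D) :
  (forall x e, fmul (a x) e = fmul x (b e)) -> d <> 0 ->
  exists c, forall x, a x = c *: x.
Proof.
move=> ab /functional [l [ll ld1]].
have [||g [gE _]] := @fmul_universal _ _ F X D _ (fun x y => l y *: x).
- by move=> z c u v; rewrite scalerDr !scalerA mulrC.
- by move=> z c u v; rewrite ll scalerDl -scalerA.
exists (l (b d)) => x.
by rewrite -(gE x (b d)) -ab gE ld1 scale1r.
Qed.

End Tensor.

Section Duality.
Variables (K : fieldType) (C : tensCat K) (F : fiberFunctor C) (Y : C).

Local Notation D := (dual Y).

Lemma ev_pair : exists pr : fob F D -> fob F Y -> K,
  forall e v, fmor F (ev Y) (fmul e v) = pr e v *: fone F.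
Proof.
have pE (ey : fob F D * fob F Y) : exists c, fmor F (ev Y) (fmul ey.1 ey.2) = c *: fone F.
  by have [c [cE' _]] := fone_basis (fmor F (ev Y) (fmul ey.1 ey.2)); exists c.
have [p {}pE] := choice pE.
by exists (fun e v => p (e, v)) => e v; exact: (pE (e, v)).
Qed.

(* The zigzag identities say that the y_i and d_i are dual bases. *)
Lemma coev_basis (pr : fob F D -> fob F Y -> K) n (y : 'I_n -> fob F Y)
    (d : 'I_n -> fob F D) :
  (forall e v, fmor F (ev Y) (fmul e v) = pr e v *: fone F) ->
  fmor F (coev Y) (fone F) = \sum_i fmul (y i) (d i) ->
  (forall v, v = \sum_i pr (d i) v *: y i) /\
  (forall e, e = \sum_i pr e (y i) *: d i).
Proof.
move=> pE cE; split.
- move=> v; have /(el_congr (fmul (fone F) v)) := zigzag Y.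
  rewrite fmul_lunit !elM fmul_nat cE el1 fmul_suml !ap_sum => {1}<-.
  apply: eq_bigr => i _; rewrite fmul_assoc fmul_nat el1 pE fmulZr apZ.
  by rewrite fmul_runit.
- move=> e; have /(el_congr (fmul e (fone F))) := zigzag_dual Y.
  rewrite fmul_runit !elM fmul_nat cE el1 fmul_sumr !ap_sum => {1}<-.
  apply: eq_bigr => i _.
  have -> : fmul e (fmul (y i) (d i)) = fmor F (assoc D Y D) (fmul (fmul e (y i)) (d i)).
    by rewrite fmul_assoc.
  rewrite -[fmor F (associ _ _ _) _]elM (proj1 (assoc_inv _ _ _)) el1.
  by rewrite fmul_nat el1 pE fmulZl apZ fmul_lunit.
Qed.

Lemma dual_neq0 : ~ is_zero Y -> exists d : fob F D, d <> 0.
Proof.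
move=> Y0; apply: contrapT => H; apply: Y0.
have [pr pE] := ev_pair.
have [n [y [d cE]]] := tens_decomp (fmor F (coev Y) (fone F)).
have [vE _] := coev_basis pE cE.
apply/(is_zeroP F) => v; rewrite (vE v) big1 // => i _.
have -> : y i = \sum_j pr (d j) (y i) *: y j by exact: vE.
rewrite scaler_sumr big1 // => j _.
have -> : pr (d j) (y i) = 0.
  have d0 : d j = 0 by apply: contrapT => dj; apply: H; exists (d j).
  have := pE (d j) (y i); rewrite d0 fmul0l ap0.
  have [c [_ cU]] := fone_basis (0 : fob F (one_ C)).
  by move=> /cU <-; apply: cU; rewrite scale0r.
by rewrite scale0r scaler0.
Qed.

(** Contracting the second factor of the image of [coev] with [v] gives back [v], by the dual bases;
    the same contraction of [(a ⊗ 1) ∘ coev] gives [a v]. *)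
Lemma coev_scalar (a : hom Y Y) c :
  (a ⊗' idm D) ∘ coev Y = c *: coev Y -> a = c *: idm Y.
Proof.
move=> acE; have [pr pE] := ev_pair.
have [n [y [d cE]]] := tens_decomp (fmor F (coev Y) (fone F)).
have [vE _] := coev_basis pE cE.
have prD e e' v k : pr (k *: e + e') v = k * pr e v + pr e' v.
  have [u [_ uU]] := fone_basis (fmor F (ev Y) (fmul (k *: e + e') v)).
  rewrite -(uU _ (pE _ _)); apply: uU.
  by rewrite fmulDl fmulZl apD apZ !pE scalerA -scalerDl.
apply: (el_eq (F := F)) => v.
have [||g [gE _]] := @fmul_universal _ _ F Y D _ (fun y d => pr d v *: y).
- by move=> z k u w; rewrite scalerDr !scalerA mulrC.
- by move=> z k u w; rewrite prD scalerDl scalerA.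
have := el_congr (fone F) acE; rewrite elM elZ cE ap_sum => /(congr1 g).
rewrite linearZ !linear_sum /=.
under eq_bigr do rewrite fmul_nat el1 gE -apZ.
under [X in _ = _ *: X]eq_bigr do rewrite gE.
by rewrite -ap_sum -vE elZ el1.
Qed.

(** The linear transpose of [a] has to be a morphism of the category, because it enters the
    endomorphism [phi] to which total nonsplitness is applied; it is therefore assembled from [coev]
    and [ev]. *)
Lemma transpose (a : hom Y Y) : exists b : hom D D,
  (a ⊗' idm D) ∘ coev Y = (idm Y ⊗' b) ∘ coev Y.
Proof.
have [pr pE] := ev_pair.
have [n [y [d cE]]] := tens_decomp (fmor F (coev Y) (fone F)).
have [vE eE] := coev_basis pE cE.
have [r [rK Kr]] := runit_iso D.
exists (lunit D ∘ (ev Y ⊗' idm D) ∘ associ D Y D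
  ∘ (idm D ⊗' ((a ⊗' idm D) ∘ coev Y)) ∘ r).
have bE e : fmor F (lunit D ∘ (ev Y ⊗' idm D) ∘ associ D Y D
  ∘ (idm D ⊗' ((a ⊗' idm D) ∘ coev Y)) ∘ r) e
   = \sum_i pr e (fmor F a (y i)) *: d i.
  rewrite elM; have -> : fmor F r e = fmul e (fone F).
    by rewrite -[RHS]el1 -rK elM fmul_runit.
  rewrite !elM fmul_nat el1 elM cE ap_sum fmul_sumr !ap_sum.
  apply: eq_bigr => i _; rewrite fmul_nat el1.
  rewrite -fmul_assoc -[fmor F (associ _ _ _) _]elM (proj1 (assoc_inv _ _ _)) el1.
  by rewrite fmul_nat el1 pE fmulZl apZ fmul_lunit.
apply: (el_eq (F := F)) => u; have [c [-> _]] := fone_basis u; rewrite !elM !apZ cE !ap_sum.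
congr (_ *: _); under eq_bigr do rewrite fmul_nat el1.
under [RHS]eq_bigr do rewrite fmul_nat el1 bE fmul_sumr.
(* Both sides are the double sum of [pr (d j) (a (y i))] times [y j ⊗ d i]. *)
rewrite exchange_big; apply: eq_bigr => i _ /=.
rewrite {1}(vE (fmor F a (y i))) fmul_suml; apply: eq_bigr => j _.
by rewrite fmulZl fmulZr.
Qed.

End Duality.

(** * Weights *)

Section Weights.
Variables (K : fieldType) (T : filteredTannakian K) (F : fiberFunctor T).
Implicit Types X Y Z : T.

(** [W n X = X], that is, all weights of [X] are at most [n]; see [full_iso]. *)
Definition full n X := surj F (Wi n X).

Lemma inj_Wi n X : inj F (Wi n X).
Proof. exact/is_mono_el/Wi_mono. Qed.

Lemma full_iso n X : full n X <-> is_iso (Wi n X).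
Proof.
split=> [Xn|/(is_iso_el F) [] //]; apply/(is_iso_el F); split=> //; exact: inj_Wi.
Qed.

Lemma W_monotone n n' X : n <= n' ->
  exists j : hom (W n X) (W n' X), Wi n' X ∘ j = Wi n X.
Proof.
move=> nn'; have -> : n' = n + `|n' - n|%N by lia.
elim: `|_|%N => [|m [j jE]]; first by rewrite addr0; exists (idm _); exact: compm1.
have [j' j'E] := W_increasing (n + m) X.
have -> : n + m.+1 = n + m + 1 by lia.
by exists (j' ∘ j); rewrite compA j'E.
Qed.

Lemma full_le n n' X : n <= n' -> full n X -> full n' X.
Proof.
move=> /(W_monotone X) [j jE] Xn x; have [y <-] := Xn x.
by exists (fmor F j y); rewrite -elM jE.
Qed.

Lemma is_zero_le n n' X : n <= n' -> is_zero (W n' X) -> is_zero (W n X).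
Proof.
move=> /(W_monotone X) [j jE] /(is_zeroP F) X0; apply/(is_zeroP F) => x.
by apply: inj_Wi; rewrite -jE elM (X0 (fmor F j x)) ap0.
Qed.

Lemma full_surj n X Y (f : hom X Y) : surj F f -> full n X -> full n Y.
Proof.
move=> fs Xn y; have [x <-] := fs y; have [x' <-] := Xn x.
by exists (fmor F (Wm n f) x'); rewrite -elM Wi_nat elM.
Qed.

Lemma full_ext n X E Y (i : hom X E) (p : hom E Y) :
  short_exact i p -> full n X -> full n Y -> full n E.
Proof.
move=> se Xn Yn e; have [_ _ [pi0 pE]] := short_exact_el F se.
have [_ ps _] := short_exact_el F (Wm_exact n se).
have [y yE] := Yn (fmor F p e); have [e' e'E] := ps y.
have [|x xE] := pE (e - fmor F (Wi n E) e').
  by rewrite apB -[fmor F p (fmor F _ _)]elM -Wi_nat elM e'E yE subrr.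
have [x' x'E] := Xn x; exists (e' + fmor F (Wm n i) x').
by rewrite apD -[fmor F _ (fmor F (Wm n i) _)]elM Wi_nat elM x'E xE addrC subrK.
Qed.

(** Exactness of [W n] makes morphisms strict. The image [I] of [f] is a quotient of [X], so
    [W n I = 0]; it is a subobject of [Y], so [W n I] is the part of [I] inside [W n Y = Y], which
    is all of [I]. *)
Lemma hom_eq0 n X Y (f : hom X Y) : is_zero (W n X) -> full n Y -> f = 0.
Proof.
move=> /(is_zeroP F) X0 Yn.
have [I [e [m [ee mm mef]]]] := epi_mono_factor f.
have [N [i /(Wm_exact n) /(short_exact_el F) [_ es _]]] := epi_exact ee.
have [Q [q se]] := mono_exact mm.
have [_ _ [qm0 qE]] := short_exact_el F se.
have [_ _ [_ WqE]] := short_exact_el F (Wm_exact n se).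
apply: (el_eq (F := F)) => x; rewrite -mef elM el0.
have [y yE] := Yn (fmor F m (fmor F e x)).
have [|z zE] := WqE y.
  by apply: inj_Wi; rewrite -elM Wi_nat elM yE qm0.
have [x' x'E] := es z; rewrite -yE -zE -x'E (X0 x').
by rewrite !ap0.
Qed.

Lemma full_tens p q X Y : full p X -> full q Y -> full (p + q) (X ⊗ Y).
Proof.
move=> Xp Yq t; have [j jE] := W_tens_ge X Y (erefl (p + q)).
have [x xE] := surj_tens Xp Yq t.
by exists (fmor F j x); rewrite -elM jE.
Qed.

Lemma is_zero_tens n X Y :
  (forall p q, p + q = n -> is_zero (W p X) \/ is_zero (W q Y)) ->
  is_zero (W n (X ⊗ Y)).
Proof.
move=> H; have [|p q pq|j jE] := @W_tens_le _ T n X Y _ (0 : hom (zob T) _).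
- by apply/(is_mono_el F) => x _; exact: (proj1 (is_zeroP F _) (zobP T)).
- exists 0; rewrite compm0; apply: (tens_eq (F := F)) => x y.
  rewrite el0 fmul_nat; have [z|z] := H _ _ pq.
    by rewrite [x](proj1 (is_zeroP F _) z) ap0 fmul0l.
  by rewrite [y](proj1 (is_zeroP F _) z) ap0 fmul0r.
by apply/(is_zeroP F) => x; apply: inj_Wi; rewrite -jE comp0m el0.
Qed.

Lemma one_nonzero : fone F <> 0.
Proof.
move=> one0; have [c [_ cU]] := fone_basis (0 : fob F (one_ T)).
have := oner_neq0 K; rewrite -(cU 0) ?scale0r // (cU 1) ?eqxx //.
by rewrite one0 scaler0.
Qed.

Lemma one_full_or_zero n : full n (one_ T) \/ is_zero (W n (one_ T)).
Proof.
have [Z|] := pselect (is_zero (W n (one_ T))); [by right | move=> nZ; left].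
have [x x0] : exists x : fob F (W n (one_ T)), x <> 0.
  apply: contrapT => H; apply/nZ/(is_zeroP F) => x; apply: contrapT => x0.
  by apply: H; exists x.
have [c [cE _]] := fone_basis (fmor F (Wi n _) x).
have c0 : c != 0.
  by apply/eqP => c0; apply/x0/inj_Wi; rewrite cE c0 scale0r.
move=> v; have [d [-> _]] := fone_basis v.
by exists ((d / c) *: x); rewrite apZ cE scalerA divfK.
Qed.

(** The fibre of the unit is a line, so its filtration jumps exactly once, at some [w]. Since the
    unit is isomorphic to its tensor square, it also jumps at [w + w], whence [w = 0]. *)
Lemma one_weight : full 0 (one_ T) /\ is_zero (W (-1) (one_ T)).
Proof.
have nb n : full n (one_ T) -> ~ is_zero (W n (one_ T)).
  move=> s /(is_zeroP F) z; have [x] := s (fone F).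
  by rewrite (z x) ap0 => /esym; exact: one_nonzero.
have [N NE] := W_low (one_ T); have [M ME] := W_high (one_ T).
have [w [wf wz]] : exists w, full w (one_ T) /\ is_zero (W (w - 1) (one_ T)).
  have : forall m : nat, full (N + m) (one_ T) ->
      exists w, full w (one_ T) /\ is_zero (W (w - 1) (one_ T)).
    elim=> [|m IHm] f; first by have := nb _ f; rewrite addr0; case; exact: NE.
    have [/IHm //|z] := one_full_or_zero (N + m).
    by exists (N + m.+1); split=> //; rewrite (_ : N + m.+1 - 1 = N + m) //; lia.
  apply; apply/full_iso; apply: (ME (N + `|M - N|%N)); lia.
have lu n : full n (one_ T ⊗ one_ T) -> full n (one_ T).
  by apply: (full_surj (f := lunit (one_ T))); have /(is_iso_el F) [] := lunit_iso (one_ T).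
have f2 := lu _ (full_tens wf wf).
have z2 : is_zero (W (w + w - 1) (one_ T)).
  have [/nb nz|//] := one_full_or_zero (w + w - 1); case: (nz).
  have /(is_zeroP F) z : is_zero (W (w + w - 1) (one_ T ⊗ one_ T)).
    apply: is_zero_tens => p q pq.
    have [pw|qw] : p <= w - 1 \/ q <= w - 1 by lia.
      by left; exact: is_zero_le wz.
    by right; exact: is_zero_le wz.
  apply/(is_zeroP F) => x; apply: inj_Wi.
  have [l' [_ l'l]] := lunit_iso (one_ T).
  rewrite -[LHS]el1 -l'l elM -[fmor F l' _]elM -Wi_nat elM.
  by rewrite (z (fmor F (Wm _ l') x)) !ap0.
have w0 : 0 <= w.
  rewrite leNgt; apply/negP => w0; apply: (nb _ f2); apply: is_zero_le wz; lia.
have w1 : w < 1.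
  rewrite ltNge; apply/negP => w1; apply: (nb _ wf); apply: is_zero_le z2; lia.
have w00 : w = 0 by lia.
by move: wf wz; rewrite w00 sub0r.
Qed.

(** As the unit has weight 0, [coev] lands in [W 0 (X ⊗ dual X)], which is contained in
    [X ⊗ W (- p) (dual X)]: in a term [W a X ⊗ W b (dual X)] with [a + b = 0], either [a < p] and
    the first factor is zero, or [b <= - p]. So the dual basis vectors [d i] may be chosen in
    [W (- p) (dual X)], and they span the dual. *)
Lemma full_dual p X : is_zero (W (p - 1) X) -> full (- p) (dual X).
Proof.
move=> Xp; have [f0 _] := one_weight.
have [||j jE] := @W_tens_le _ T 0 X (dual X) _ (idm X ⊗' Wi (- p) (dual X)).
- by apply/(is_mono_el F)/inj_tensr; exact: inj_Wi.
- move=> a b ab; have [ap|pa] := ltP a p.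
    exists 0; rewrite compm0; apply: (tens_eq (F := F)) => x y.
    have /(is_zeroP F) /(_ x) -> : is_zero (W a X) by apply: is_zero_le Xp; lia.
    by rewrite fmul0l el0 ap0.
  have [|j jE] := @W_monotone b (- p) (dual X); first by lia.
  by exists (Wi a X ⊗' j); rewrite -tensm_comp comp1m jE.
have [u uE] := f0 (fone F).
have [n [y [d tE]]] := tens_decomp (fmor F j (fmor F (Wm 0 (coev X)) u)).
have [pr prE] := ev_pair F X.
have /(coev_basis prE) [_ dE] : fmor F (coev X) (fone F)
    = \sum_i fmul (y i) (fmor F (Wi (- p) (dual X)) (d i)).
  rewrite -uE -elM -Wi_nat elM -jE elM tE ap_sum.
  by apply: eq_bigr => i _; rewrite fmul_nat el1.
move=> e; exists (\sum_i pr e (y i) *: d i).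
by rewrite [RHS](dE e) ap_sum; apply: eq_bigr => i _; rewrite apZ.
Qed.

End Weights.

(** * Endomorphisms of totally nonsplit extensions *)

Lemma ext_pullback (K : fieldType) (C : tensCat K) (F : fiberFunctor C)
    (Y X Y' : C) (E : extSeq Y X) (b : hom Y' Y) : exact E ->
  exists E' : extSeq Y' X, exact E' /\ exists h, ext_mor E' E (idm X) b h.
Proof.
move=> /(short_exact_el F) [ii ps [pi0 pE]].
have [P [g [q [gq Ps Pi Pu]]]] := pullback F (prj E) b.
have [|i [gi qi]] := Pu _ (inc E) (0 : hom X Y').
  by apply: (el_eq (F := F)) => x; rewrite compm0 el0 elM pi0.
exists (ExtSeq i q); split; last by exists g; rewrite /ext_mor compm1 gi.
apply: (@el_short_exact _ _ F).
- by move=> x x0; apply: ii; rewrite -gi elM x0 ap0.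
- by move=> y; have [e eE] := ps (fmor F b y); have [x [_ <-]] := Ps _ _ eE; exists x.
split=> [x|x qx0]; first by rewrite -elM qi el0.
have [|y yE] := pE (fmor F g x).
  by rewrite -elM gq elM qx0 ap0.
by exists y; apply: Pi; rewrite -elM ?gi ?yE // qi el0 qx0.
Qed.

Lemma bip_exact (K : fieldType) (C : tensCat K) (F : fiberFunctor C) (X Y : C) :
  short_exact (@inl_ _ _ X Y) (@prr _ _ X Y).
Proof.
apply: (el_short_exact (F := F)).
- by move=> x /(congr1 (fmor F prl)); rewrite !bipE.
- by move=> y; exists (fmor F inr_ y); rewrite !bipE.
split=> [x|x x0]; first by rewrite bipE.
by exists (fmor F prl x); rewrite [RHS]el_bip x0 ap0 addr0.
Qed.

Section Rigidity.
Variables (K : fieldType) (T : filteredTannakian K) (F : fiberFunctor T).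
Implicit Types X Y Z : T.

(* The class of E is killed by the pushforward along phi = a (x) 1 - 1 (x) b^t
   on X (x) dual Y.  As Hom(1, coker phi) = 0 for weight reasons, it is already
   killed in the image of phi; by total nonsplitness phi = 0, which forces a
   and b to be the same scalar. *)
Lemma totally_nonsplit_endo (n : int) Y X (E : extSeq Y X) h a b :
  exact E -> totally_nonsplit E -> is_zero (W (n - 1) Y) -> full F (n - 1) X ->
  ~ is_zero Y -> ~ is_zero X -> ext_mor E E a b h ->
  exists c, [/\ h = c *: idm _, a = c *: idm _ & b = c *: idm _].
Proof.
move=> exE tnsE Yn Xn Ynz Xnz [hi ph].
set D := dual Y.
have exED : exact (ExtSeq (inc E ⊗' idm D) (prj E ⊗' idm D)).
  exact: (tens_exact F).
have [ii ps [pi0 pE]] := short_exact_el F exE.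
have [iiD psD [pi0D pED]] := short_exact_el F exED.
have [E' [exE' [g [gi pg]]]] := ext_pullback F (coev Y) exED.
have [ii' ps' [pi0' pE']] := short_exact_el F exE'.
rewrite compm1 /= in gi; rewrite /= in pg.
have tns1 := tnsE E' (conj exE' (ex_intro _ g (conj (etrans gi (esym (compm1 _))) pg))).
have [bt btE] := transpose F b; rewrite -/D in btE.
(* [k] induces [phi] on [X ⊗ D] and [b ⊗ 1 - 1 ⊗ bt] on [Y ⊗ D]. The latter kills [coev], so [k ∘ g]
   lands in [X ⊗ D] and provides an extension [r] of [phi] to [mid E'], which is what it means for
   the pushforward along [phi] to split. *)
pose k := (h ⊗' idm D) - (idm (mid E) ⊗' bt).
pose phi := (a ⊗' idm D) - (idm X ⊗' bt).
have pk : (prj E ⊗' idm D) ∘ (k ∘ g) = 0.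
  rewrite compA compDr compNr -!tensm_comp ph !comp1m compm1.
  rewrite -[X in _ ⊗' X](comp1m (idm D)) tensm_comp.
  have -> : prj E ⊗' bt = (idm Y ⊗' bt) ∘ (prj E ⊗' idm D).
    by rewrite -tensm_comp comp1m compm1.
  by rewrite -compNl -compDl -compA pg compA compDl compNl btE subrr comp0m.
have ki : k ∘ (inc E ⊗' idm D) = (inc E ⊗' idm D) ∘ phi.
  by rewrite compDl compDr compNl compNr -!tensm_comp hi !comp1m !compm1.
have [r rE] : exists r, (inc E ⊗' idm D) ∘ r = k ∘ g.
  by apply: (lift (F := F)) => // z; apply: pED; rewrite -elM pk el0.
have ri : r ∘ inc E' = phi.
  apply: (proj2 (is_mono_el F _) iiD).
  by rewrite compA rE -compA gi ki.
have [Q [e [m [ee mm meE]]]] := epi_mono_factor phi.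
have [X' [j sej]] := epi_exact ee; have [R [q seq_]] := mono_exact mm.
have [mi qs [qm0 qE]] := short_exact_el F seq_.
have [rho rhoE] : exists rho, rho ∘ prj E' = q ∘ r.
  apply: (desc (F := F)) => // x /pE' [y <-].
  by rewrite -elM -compA ri -meE !elM qm0.
have [_ o0] := one_weight F.
(* [X] has weights at most [n - 1] and [dual Y] at most [- n], so the cokernel [R] of [phi] has
   weights at most -1. *)
have rho0 : rho = 0.
  apply: (hom_eq0 rho o0); apply: (full_surj qs).
  have -> : -1 = (n - 1) + - n by lia.
  exact: full_tens Xn (full_dual Yn).
have [r' r'E] : exists r', m ∘ r' = r.
  by apply: (lift (F := F)) => // z; apply: qE; rewrite -elM -rhoE rho0 comp0m el0.
have r'i : r' ∘ inc E' = e by apply: mm; rewrite compA r'E ri meE.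
(* [r'] extends the epi part [e] of [phi] to [mid E'], so the pushforward of [E'] along [e] is this
   split extension. Total nonsplitness, applied to the kernel [j] of [e], forces [j] to be an
   isomorphism, hence [e = 0] and [phi = 0]. *)
pose E'' : extSeq (one_ T) Q := ExtSeq (@inl_ _ _ Q (one_ T)) prr.
have exE'' : exact E'' by exact: (bip_exact F).
have phi0 : phi = 0.
  have [[kj _] cj] := sej; have [v [_ jv]] : is_iso j.
    apply: contrapT => nj; apply: (tns1 X' j Q e E'') => //.
    - exact: kernel_mono (proj1 sej).
    - split=> //; exists (inl_ ∘ r' + inr_ ∘ prj E'); split=> /=.
        apply: (el_eq (F := F)) => x; rewrite !elE pi0' ap0 addr0.
        by rewrite -[fmor F r' _]elM r'i.
      by apply: (el_eq (F := F)) => x; rewrite !elE !bipE.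
    - by exists inr_; exact: prr_inr.
  by rewrite -meE -[e]compm1 -jv [e ∘ _]compA kj comp0m compm0.
have {}phi0 x d : fmul (fmor F a x) d = fmul x (fmor F bt d).
  have := el_congr (fmul x d) phi0.
  by rewrite elB !fmul_nat !el1 el0 => /eqP; rewrite subr_eq0 => /eqP.
have [d0 d0nz] := dual_neq0 F Ynz.
have [x0 x0nz] : exists x : fob F X, x <> 0.
  apply: contrapT => H; apply/Xnz/(is_zeroP F) => x; apply: contrapT => x0.
  by apply: H; exists x.
have [c ac] := fmul_scalar phi0 d0nz; exists c.
have btc : bt = c *: idm D.
  apply: (el_eq (F := F)) => d; rewrite elZ el1; apply/eqP; rewrite -subr_eq0.
  apply/eqP; apply: (fmul_eq0 (x := x0)) => //.
  by rewrite fmulDr -scaleN1r !fmulZr -phi0 ac fmulZl scaleN1r subrr.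
have bc : b = c *: idm Y.
  apply: (coev_scalar F); rewrite -/D btE btc.
  have -> : idm Y ⊗' (c *: idm D) = c *: idm (Y ⊗ D).
    apply: (tens_eq (F := F)) => x y.
    by rewrite fmul_nat !elZ !el1 fmulZr.
  by rewrite compZl comp1m.
have {}ac : a = c *: idm X by apply: (el_eq (F := F)) => x; rewrite ac elZ el1.
split=> //; apply/eqP; rewrite -subr_eq0; apply/eqP.
(* [h - c] kills [X] and has image in [X], so it is induced by a morphism [v : Y -> X], which is
   zero by weights. *)
set s := h - _.
have [u uE] : exists u, u ∘ prj E = s.
  apply: (desc (F := F)) => // x /pE [y <-].
  by rewrite -elM compDl compNl hi ac compZl compZr comp1m compm1 subrr el0.
have [v vE] : exists v, inc E ∘ v = u.
  apply: (lift (F := F)) => // z; apply: pE; have [y <-] := ps z.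
  rewrite -!elM -compA uE compDr compNr ph bc compZl compZr comp1m compm1 subrr.
  by rewrite el0.
by rewrite -uE -vE (hom_eq0 v Yn Xn) compm0 comp0m.
Qed.

End Rigidity.

(** * Isomorphisms of generalized extensions *)

Arguments epiP {K C k A l} g {m d} _.
Arguments monoP {K C k A l} g {m d} _.
Arguments squareP {K C k A l} g {m d} _.
Arguments vexactP {K C k A l} g {m d} _.

Section GextIsos.
Variables (K : fieldType) (C : tensCat K) (k : nat) (A : nat -> C).

Lemma scale_idm_inj (X : C) (c c' : K) :
  ~ is_zero X -> c *: idm X = c' *: idm X -> c = c'.
Proof.
move=> X0 /eqP; rewrite -subr_eq0 -scalerBl scaler_eq0 subr_eq0.
by case/orP=> /eqP.
Qed.

Lemma to_top_gaut l (X : gext k A l) (s : gaut X) m d : in_range k l m d ->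
  exists a, to_top (epi X) m d ∘ gfun s m d = a ∘ to_top (epi X) m d.
Proof.
elim: d m => [|d IHd] m r /=; first by exists (gfun s m 0); rewrite compm1 comp1m.
have [|a ea] := IHd m.+1; first by move: r; rewrite /in_range; lia.
exists a; have [/= se _] := gfun_mor s r.
by rewrite -compA se !compA ea.
Qed.

Lemma ginv_id l (X X' : gext k A l) (g : giso X X') : id_on_A g ->
  forall m, (m < k)%N -> ginv g m 0 = idm (A m.+1).
Proof.
move=> g1 m mk; have r0 : in_range k l m 0 by rewrite /in_range; lia.
by have [_] := gfunK g r0; rewrite g1 // comp1m.
Qed.

Lemma gfun_sym l (X X' : gext k A l) (g : giso X X') m d :
  gfun (giso_sym g) m d = ginv g m d.
Proof. by case: g. Qed.

Definition giso_scale l (X X' : gext k A l) (f : giso X X') (c : K) (c0 : c != 0) :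
  giso X X'.
Proof.
exists (fun m d => c *: gfun f m d) (fun m d => c^-1 *: ginv f m d).
- by move=> m d r; have [fe fm] := gfun_mor f r; rewrite !(compZl, compZr) fe fm.
- by move=> m d r; have [fe fm] := ginv_mor f r; rewrite !(compZl, compZr) fe fm.
- move=> m d r; have [fg gf] := gfunK f r; rewrite /mutually_inverse.
  by rewrite !(compZl, compZr) fg gf !scalerA mulfV // mulVf // !scale1r.
Defined.

Definition scalar_aut l (X : gext k A l) (s : gaut X) (c : K) :=
  c != 0 /\ forall m d, in_range k l m d ->
    gfun s m d = c *: idm _ /\ ginv s m d = c^-1 *: idm _.

(** The twist multiplies the top epimorphisms by [c] and the top monomorphisms by [c^-1]. Both
    factors are absorbed by [c^-1] on the top objects and the identity below, in particular on the
    [A r]. *)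
Lemma twist_scalar l (Y : gext k A l) (s : gaut (trunc Y)) c : (1 < l)%N ->
  scalar_aut s c -> gisom' Y (twist s).
Proof.
move=> l1 [c0 sE]; have l0 : (0 == l) = false by lia.
unshelve eexists (@GIso _ _ _ _ _ Y (twist s)
  (fun m d => if d == l then c^-1 *: idm (gX Y m d) else idm _)
  (fun m d => if d == l then c *: idm (gX Y m d) else idm _) _ _ _).
- move=> m d r; rewrite /= /twist_epi /twist_mono.
  have -> : (d == l) = false by move: r; rewrite /in_range; lia.
  case: eqP => [dl|_]; last by rewrite !comp1m !compm1.
  have [-> _] : gfun s m.+1 d = c *: idm _ /\ ginv s m.+1 d = c^-1 *: idm _.
    by apply: sE; move: r; rewrite /in_range; lia.
  have [_ ->] : gfun s m d = c *: idm _ /\ ginv s m d = c^-1 *: idm _.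
    by apply: sE; move: r; rewrite /in_range; lia.
  by rewrite !(compZl, compZr, comp1m, compm1) scalerA mulVf // scale1r.
- move=> m d r; rewrite /= /twist_epi /twist_mono.
  have -> : (d == l) = false by move: r; rewrite /in_range; lia.
  case: eqP => [dl|_]; last by rewrite !comp1m !compm1.
  have [-> _] : gfun s m.+1 d = c *: idm _ /\ ginv s m.+1 d = c^-1 *: idm _.
    by apply: sE; move: r; rewrite /in_range; lia.
  have [_ ->] : gfun s m d = c *: idm _ /\ ginv s m d = c^-1 *: idm _.
    by apply: sE; move: r; rewrite /in_range; lia.
  by rewrite !(compZl, compZr, comp1m, compm1) scalerA mulfV // scale1r.
- move=> m d r; rewrite /mutually_inverse; case: eqP => _; last by rewrite !comp1m.
  by rewrite !(compZl, compZr, comp1m, compm1) !scalerA mulfV // mulVf // scale1r.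
- by move=> m mk /=; rewrite l0.
Qed.

End GextIsos.

(* Generalized extensions presented by objects M m d for all d, the pieces M m 0
   being only isomorphic to A m.+1. *)
Section Model.
Variables (K : fieldType) (C : tensCat K) (F : fiberFunctor C).
Variables (k : nat) (A : nat -> C) (l : nat) (M : nat -> nat -> C).
Variables (e : forall m d, hom (M m d.+1) (M m.+1 d)).
Variables (u : forall m d, hom (M m d) (M m d.+1)).
Variables (a : forall m, hom (M m 0) (A m.+1)) (b : forall m, hom (A m.+1) (M m 0)).

Fixpoint model_top (m d : nat) {struct d} : hom (M m d) (A (top m d)) :=
  match d with
  | 0 => a m
  | d'.+1 => model_top m.+1 d' ∘ e m d'
  end.

Lemma short_exact_mid (X E E' Y : C) (i : hom X E) (p : hom E Y)
    (f : hom E' E) (g : hom E E') :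
  mutually_inverse f g -> short_exact i p -> short_exact (g ∘ i) (p ∘ f).
Proof.
move=> [gf fg] /(short_exact_el F) [ii ps [pi0 pE]].
have fK x : fmor F g (fmor F f x) = x by rewrite -elM gf el1.
have gK x : fmor F f (fmor F g x) = x by rewrite -elM fg el1.
apply: (el_short_exact (F := F)).
- by move=> x; rewrite elM => /(congr1 (fmor F f)); rewrite gK ap0; exact: ii.
- by move=> y; have [x xE] := ps y; exists (fmor F g x); rewrite elM gK.
split=> [x|y]; first by rewrite !elM gK pi0.
by rewrite elM => /pE [x xE]; exists x; rewrite elM xE fK.
Qed.

(** Arrows are conjugated by [f] and [g], which are identities for [d > 0] and [b], [a] for [d = 0].
    The last two clauses export these formulas, since [Y] is otherwise known only through the
    existential. *)
Lemma gext_of_model :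
  (forall m, (m < k)%N -> mutually_inverse (a m) (b m)) ->
  (forall m d, in_range k l m d.+1 -> is_epi (e m d)) ->
  (forall m d, in_range k l m d.+1 -> is_mono (u m d)) ->
  (forall m d, in_range k l m d.+2 -> e m d.+1 ∘ u m d.+1 = u m.+1 d ∘ e m d) ->
  (forall m d, in_range k l m d.+1 -> short_exact (u m d) (model_top m d.+1)) ->
  exists (Y : gext k A l) (f : forall m d, hom (gX Y m d) (M m d))
      (g : forall m d, hom (M m d) (gX Y m d)),
    [/\ forall m d, in_range k l m d -> mutually_inverse (f m d) (g m d),
        forall m d, in_range k l m d.+1 -> e m d ∘ f m d.+1 = f m.+1 d ∘ epi Y m d,
        forall m d, in_range k l m d.+1 -> u m d ∘ f m d = f m d.+1 ∘ mono Y m d,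
        forall m d, epi Y m d = g m.+1 d ∘ e m d ∘ f m d.+1 /\
                    mono Y m d = g m d.+1 ∘ u m d ∘ f m d
      & forall m, f m 0 = b m /\ g m 0 = a m].
Proof.
move=> ab eP uP sq vex.
pose B m d := M m d.+1.
pose f m d : hom (gob A B m d) (M m d) :=
  if d is d'.+1 return hom (gob A B m d) (M m d) then idm _ else b m.
pose g m d : hom (M m d) (gob A B m d) :=
  if d is d'.+1 return hom (M m d) (gob A B m d) then idm _ else a m.
have fgP m d : in_range k l m d -> mutually_inverse (f m d) (g m d).
  case: d => [|d] r; last by split; rewrite comp1m.
  by have [] := ab m; [move: r; rewrite /in_range; lia|split].
have rS m d : in_range k l m d.+1 -> in_range k l m.+1 d /\ in_range k l m d.
  by rewrite /in_range; lia.
(* Hiding [e'] and [u'] behind existentials leaves only their defining equations and keeps them from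
   being unfolded by conversion. *)
have [e' e'E] : exists e' : forall m d, hom (gob A B m d.+1) (gob A B m.+1 d),
    forall m d, e' m d = g m.+1 d ∘ e m d ∘ f m d.+1 by eexists.
have [u' u'E] : exists u' : forall m d, hom (gob A B m d) (gob A B m d.+1),
    forall m d, u' m d = g m d.+1 ∘ u m d ∘ f m d by eexists.
have eE m d : in_range k l m d.+1 -> e m d ∘ f m d.+1 = f m.+1 d ∘ e' m d.
  move=> /rS [/fgP [_ fgE] _].
  by rewrite e'E -[X in f m.+1 d ∘ X]compA [RHS]compA fgE comp1m.
have uE m d : in_range k l m d.+1 -> u m d ∘ f m d = f m d.+1 ∘ u' m d.
  move=> /fgP [_ fgE].
  by rewrite u'E -[X in f m d.+1 ∘ X]compA [RHS]compA fgE comp1m.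
have fmono m d : in_range k l m d -> is_mono (f m d).
  move=> /fgP [gf _] Z x y xy.
  by rewrite -[x]comp1m -[y]comp1m -gf -!compA xy.
have fepi m d : in_range k l m d -> is_epi (f m d).
  move=> /fgP [_ fg] Z x y xy.
  by rewrite -[x]compm1 -[y]compm1 -fg !compA xy.
have tE m d : in_range k l m d -> to_top e' m d = model_top m d ∘ f m d.
  elim: d m => [|d IHd] m r /=.
    by have [|_ ->] := ab m; first by move: r; rewrite /in_range; lia.
  have [r1 r2] := rS _ _ r; rewrite IHd //.
  by rewrite -!compA -eE //.
have e'P m d : in_range k l m d.+1 -> is_epi (e' m d).
  move=> r Z x y xy; have [r1 r2] := rS _ _ r.
  have [gf fg] := fgP _ _ r1.
  rewrite -[x]compm1 -[y]compm1 -gf !compA; congr (_ ∘ _).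
  apply: (eP _ _ r); apply: (fepi _ _ r).
  by rewrite -!compA eE // ![g _ _ ∘ _]compA gf !comp1m.
have u'P m d : in_range k l m d.+1 -> is_mono (u' m d).
  move=> r Z x y xy; have [r1 r2] := rS _ _ r.
  apply: (fmono _ _ r2); apply: (uP _ _ r).
  by rewrite !compA uE // -!compA xy.
have sq' m d : in_range k l m d.+2 -> e' m d.+1 ∘ u' m d.+1 = u' m.+1 d ∘ e' m d.
  move=> r; have [r1 r2] := rS _ _ r.
  apply: (fmono _ _ r1); rewrite [LHS]compA -eE // -compA -uE // compA sq //.
  by rewrite [RHS]compA -uE // -!compA eE.
have vex' m d : in_range k l m d.+1 -> short_exact (u' m d) (to_top e' m d.+1).
  move=> r; have [r1 r2] := rS _ _ r; rewrite tE // u'E.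
  rewrite -compA; apply: short_exact_mid; first exact: fgP.
  rewrite -[model_top _ _]comp1m; apply: short_exact_iso; last exact: vex.
    by exists (g m d); exact: fgP.
  by exists (idm _); split; exact: comp1m.
exists (GExt e'P u'P sq' vex'), f, g; split=> //.
Qed.

End Model.

Section Transport.
Variables (K : fieldType) (C : tensCat K) (F : fiberFunctor C).
Variables (k : nat) (A : nat -> C).

(** The objects and arrows of [Y] are kept; only the way in which its bottom objects are identified
    with the [A r] changes. *)
Lemma transport_A l (Y : gext k A l) (a b : forall m, hom (A m.+1) (A m.+1)) :
  (forall m, (m < k)%N -> mutually_inverse (a m) (b m)) ->
  exists (Y' : gext k A l) (f : giso Y' Y),
    forall m, (m < k)%N -> gfun f m 0 = b m.
Proof.
move=> ab.
have top_a m d : in_range k l m d -> exists2 c, is_iso c &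
    model_top (epi Y) a m d = c ∘ to_top (epi Y) m d.
  elim: d m => [|d IHd] m r /=.
    exists (a m); last by rewrite compm1.
    by exists (b m); apply: ab; move: r; rewrite /in_range; lia.
  have [|c ic cE] := IHd m.+1; first by move: r; rewrite /in_range; lia.
  by exists c => //; rewrite cE compA.
have [m d r|Y' [f [g [fg fe fu defY' f0]]]] :=
  gext_of_model F ab (fun m d => epiP Y) (fun m d => monoP Y) (fun m d => squareP Y).
- have [c ic ->] := top_a _ _ r.
  rewrite -[mono _ _ _]compm1; apply: short_exact_iso ic (vexactP Y r).
  by exists (idm _); split; exact: comp1m.
have gP : is_gmor (g : gfam Y Y').
  move=> m d r; have [-> ->] := defY' m d; have [_ fgE] := fg _ _ r.
  have [|_ fgE'] := fg m d; first by move: r; rewrite /in_range; lia.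
  split; first by rewrite -!compA fgE compm1.
  by rewrite -!compA fgE' compm1.
exists Y', (@GIso _ _ _ _ _ Y' Y f g (fun m d r => conj (fe m d r) (fu m d r)) gP fg).
by move=> m _; have [] := f0 m.
Qed.

End Transport.

Lemma class_refl U (R : U -> U -> Prop) (eR : is_equiv R) (c : classes R) x :
  sval c x -> sval c = R x.
Proof.
case: c => c [y /= ->] yx; have [r s t] := eR.
apply/funext => z; apply/propext; split; [exact: t (s _ _ yx)|exact: t yx].
Qed.

Lemma class_inhabited U (R : U -> U -> Prop) (eR : is_equiv R) (c : classes R) :
  exists x, sval c x.
Proof. by case: c => c [y /= ->]; exists y; have [r _ _] := eR; exact: r. Qed.

Lemma class_ext U (R : U -> U -> Prop) (eR : is_equiv R) (c c' : classes R) x y :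
  sval c x -> sval c' y -> R x y -> c = c'.
Proof.
move=> cx cy xy; apply: classes_eq; rewrite (class_refl eR cy).
apply: class_refl => //; rewrite (class_refl eR cx); exact: xy.
Qed.

(** * Rigidity of totally nonsplit generalized extensions, and the fibres of [forget] *)

Section Rigid.
Variables (K : fieldType) (T : filteredTannakian K) (F : fiberFunctor T).
Variables (k : nat) (A : nat -> T) (p : nat -> int).
Hypothesis A_nonzero : forall r : nat, (1 <= r <= k)%N -> ~ is_zero (A r).
Hypothesis A_pure : forall r : nat, (1 <= r <= k)%N -> pure (p r) (A r).
Hypothesis p_increasing :
  forall r s : nat, (1 <= r)%N -> (r < s)%N -> (s <= k)%N -> p r < p s.

Lemma gX_full l (X : gext k A l) m d : in_range k l m d ->
  full F (p (m + d).+1) (gX X m d).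
Proof.
elim: d => [|d IHd] r.
  have [|_ /full_iso] := A_pure (r := m.+1); first by move: r; rewrite /in_range; lia.
  by rewrite addn0; apply.
apply: (full_ext (vexactP X r)).
  apply: full_le (IHd _); last by move: r; rewrite /in_range; lia.
  by apply/ltW/p_increasing; move: r; rewrite /in_range; lia.
have [|_ /full_iso] := A_pure (r := top m d.+1); last by rewrite -topE.
by rewrite topE; move: r; rewrite /in_range; lia.
Qed.

Lemma gX_nonzero l (X : gext k A l) m d : in_range k l m d -> ~ is_zero (gX X m d).
Proof.
elim: d => [|d IHd] r.
  by apply: A_nonzero; move: r; rewrite /in_range; lia.
move=> /(is_zeroP F) X0; apply: IHd; first by move: r; rewrite /in_range; lia.
apply/(is_zeroP F) => x.
by have /(is_mono_el F) := monoP X r; apply; exact: X0.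
Qed.

(** Rigidity for the sequence with sub [X_{m,n-1}], of weights at most [p_{n-1}], and quotient
    [A_n], pure of weight [p_n]; as weights are integers, [p_{n-1} <= p_n - 1]. *)
Lemma gaut_scalar_step l (X : gext k A l) (s : gaut X) m d :
  gext_totally_nonsplit X -> in_range k l m d.+1 ->
  exists c, gfun s m d.+1 = c *: idm _ /\ gfun s m d = c *: idm _.
Proof.
move=> tns r; have [tv _] := tns _ _ r.
have rm : (1 <= top m d.+1 <= k)%N by rewrite topE; move: r; rewrite /in_range; lia.
have rd : in_range k l m d by move: r; rewrite /in_range; lia.
have [a aE] := to_top_gaut s r.
have [c [] ] : exists c, [/\ gfun s m d.+1 = c *: idm _, gfun s m d = c *: idm _
    & a = c *: idm _]; last by move=> *; exists c.
apply: (totally_nonsplit_endo (F := F) (E := vseq X m d) (n := p (top m d.+1))).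
- exact: vexactP.
- exact: tv.
- by have [] := A_pure rm.
- apply: (full_le _ (gX_full (X := X) rd)); rewrite topE.
  have : p (m + d).+1 < p (m + d.+1).+1 by apply: p_increasing; move: r; rewrite /in_range; lia.
  by lia.
- exact: A_nonzero.
- exact: gX_nonzero.
- by have [_ fm] := gfun_mor s r; split.
Qed.

(** Each step gives its own scalar, and these have to be matched. Along a row, consecutive steps
    share a nonzero object. From row [m] to the next, the scalar passes through the epimorphism from
    [X_{m,m+2}] onto [A_{m+2}], the first object of row [m + 1]. *)
Lemma gaut_scalar l (X : gext k A l) (s : gaut X) : (1 < k)%N -> (0 < l)%N ->
  gext_totally_nonsplit X -> exists c, scalar_aut s c.
Proof.
move=> k1 l0 tns.
have r01 : in_range k l 0 1 by rewrite /in_range; lia.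
have r00 : in_range k l 0 0 by rewrite /in_range; lia.
have [c [_ s0]] := gaut_scalar_step s tns r01; exists c.
have row m : in_range k l m 0 -> gfun s m 0 = c *: idm _ ->
    forall d, in_range k l m d -> gfun s m d = c *: idm _.
  move=> _ sm; elim=> // d IHd r.
  have [c' [-> ]] := gaut_scalar_step s tns r.
  have rd : in_range k l m d by move: r; rewrite /in_range; lia.
  by rewrite IHd // => /(scale_idm_inj (gX_nonzero (X := X) rd)) <-.
have col m : in_range k l m 0 -> gfun s m 0 = c *: idm _.
  elim: m => // m IHm r.
  have r1 : in_range k l m 1 by move: r; rewrite /in_range; lia.
  have r0 : in_range k l m 0 by move: r; rewrite /in_range; lia.
  have [se _] := gfun_mor s r1; have e1 := epiP X r1; apply: e1.
  rewrite -[LHS]se (row _ r0 (IHm r0) _ r1).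
  by rewrite compZr compZl compm1 comp1m.
have sE m d : in_range k l m d -> gfun s m d = c *: idm _.
  move=> r; have r0 : in_range k l m 0 by move: r; rewrite /in_range; lia.
  exact: row r0 (col _ r0) _ r.
have c0 : c != 0.
  apply/eqP => c0; have [g1 _] := gfunK s r00.
  apply: (gX_nonzero (X := X) r00); rewrite /is_zero -g1 sE // c0 scale0r.
  exact: compm0.
split=> // m d r; split; first exact: sE.
have [g1 _] := gfunK s r; rewrite sE // compZr compm1 in g1.
by rewrite -g1 scalerA mulVf // scale1r.
Qed.

Variables (l : nat).
Hypothesis hl : (2 <= l <= k.-1)%N.

Section Fibre.
Variables (eps' : gS' k A l.-1).
Hypothesis eps_tns : forall X, sval eps' X -> gext_totally_nonsplit X.

Lemma Gamma_act_trivial (g : Gamma eps') (c : fiber' eps') : Gamma_act g c = c.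
Proof.
have fiber_inj (c1 c2 : fiber' eps') : sval c1 = sval c2 -> c1 = c2.
  by case: c1 c2 => [c1 E1] [c2 E2] /= E; exact: eq_exist.
have [r s t] := @gisom'_equiv K T k A l.
have [Y cY] := class_inhabited (@gisom'_equiv K T k A l) (sval c).
apply: fiber_inj; apply: (class_ext (@gisom'_equiv K T k A l) (x := Y) (y := Y)) => //.
exists Y, cY; apply: s.
have [|||c' c'P] := gaut_scalar (gam g (fiber'_trunc cY)); try lia.
  exact: eps_tns (fiber'_trunc cY).
by apply: twist_scalar c'P; lia.
Qed.

(** [g^-1 ∘ f] is an automorphism of [trunc Y], hence a scalar [c]. As [g] is the identity on the
    [A r], [f] is [c] there, and [c^-1 *: f] is the isomorphism sought. *)
Lemma gisom_trunc_isom' (Y Y' : gext k A l) : sval eps' (trunc Y) ->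
  gisom Y Y' -> gisom' (trunc Y) (trunc Y') -> gisom' Y Y'.
Proof.
move=> eY [f] [g g1].
have [||c [c0 cE]] := gaut_scalar (giso_comp (giso_sym g) (trunc_iso f)) _ _ (eps_tns eY); try lia.
exists (giso_scale f (c := c^-1) (ltac:(by rewrite invr_eq0))) => m mk /=.
have r0 : in_range k l.-1 m 0 by rewrite /in_range; lia.
have [/= + _] := cE _ _ r0.
rewrite gfun_sym (ginv_id g1 mk) comp1m => ->.
by rewrite scalerA mulVf // scale1r.
Qed.

Lemma forget_bij : set_bij [set c : gS' k A l | Theta' c = eps']
  [set c : gS k A l | Theta c = forget eps'] (@forget K T k A l).
Proof.
have [r s t] := gisom'_equiv k A l; have [r1 s1 t1] := gisom'_equiv k A l.-1.
have [r2 s2 t2] := gisom_equiv k A l.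
have ThetaE (c : gS' k A l) Y : sval c Y -> sval (Theta' c) (trunc Y).
  by move=> cY; exists Y.
split.
- move=> c /= <-; have [Y cY] := class_inhabited (@gisom'_equiv K T k A l) c.
  apply: (class_ext (@gisom_equiv K T k A l.-1) (x := trunc Y) (y := trunc Y)).
  + by exists Y; [exists Y|have [q _ _] := gisom_equiv k A l.-1; exact: q].
  + by exists (trunc Y); [exists Y|have [q _ _] := gisom_equiv k A l.-1; exact: q].
  + by have [q _ _] := gisom_equiv k A l.-1; exact: q.
- move=> c c'; rewrite !inE /= => ce ce' cc'.
  have [Y cY] := class_inhabited (@gisom'_equiv K T k A l) c.
  have [Y' cY'] := class_inhabited (@gisom'_equiv K T k A l) c'.
  apply: (class_ext (@gisom'_equiv K T k A l) cY cY').
  have eY : sval eps' (trunc Y) by rewrite -ce; exact: ThetaE.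
  apply: gisom_trunc_isom' => //.
    have : sval (forget c) Y' by rewrite cc'; exists Y'.
    by case=> Y2; rewrite (class_refl (@gisom'_equiv K T k A l) cY) => /gisom'W; exact: t2.
  rewrite -(class_refl (@gisom'_equiv K T k A l.-1) eY) -ce'; exact: ThetaE.
- move=> c /= cE; have [Y cY] := class_inhabited (@gisom_equiv K T k A l) c.
  have : sval (forget eps') (trunc Y).
    rewrite -cE; exists Y => //; by have [q _ _] := gisom_equiv k A l.-1; exact: q.
  case=> X eX [f].
  (* The isomorphism [f] from the representative [X] of [eps'] to [trunc Y] may move the [A r].
     Relabelling the bottom objects of [Y] through [f] yields [Y'] isomorphic to [Y], and [f^-1 ∘ h]
     identifies its truncation with [X] by the identity on every [A r]. *)
  have [|Y' [h hE]] := transport_A F Y (a := fun m => ginv f m 0) (b := fun m => gfun f m 0).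
    move=> m mk; have [|fg gf] := gfunK f (m := m) (d := 0); last by split.
    by rewrite /in_range; lia.
  exists (exist _ [set Z | gisom' Y' Z]%classic (ex_intro _ Y' erefl) : gS' k A l).
    rewrite /=; apply: (class_ext (@gisom'_equiv K T k A l.-1) (x := trunc Y') _ eX).
      by exists Y'; [exact: r|exact: r1].
    exists (giso_comp (giso_sym f) (trunc_iso h)) => m mk.
    have [|fg _] := gfunK f (m := m) (d := 0); first by rewrite /in_range; lia.
    by rewrite /= gfun_sym hE.
  apply: (class_ext (@gisom_equiv K T k A l) (x := Y') _ cY).
    by exists Y'; [exact: r|exact: r2].
  by split; exact: h.
Qed.

End Fibre.

End Rigid.

(** * Blended extensions *)

(* Blended extensions (extensions panachees): objects Z between U and V, where
   A -> U -> V -> R is exact, on which Ext^1(R, A) acts.  For U = A and V = R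
   these are the extensions of R by A, and the action is the Baer sum. *)
Record blend (K : fieldType) (C : linCat K) (U V : C) := Blend {
  bmid : C;
  bmu : hom U bmid;
  bpi : hom bmid V
}.

Section Blends.
Variables (K : fieldType) (C : tensCat K) (F : fiberFunctor C).

Local Notation "f $ x" := (fmor F f x) (at level 30, right associativity).

Definition el_ext (Y X : C) (E : extSeq Y X) :=
  [/\ inj F (inc E), surj F (prj E) & el_exact F (inc E) (prj E)].

Lemma exact_el (Y X : C) (E : extSeq Y X) : exact E <-> el_ext E.
Proof.
split; first exact: short_exact_el.
by case=> ii ps ip; exact: (el_short_exact (F := F)).
Qed.

Section Base.
Variables (A U V R : C) (i : hom A U) (b : hom U V) (w : hom V R).

(** Exactness of [A -> U -> V -> R -> 0] on elements. Injectivity on the left is carried by the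
    third clause of [is_blend]. *)
Definition blend_base :=
  [/\ forall a, b $ i $ a = 0,
      forall u, b $ u = 0 -> exists a, i $ a = u,
      forall u, w $ b $ u = 0,
      forall v, w $ v = 0 -> exists u, b $ u = v
    & surj F w].

Definition is_blend (Z : blend U V) :=
  [/\ forall u, bpi Z $ bmu Z $ u = b $ u,
      surj F (bpi Z),
      forall a, bmu Z $ i $ a = 0 -> a = 0
    & forall z, bpi Z $ z = 0 -> exists a, bmu Z $ i $ a = z].

(* Z' = Z + E, witnessed by any P mapping onto the fibre product of Z and E
   over R; the last condition says that P -> Z' factors through the quotient of
   this fibre product that defines the sum. *)
Definition sum_via (Z : blend U V) (E : extSeq R A) (Z' : blend U V) (P : C)
    (z : hom P (bmid Z)) (e : hom P (mid E)) (z' : hom P (bmid Z')) :=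
  [/\ forall p, bpi Z $ z $ p = bpi Z' $ z' $ p,
      forall p, prj E $ e $ p = w $ bpi Z $ z $ p,
      forall z0 e0, w $ bpi Z $ z0 = prj E $ e0 ->
        exists p, z $ p = z0 /\ e $ p = e0
    & forall p u a, z $ p = bmu Z $ u -> e $ p = inc E $ a ->
        z' $ p = bmu Z' $ (u + i $ a)].

Definition is_sum Z E Z' := exists P z e z', @sum_via Z E Z' P z e z'.

Definition blend_mor (Z Z' : blend U V) (f : hom (bmid Z) (bmid Z')) :=
  f ∘ bmu Z = bmu Z' /\ bpi Z' ∘ f = bpi Z.

Hypothesis base : blend_base.

Lemma blend_diff Z z z' : is_blend Z -> bpi Z $ z = bpi Z $ z' ->
  exists a, z = z' + bmu Z $ i $ a.
Proof.
move=> [pm ps mi pE] zz'.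
have [|a ->] := @exact_diff _ _ F _ _ _ (bmu Z ∘ i) (bpi Z) _ _ _ zz'.
  by move=> y /pE [a <-]; exists a; rewrite elM.
by exists a; rewrite elM.
Qed.

Lemma blend_mu_inj Z : is_blend Z -> inj F (bmu Z).
Proof.
move=> [pm ps mi pE] u u0; have [bi0 bE wb0 wE ws] := base.
have [|a aE] := bE u; first by rewrite -pm u0 ap0.
by move: u0; rewrite -aE => /mi ->; rewrite ap0.
Qed.

Lemma blend_bot Z z : is_blend Z -> w $ bpi Z $ z = 0 -> exists u, z = bmu Z $ u.
Proof.
move=> bZ; have [bi0 bE wb0 wE ws] := base => /wE [u uE].
have [|a aE] := @blend_diff Z z (bmu Z $ u) bZ.
  by case: bZ => pm _ _ _; rewrite pm uE.
by exists (u + i $ a); rewrite apD.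
Qed.

(** The short five lemma for the extensions of [V] by [A] underlying [Z] and [Z']. *)
Lemma blend_mor_iso Z Z' f : is_blend Z -> is_blend Z' -> @blend_mor Z Z' f ->
  is_iso f.
Proof.
move=> [_ ps _ pE] bZ' [fm pf]; have [_ ps' mi' pE'] := bZ'.
apply/(is_iso_el F); split.
- move=> z z0; have [|a aE] := pE z; first by rewrite -pf elM z0 ap0.
  by move: z0; rewrite -aE -elM fm => /mi' ->; rewrite !ap0.
- move=> z'; have [z zE] := ps (bpi Z' $ z').
  have [|a ->] := @blend_diff Z' z' (f $ z) bZ'; first by rewrite -zE -pf elM.
  by exists (z + bmu Z $ i $ a); rewrite apD -[f $ bmu Z $ _]elM fm.
Qed.

Lemma is_sum_mor Z E Z' Z2 E2 Z2' f g h :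
  is_sum Z E Z' -> @blend_mor Z Z2 f -> is_iso f ->
  @ext_mor _ _ _ _ _ _ E E2 (idm _) (idm _) g -> is_iso g ->
  @blend_mor Z' Z2' h -> is_sum Z2 E2 Z2'.
Proof.
move=> [P [z [e [z' [zz' ze lft def]]]]] [fm pf] /(is_iso_el F) [fi fs].
move=> [gi pg] /(is_iso_el F) [gI gs] [hm ph].
rewrite compm1 in gi; rewrite comp1m in pg.
exists P, (f ∘ z), (g ∘ e), (h ∘ z'); split.
- by move=> p; rewrite !elM -elM pf -[bpi Z2' $ h $ _]elM ph.
- by move=> p; rewrite !elM -elM pg -[bpi Z2 $ f $ _]elM pf ze.
- move=> z0 e0; have [z1 <-] := fs z0; have [e1 <-] := gs e0.
  rewrite -[bpi Z2 $ f $ _]elM pf -[prj E2 $ g $ _]elM pg => /lft [p [<- <-]].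
  by exists p; rewrite !elM.
- move=> p u a; rewrite !elM -fm -gi !elM => /(injE fi) zp /(injE gI) ep.
  by rewrite (def p u a) // -elM hm.
Qed.

(** The Baer construction: [P] is the fibre product of [Z] and [E] over [R], and the sum is its
    quotient by the antidiagonal copy [ka] of [A]. The inclusion of [U] comes from [s], which is
    [bmu Z] in [Z] and 0 in [E]. *)
Lemma is_sum_total Z E : is_blend Z -> el_ext E ->
  exists Z', is_blend Z' /\ is_sum Z E Z'.
Proof.
move=> bZ [ii prs [pi0 prE]]; have [pm ps mi pE] := bZ.
have [bi0 bE wb0 wE ws] := base.
have [P [z [e [ze lft zei uni]]]] := pullback F (w ∘ bpi Z) (prj E).
have {}ze p : w $ bpi Z $ z $ p = prj E $ e $ p by rewrite -!elM ze.
have [|ka [kaz kae]] := uni _ (bmu Z ∘ i) (- inc E).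
  by apply: (el_eq (F := F)) => x; rewrite !elE pm bi0 pi0 ap0 oppr0.
have [|s [sz se]] := uni _ (bmu Z) (0 : hom U (mid E)).
  by apply: (el_eq (F := F)) => x; rewrite !elE pm wb0.
have kaz' a : z $ ka $ a = bmu Z $ i $ a by rewrite -!elM kaz.
have kae' a : e $ ka $ a = - inc E $ a by rewrite -elM kae elN.
have sz' u : z $ s $ u = bmu Z $ u by rewrite -elM sz.
have se' u : e $ s $ u = 0 by rewrite -elM se el0.
have [Q [c /(cokernel_el F) [cs [c0 cE]]]] := has_cokernel ka.
have [|pi' pi'E] := @desc _ _ F _ _ _ c (bpi Z ∘ z) cs.
  by move=> x /cE [a <-]; rewrite elM kaz' pm bi0.
have {}pi'E p : pi' $ c $ p = bpi Z $ z $ p by rewrite -!elM pi'E.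
(* Adding the antidiagonal element [ka $ a] moves the [E]-component of [p] into its
   [Z]-component. *)
have decomp p u a : z $ p = bmu Z $ u -> e $ p = inc E $ a ->
    c $ p = c $ s $ (u + i $ a).
  move=> zp ep; rewrite -[LHS]addr0 -(c0 a) -apD; congr (c $ _); apply: zei.
    by rewrite apD kaz' sz' zp apD.
  by rewrite apD kae' se' ep addrN.
exists (Blend (c ∘ s) pi'); split.
  split=> /=.
  - by move=> u; rewrite elM pi'E sz' pm.
  - move=> v; have [z0 z0E] := ps v; have [e0 e0E] := prs (w $ v).
    have [|p [zp _]] := lft z0 e0; first by rewrite elM z0E e0E.
    by exists (c $ p); rewrite pi'E zp z0E.
  - move=> a; rewrite elM => /cE [a' a'E].
    have a'0 : a' = 0.
      have /eqP := kae' a'; rewrite a'E se' eq_sym oppr_eq0 => /eqP.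
      exact: ii.
    by apply: mi; rewrite -sz' -a'E a'0 !ap0.
  - move=> q; have [p <-] := cs q; rewrite pi'E => zp0.
    have [a1 a1E] := pE _ zp0.
    have [|a2 a2E] := prE (e $ p); first by rewrite -ze zp0 ap0.
    by exists (a1 + a2); rewrite (decomp p (i $ a1) a2) // elM apD.
exists P, z, e, c; split=> /=.
- by move=> p; rewrite pi'E.
- by move=> p; rewrite ze.
- by move=> z0 e0 ze0; apply: lft; rewrite elM.
- by move=> p u a zp ep; rewrite (decomp p u a) // elM.
Qed.

Lemma sum_via_surj Z E Z' P z e z' : is_blend Z -> is_blend Z' -> el_ext E ->
  @sum_via Z E Z' P z e z' -> surj F z'.
Proof.
move=> [pm ps mi pE] bZ' [ii prs [pi0 prE]] [zz' ze lft def] q.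
have [z0 z0E] := ps (bpi Z' $ q); have [e0 e0E] := prs (w $ bpi Z $ z0).
have [p [zp ep]] := lft z0 e0 (esym e0E).
have [|a ->] := @blend_diff Z' q (z' $ p) bZ'; first by rewrite -zz' zp z0E.
have [|p' [zp' ep']] := lft 0 (inc E $ a); first by rewrite pi0 !ap0.
by exists (p + p'); rewrite apD (def p' 0 a) // ?ap0 // add0r.
Qed.

(** Two witnesses [P1] and [P2] are compared on their fibre product [Q] over [Z] and [E]. [Q] maps
    onto [Z1], and what dies in [Z1] has components in [Z] and [E] coming from [a1] and [a2] with
    [a1 + a2 = 0], so it dies in [Z2] as well: the map to [Z2] descends. *)
Lemma is_sum_functional Z E Z1 Z2 : is_blend Z -> el_ext E ->
  is_blend Z1 -> is_blend Z2 -> is_sum Z E Z1 -> is_sum Z E Z2 ->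
  exists f, @blend_mor Z1 Z2 f.
Proof.
move=> bZ eE b1 b2 [P1 [z1 [e1 [z1' S1]]]] [P2 [z2 [e2 [z2' S2]]]].
have s1 := sum_via_surj bZ b1 eE S1.
have [pm ps mi pE] := bZ; have [ii prs [pi0 prE]] := eE; have [pm1 ps1 mi1 pE1] := b1.
have [zz1 ze1 lft1 def1] := S1; have [zz2 ze2 lft2 def2] := S2.
have [bi0 bE wb0 wE ws] := base.
have [Q [q1 [q2 [qq lft _ _]]]] :=
  pullback F (inl_ ∘ z1 + inr_ ∘ e1) (inl_ ∘ z2 + inr_ ∘ e2).
have qqz q : z1 $ q1 $ q = z2 $ q2 $ q.
  by have /(congr1 (fmor F prl)) := el_congr q qq; rewrite !elE !bipE.
have qqe q : e1 $ q1 $ q = e2 $ q2 $ q.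
  by have /(congr1 (fmor F prr)) := el_congr q qq; rewrite !elE !bipE.
have {}lft p1 p2 : z1 $ p1 = z2 $ p2 -> e1 $ p1 = e2 $ p2 ->
    exists q, q1 $ q = p1 /\ q2 $ q = p2.
  by move=> zp ep; apply: lft; rewrite !elE zp ep.
have over p1 : exists q, q1 $ q = p1.
  have [|p2 [zp ep]] := lft2 (z1 $ p1) (e1 $ p1); first by rewrite ze1.
  by have [q [q1E _]] := lft p1 p2 (esym zp) (esym ep); exists q.
have [||f fE] := @desc _ _ F _ _ _ (z1' ∘ q1) (z2' ∘ q2).
- move=> z; have [p <-] := s1 z; have [q <-] := over p.
  by exists q; rewrite elM.
- move=> q; rewrite !elM => z0.
  have zp0 : bpi Z $ z1 $ q1 $ q = 0 by rewrite zz1 z0 ap0.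
  have [a1 a1E] := pE _ zp0.
  have [|a2 a2E] := prE (e1 $ q1 $ q); first by rewrite ze1 zp0 ap0.
  have := def1 _ _ _ (esym a1E) (esym a2E); rewrite z0 -apD => /esym /mi1 a12.
  by rewrite (def2 _ (i $ a1) a2) -?qqz -?qqe // -apD a12 !ap0.
have {}fE q : f $ z1' $ q1 $ q = z2' $ q2 $ q by rewrite -!elM -compA fE.
exists f; split; apply: (el_eq (F := F)) => x; rewrite elM.
- have [|p [zp ep]] := lft1 (bmu Z $ x) (inc E $ 0); first by rewrite pm wb0 !ap0.
  have [q qE] := over p; rewrite -qE in zp ep.
  have zp1 := def1 _ _ _ zp ep.
  rewrite qqz in zp; rewrite qqe in ep; have zp2 := def2 _ _ _ zp ep.
  by move: zp1 zp2; rewrite !ap0 !addr0 => <- <-.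
- have [p <-] := s1 x; have [q <-] := over p.
  by rewrite fE -zz2 -qqz zz1.
Qed.

(** The fibre product of [Z] with the split extension over [R] is [Z ⊕ A]; the sum map adds the
    [A]-component to [Z]. *)
Lemma is_sum0 Z : is_blend Z -> is_sum Z (ExtSeq (@inl_ _ _ A R) prr) Z.
Proof.
move=> [pm ps mi pE]; have [bi0 bE wb0 wE ws] := base.
exists (bip (bmid Z) A), prl, (inl_ ∘ prr + inr_ ∘ w ∘ bpi Z ∘ prl),
  (prl + bmu Z ∘ i ∘ prr); split=> /=.
- by move=> p; rewrite !elE pm bi0 addr0.
- by move=> p; rewrite !elE !bipE.
- move=> z0 e0 ze; exists (inl_ $ z0 + inr_ $ prl $ e0); rewrite !elE !bipE.
  by split=> //; rewrite [RHS]el_bip ze.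
- move=> p u a zp /(congr1 (fmor F prl)); rewrite !elE !bipE => <-.
  by rewrite zp.
Qed.

(** The difference of [Z'] and [Z] is their fibre product over [V] modulo the diagonal copy [s] of
    [U]. In it [A] sits through [t], as 0 in [Z] and [bmu Z' ∘ i] in [Z'], which fixes the sign;
    that fibre product also witnesses the sum. *)
Lemma is_sum_transitive Z Z' : is_blend Z -> is_blend Z' ->
  exists E, el_ext E /\ is_sum Z E Z'.
Proof.
move=> bZ bZ'; have [pm ps mi pE] := bZ; have [pm' ps' mi' pE'] := bZ'.
have [bi0 bE wb0 wE ws] := base; have muI := injE (blend_mu_inj bZ).
have [P [z [z' [zz' lft zzi uni]]]] := pullback F (bpi Z) (bpi Z').
have {}zz' p : bpi Z $ z $ p = bpi Z' $ z' $ p by rewrite -!elM zz'.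
have [|s [sz sz']] := uni _ (bmu Z) (bmu Z').
  by apply: (el_eq (F := F)) => x; rewrite !elE pm pm'.
have [|t [tz tz']] := uni _ (0 : hom A (bmid Z)) (bmu Z' ∘ i).
  by apply: (el_eq (F := F)) => x; rewrite !elE pm' bi0.
have {}sz u : z $ s $ u = bmu Z $ u by rewrite -elM sz.
have {}sz' u : z' $ s $ u = bmu Z' $ u by rewrite -elM sz'.
have {}tz u : z $ t $ u = 0 by rewrite -elM tz el0.
have {}tz' u : z' $ t $ u = bmu Z' $ i $ u by rewrite -!elM tz'.
have [E [c /(cokernel_el F) [cs [c0 cE]]]] := has_cokernel s.
have [|pi' pi'E] := @desc _ _ F _ _ _ c (w ∘ bpi Z ∘ z) cs.
  by move=> x /cE [u <-]; rewrite !elM sz pm wb0.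
have {}pi'E p : pi' $ c $ p = w $ bpi Z $ z $ p by rewrite -!elM pi'E.
exists (ExtSeq (c ∘ t) pi'); split.
  split=> /=.
  - move=> a; rewrite elM => /cE [u uE].
    have u0 : u = 0 by apply: muI; rewrite -sz uE tz ap0.
    by apply: mi'; rewrite -tz' -uE u0 !ap0.
  - move=> r; have [v vE] := ws r; have [z0 z0E] := ps v; have [z0' z0'E] := ps' v.
    have [|p [zp _]] := lft z0 z0'; first by rewrite z0E.
    by exists (c $ p); rewrite pi'E zp z0E.
  split=> [a|q]; first by rewrite elM pi'E tz !ap0.
  have [p <-] := cs q; rewrite pi'E => /(blend_bot bZ) [u uE].
  have [|a aE] := @blend_diff Z' (z' $ p) (bmu Z' $ u) bZ'.
    by rewrite -zz' uE pm pm'.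
  exists a; rewrite elM -[LHS]add0r -(c0 u) -apD; congr (c $ _); apply: zzi.
    by rewrite apD sz tz addr0.
  by rewrite apD sz' tz'.
exists P, z, c, z'; split=> //=.
- move=> z0 e0; have [p <-] := cs e0; rewrite pi'E => wz.
  have [u uE] := exact_diff wE wz.
  have [|a aE] := @blend_diff Z z0 (z $ (p + s $ u)) bZ.
    by rewrite uE !apD sz pm.
  exists (p + s $ u + s $ i $ a); split; first by rewrite aE !apD !sz.
  by rewrite !apD !c0 !addr0.
- move=> p u a zp; rewrite elM => /(exact_diff cE) [u' pE2].
  have -> : u = u' by apply: muI; rewrite -zp pE2 apD tz sz add0r.
  by rewrite pE2 !apD tz' sz' addrC.
Qed.

(** The argument of [is_sum_functional] with [E] and [Z'] exchanged: the witnesses are compared over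
    [Z] and [Z'], and the map to [E2] descends to [E1]. *)
Lemma is_sum_free Z E1 E2 Z' : is_blend Z -> is_blend Z' ->
  el_ext E1 -> el_ext E2 -> is_sum Z E1 Z' -> is_sum Z E2 Z' ->
  exists h, @ext_mor _ _ _ _ _ _ E1 E2 (idm A) (idm R) h.
Proof.
move=> bZ bZ' eE1 eE2 [P1 [z1 [e1 [z1' S1]]]] [P2 [z2 [e2 [z2' S2]]]].
have [pm ps mi pE] := bZ; have [pm' ps' mi' pE'] := bZ'.
have [ii1 prs1 [pi01 prE1]] := eE1; have [ii2 prs2 [pi02 prE2]] := eE2.
have [zz1 ze1 lft1 def1] := S1; have [zz2 ze2 lft2 def2] := S2.
have [bi0 bE wb0 wE ws] := base.
have [Q [q1 [q2 [qq lft _ _]]]] :=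
  pullback F (inl_ ∘ z1 + inr_ ∘ z1') (inl_ ∘ z2 + inr_ ∘ z2').
have qqz q : z1 $ q1 $ q = z2 $ q2 $ q.
  by have /(congr1 (fmor F prl)) := el_congr q qq; rewrite !elE !bipE.
have qqe q : z1' $ q1 $ q = z2' $ q2 $ q.
  by have /(congr1 (fmor F prr)) := el_congr q qq; rewrite !elE !bipE.
have {}lft p1 p2 : z1 $ p1 = z2 $ p2 -> z1' $ p1 = z2' $ p2 ->
    exists q, q1 $ q = p1 /\ q2 $ q = p2.
  by move=> zp ep; apply: lft; rewrite !elE zp ep.
(* Elements of [P1] and [P2] chosen over the same [z0] have images in [Z'] that differ by some [a]
   in [A]; adding to the second an element of [P2] with components 0 and [inc E2 $ a] makes them
   agree. *)
have over e0 : exists q, e1 $ q1 $ q = e0.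
  have [v vE] := ws (prj E1 $ e0); have [z0 z0E] := ps v.
  have [e0' e0'E] := prs2 (prj E1 $ e0).
  have [|p1 [zp1 ep1]] := lft1 z0 e0; first by rewrite z0E.
  have [|p2 [zp2 ep2]] := lft2 z0 e0'; first by rewrite z0E vE.
  have [|a aE] := @blend_diff Z' (z1' $ p1) (z2' $ p2) bZ'.
    by rewrite -zz1 -zz2 zp1 zp2.
  have [|p [zp ep]] := lft2 0 (inc E2 $ a); first by rewrite pi02 !ap0.
  have [||q [qE _]] := lft p1 (p2 + p).
  - by rewrite apD zp1 zp2 zp addr0.
  - by rewrite apD aE (def2 p 0 a) // ?ap0 // add0r.
  by exists q; rewrite qE.
have [||h hE] := @desc _ _ F _ _ _ (e1 ∘ q1) (e2 ∘ q2).
- by move=> e0; have [q <-] := over e0; exists q; rewrite elM.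
- move=> q; rewrite !elM => e0.
  have wz : w $ bpi Z $ z1 $ q1 $ q = 0 by rewrite -ze1 e0 ap0.
  have [u uE] := blend_bot bZ wz.
  have [|a aE] := prE2 (e2 $ q2 $ q); first by rewrite ze2 -qqz wz.
  have d1 := def1 (q1 $ q) u 0 uE; rewrite e0 !ap0 addr0 in d1.
  have d2 : z2' $ q2 $ q = bmu Z' $ (u + i $ a) by apply: def2; rewrite -?qqz.
  move: d2; rewrite -qqe d1 // apD -[LHS]addr0 => /addrI /esym /mi' a0.
  by rewrite -aE a0 ap0.
have {}hE q : h $ e1 $ q1 $ q = e2 $ q2 $ q by rewrite -!elM -compA hE.
exists h; split; apply: (el_eq (F := F)) => x; rewrite !elM el1.
- have [|p1 [zp1 ep1]] := lft1 0 (inc E1 $ x); first by rewrite pi01 !ap0.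
  have [|p2 [zp2 ep2]] := lft2 0 (inc E2 $ x); first by rewrite pi02 !ap0.
  have [||q [q1E q2E]] := lft p1 p2; first by rewrite zp1 zp2.
    by rewrite (def1 p1 0 x) ?ap0 // (def2 p2 0 x) ?ap0.
  by rewrite -ep1 -q1E hE q2E ep2.
- by have [q <-] := over x; rewrite hE ze2 -qqz ze1.
Qed.

End Base.

Definition ext_blend (A R : C) (E : extSeq R A) : blend A R := Blend (inc E) (prj E).

Lemma ext_blend_base (A R : C) : blend_base (idm A) 0 (idm R).
Proof.
split.
- by move=> a; rewrite el0.
- by move=> a _; exists a; rewrite el1.
- by move=> a; rewrite el0 el1.
- by move=> r; rewrite el1 => ->; exists 0; rewrite el0.
- by move=> r; exists r; rewrite el1.
Qed.

Lemma is_ext_blend (A R : C) (E : extSeq R A) :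
  el_ext E <-> is_blend (idm A) 0 (ext_blend E).
Proof.
split=> [[ii ps [pi0 pE]]|[pi0 ps ii pE]]; split=> //=.
- by move=> u; rewrite pi0 el0.
- by move=> a; rewrite el1; exact: ii.
- by move=> z /pE [a <-]; exists a; rewrite el1.
- by move=> a a0; apply: ii; rewrite el1.
- by split=> [a|z /pE [a <-]]; [rewrite pi0 el0|exists a; rewrite el1].
Qed.

Definition ext_is_sum (A R : C) (E1 E2 E3 : extSeq R A) :=
  is_sum (idm A) (idm R) (ext_blend E1) E2 (ext_blend E3).

Lemma ext_is_sum_sym (A R : C) (E1 E2 E3 : extSeq R A) :
  ext_is_sum E1 E2 E3 -> ext_is_sum E2 E1 E3.
Proof.
move=> [P [z [e [z' [zz' ze lft def]]]]]; exists P, e, z, z'.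
have {}ze p : prj E2 $ e $ p = prj E1 $ z $ p by rewrite ze el1.
split=> /=.
- by move=> p; rewrite ze zz'.
- by move=> p; rewrite el1 ze.
- move=> z0 e0 ze0; have [|p [pz pe]] := lft e0 z0; last by exists p.
  by rewrite -ze0 !el1.
- by move=> p u a zp ep; rewrite (def p a u) //= !el1 addrC.
Qed.

Section Assoc.
Variables (A U V R : C) (i : hom A U) (b : hom U V) (w : hom V R).
Hypothesis base : blend_base i b w.

(** [(Z + E1) + E2 = Z + (E1 + E2)] by gluing the three witnesses: [D] matches the two values in
    [Z1], and [Q] matches the components in [E1] and [E2]. *)
Lemma is_sum_add (Z Z1 Z2 : blend U V) (E1 E2 E3 : extSeq R A) :
  el_ext E1 -> el_ext E2 -> el_ext E3 ->
  is_sum i w Z E1 Z1 -> is_sum i w Z1 E2 Z2 -> ext_is_sum E1 E2 E3 ->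
  is_sum i w Z E3 Z2.
Proof.
move=> [ii1 prs1 [pi01 prE1]] [ii2 prs2 [pi02 prE2]] [ii3 prs3 [pi03 prE3]].
move=> [P1 [z1 [e1 [z1' [zz1 ze1 lft1 def1]]]]].
move=> [P2 [z2 [e2 [z2' [zz2 ze2 lft2 def2]]]]].
move=> [S [s1 [s2 [s3 [ss ss2 lfts defs]]]]].
rewrite /= in ss ss2 lfts defs.
have {}ss2 p : prj E2 $ s2 $ p = prj E1 $ s1 $ p by rewrite ss2 el1.
have [D [d1 [d2 [dd lftd _ _]]]] := pullback F z1' z2.
have {}dd p : z1' $ d1 $ p = z2 $ d2 $ p by rewrite -!elM dd.
have [Q [q [s [qq lft _ _]]]] :=
  pullback F (inl_ ∘ e1 ∘ d1 + inr_ ∘ e2 ∘ d2) (inl_ ∘ s1 + inr_ ∘ s2).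
have qq1 x : e1 $ d1 $ q $ x = s1 $ s $ x.
  by have /(congr1 (fmor F prl)) := el_congr x qq; rewrite !elE !bipE.
have qq2 x : e2 $ d2 $ q $ x = s2 $ s $ x.
  by have /(congr1 (fmor F prr)) := el_congr x qq; rewrite !elE !bipE.
exists Q, (z1 ∘ d1 ∘ q), (s3 ∘ s), (z2' ∘ d2 ∘ q); split.
- by move=> p; rewrite !elM zz1 dd zz2.
- by move=> p; rewrite !elM -ss -qq1 ze1.
- move=> z0 e0 ze0.
  have [e10 e10E] := prs1 (prj E3 $ e0); have [e20 e20E] := prs2 (prj E3 $ e0).
  have [|x [x1 x2]] := lfts e10 e20; first by rewrite el1 e10E.
  have [|a aE] := exact_diff prE3 (y := e0) (y' := s3 $ x).
    by rewrite -ss x1 e10E.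
  (* The element [x] of [S] reaches [e0] only up to some [a]; the correction [x'] adds it, at the
     cost of changing the [E2]-component by [inc E2 $ a]. *)
  have [|x' [x'1 x'2]] := lfts 0 (inc E2 $ a); first by rewrite pi02 !ap0.
  have x'3 : s3 $ x' = inc E3 $ a.
    by rewrite (defs x' 0 a) ?ap0 // el1 add0r.
  have [|p1 [p1z p1e]] := lft1 z0 e10; first by rewrite e10E.
  have [|p2 [p2z p2e]] := lft2 (z1' $ p1) (s2 $ (x + x')).
    by rewrite -zz1 p1z ze0 apD x2 x'2 apD e20E pi02 addr0.
  have [y [y1 y2]] := lftd p1 p2 (esym p2z).
  have [|t [t1 t2]] := lft y (x + x').
    by rewrite !elE y1 y2 p1e p2e x1 x'1 !apD !ap0 addr0.
  by exists t; rewrite !elM t1 t2 y1 p1z aE apD x'3.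
- move=> p u a; rewrite !elM => zp sp.
  have [|a1 a1E] := prE1 (s1 $ s $ p); first by rewrite ss sp pi03.
  have [|a2 a2E] := prE2 (s2 $ s $ p); first by rewrite ss2 ss sp pi03.
  have aa : a = a1 + a2.
    apply: (injE ii3); rewrite -sp (defs _ a1 a2) ?el1 //.
  have zp1 : z1' $ d1 $ q $ p = bmu Z1 $ (u + i $ a1) by apply: def1; rewrite ?qq1.
  by rewrite (def2 _ (u + i $ a1) a2) -?dd ?qq2 // aa [i $ (a1 + a2)]apD addrA.
Qed.

Lemma is_sum_base (U1 V1 : C) (fU : hom U U1) (fV : hom V1 V)
    (Z Z' : blend U1 V1) (E : extSeq R A) :
  is_sum (fU ∘ i) (w ∘ fV) Z E Z' ->
  is_sum i w (Blend (bmu Z ∘ fU) (fV ∘ bpi Z)) E (Blend (bmu Z' ∘ fU) (fV ∘ bpi Z')).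
Proof.
move=> [P [z [e [z' [zz' ze lft def]]]]]; exists P, z, e, z'; split=> /=.
- by move=> p; rewrite !elM zz'.
- by move=> p; rewrite ze !elM.
- by move=> z0 e0; rewrite elM => ze0; apply: lft; rewrite elM.
- by move=> p u a; rewrite elM => zp ep; rewrite (def p (fU $ u) a) // !elM !apD.
Qed.

End Assoc.
End Blends.

(** * Baer sum diagrams and the relation [is_sum] *)

Section Diagrams.
Variables (K : fieldType) (C : tensCat K) (F : fiberFunctor C).

Local Notation "f $ x" := (fmor F f x) (at level 30, right associativity).

Section PullbackExt.
Variables (Y X Y' : C) (E : extSeq Y X) (E' : extSeq Y' X) (b : hom Y' Y)
  (h : hom (mid E') (mid E)).
Hypotheses (eE : el_ext F E) (eE' : el_ext F E') (hP : ext_mor E' E (idm X) b h).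

Lemma ext_pullback_inj x y : h $ x = h $ y -> prj E' $ x = prj E' $ y -> x = y.
Proof.
have [hi ph] := hP; have [ii ps [pi0 pE]] := eE; have [ii' ps' [pi0' pE']] := eE'.
move=> hxy /(exact_diff pE') [a xE]; move: hxy; rewrite xE apD.
rewrite -[h $ inc E' $ a]elM hi compm1 -[RHS]addr0 => /addrI /ii ->.
by rewrite ap0 addr0.
Qed.

Lemma ext_pullback_lift e y : prj E $ e = b $ y ->
  exists x, h $ x = e /\ prj E' $ x = y.
Proof.
have [hi ph] := hP; have [ii ps [pi0 pE]] := eE; have [ii' ps' [pi0' pE']] := eE'.
have [x0 <-] := ps' y; rewrite -elM -ph elM => /(exact_diff pE) [a ->].
exists (x0 + inc E' $ a); rewrite !apD pi0' addr0.
by rewrite -[h $ inc E' $ a]elM hi compm1.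
Qed.

Lemma ext_pullback_univ (Z : C) (u : hom Z Y') (v : hom Z (mid E)) :
  prj E ∘ v = b ∘ u -> exists t, prj E' ∘ t = u /\ h ∘ t = v.
Proof.
move=> vu; have [||t tE] := @lift _ _ F _ _ _ (inl_ ∘ h + inr_ ∘ prj E')
    (inl_ ∘ v + inr_ ∘ u).
- move=> x x0; apply: ext_pullback_inj; rewrite !ap0.
    by have := congr1 (fmor F prl) x0; rewrite !elE !bipE.
  by have := congr1 (fmor F prr) x0; rewrite !elE !bipE.
- move=> z; have [|x [xv xu]] := @ext_pullback_lift (v $ z) (u $ z).
    by rewrite -!elM vu.
  by exists x; rewrite !elE xv xu.
exists t; split; apply: (el_eq (F := F)) => z; have := el_congr z tE.
  by move=> /(congr1 (fmor F prr)); rewrite !elE !bipE.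
by move=> /(congr1 (fmor F prl)); rewrite !elE !bipE.
Qed.

End PullbackExt.

Lemma ext_sum_el (Y X : C) (E1 E2 : extSeq Y X) :
  el_ext F E1 -> el_ext F E2 -> el_ext F (ext_sum E1 E2).
Proof.
move=> [ii1 ps1 [pi1 pE1]] [ii2 ps2 [pi2 pE2]]; split=> /=.
- move=> x x0; rewrite [x]el_bip.
  have := congr1 (fmor F prl) x0; rewrite !elE !bipE => /ii1 ->.
  by have := congr1 (fmor F prr) x0; rewrite !elE !bipE => /ii2 ->; rewrite ap0.
- move=> y; have [x1 x1E] := ps1 (prl $ y); have [x2 x2E] := ps2 (prr $ y).
  exists (inl_ $ x1 + inr_ $ x2); rewrite !elE !bipE x1E x2E.
  by rewrite [RHS]el_bip.
split=> [x|y y0]; first by rewrite !elE !bipE pi1 pi2 !ap0 addr0.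
have [|x1 x1E] := pE1 (prl $ y).
  by have := congr1 (fmor F prl) y0; rewrite !elE !bipE.
have [|x2 x2E] := pE2 (prr $ y).
  by have := congr1 (fmor F prr) y0; rewrite !elE !bipE.
exists (inl_ $ x1 + inr_ $ x2); rewrite !elE !bipE x1E x2E.
by rewrite [RHS]el_bip.
Qed.

Section BaerDiagram.
Variables (A V V' : C) (E1 E2 : extSeq V A) (E3 : extSeq V' A) (g : hom V V').
Hypotheses (eE1 : el_ext F E1) (eE2 : el_ext F E2).

Lemma diag_inj (P : extSeq V (bip A A)) h : el_ext F P ->
  ext_mor P (ext_sum E1 E2) (idm _) (diag V) h ->
  forall x y, h $ x = h $ y -> x = y.
Proof.
move=> eP hP x y xy; apply: (ext_pullback_inj (ext_sum_el eE1 eE2) eP hP xy).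
have [_ /=] := hP => ph; have := congr1 (fmor F (prl ∘ prj (ext_sum E1 E2))) xy.
rewrite !elM -![_ $ h $ _]elM ph /diag => /=.
by rewrite !elE !bipE.
Qed.

(** The pullback of [ext_sum E1 E2] along [diag V] is the fibre product of the two middle objects
    over [V]. *)
Lemma baer_diagram_parts (P : extSeq V (bip A A)) h : el_ext F P ->
  ext_mor P (ext_sum E1 E2) (idm _) (diag V) h ->
  [/\ forall x, prj E1 $ prl $ h $ x = prj P $ x,
      forall x, prj E2 $ prr $ h $ x = prj P $ x,
      forall z1 z2, prj E1 $ z1 = prj E2 $ z2 ->
        exists x, prl $ h $ x = z1 /\ prr $ h $ x = z2
    & forall c, prl $ h $ inc P $ c = inc E1 $ prl $ c /\
                prr $ h $ inc P $ c = inc E2 $ prr $ c].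
Proof.
move=> eP hP; have [hi ph] := hP; rewrite /= in hi ph; split.
- move=> x; have := congr1 (fmor F prl) (el_congr x ph).
  by rewrite /diag !elE !bipE.
- move=> x; have := congr1 (fmor F prr) (el_congr x ph).
  by rewrite /diag !elE !bipE.
- move=> z1 z2 zz.
  have [|x [xE _]] := @ext_pullback_lift _ _ _ _ _ _ _
      (ext_sum_el eE1 eE2) eP hP (inl_ $ z1 + inr_ $ z2) (prj E1 $ z1).
    by rewrite /= /diag !elE !bipE zz.
  by exists x; rewrite xE !elE !bipE.
- move=> c; rewrite -[h $ _]elM hi compm1; split.
    by rewrite !elE !bipE.
  by rewrite !elE !bipE.
Qed.

(** [P0] covers the pullback [P] through [w0], so [z'] descends to [q]. The arrow [g] is there
    because the row of [Y'] lies over an object that is only isomorphic to the one under the row of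
    [Y]. *)
Lemma baer_diagram (P0 : C) (z : hom P0 (mid E1)) (f : hom P0 (mid E2))
    (z' : hom P0 (mid E3)) :
  (forall p, prj E1 $ z $ p = prj E2 $ f $ p) ->
  (forall p, prj E3 $ z' $ p = g $ prj E1 $ z $ p) ->
  (forall z0 f0, prj E1 $ z0 = prj E2 $ f0 -> exists p, z $ p = z0 /\ f $ p = f0) ->
  (forall p a1 a2, z $ p = inc E1 $ a1 -> f $ p = inc E2 $ a2 ->
     z' $ p = inc E3 $ (a1 + a2)) ->
  exists (P : extSeq V (bip A A)) h q (w0 : hom P0 (mid P)),
    [/\ exact P, ext_mor P (ext_sum E1 E2) (idm (bip A A)) (diag V) h,
        ext_mor P E3 (codiag A) g q,
        h ∘ w0 = inl_ ∘ z + inr_ ∘ f & q ∘ w0 = z'].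
Proof.
move=> zf zz' lft def.
have /(exact_el F) exS := ext_sum_el eE1 eE2.
have [P [exP [h hP]]] := ext_pullback F (diag V) exS.
have /(exact_el F) eP := exP.
have [p1 p2 plift pinc] := baer_diagram_parts eP hP.
have hinj := diag_inj eP hP.
have [||w0 w0E] := @lift _ _ F _ _ _ h (inl_ ∘ z + inr_ ∘ f).
- by move=> x x0; apply: hinj; rewrite x0 ap0.
- move=> p; have [x [x1 x2]] := plift _ _ (zf p); exists x.
  by rewrite [LHS]el_bip x1 x2 !elE.
have w0z p : prl $ h $ w0 $ p = z $ p by rewrite -[h $ _]elM w0E !elE !bipE.
have w0f p : prr $ h $ w0 $ p = f $ p by rewrite -[h $ _]elM w0E !elE !bipE.
have w0s x : exists p, w0 $ p = x.
  have [|p [pz pf]] := lft (prl $ h $ x) (prr $ h $ x); first by rewrite p1 p2.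
  exists p; apply: hinj; rewrite [LHS]el_bip [RHS]el_bip w0z w0f pz pf.
  by [].
have [|q qE] := @desc _ _ F _ _ _ w0 z' w0s.
  move=> p w0p; rewrite (def p 0 0) ?addr0 ?ap0 //.
    by rewrite -w0z w0p !ap0.
  by rewrite -w0f w0p !ap0.
have qE' p : q $ w0 $ p = z' $ p by rewrite -elM qE.
exists P, h, q, w0; split=> //; split; apply: (el_eq (F := F)) => x; rewrite !elM.
- have [p pE] := w0s (inc P $ x); rewrite -pE qE' (def p (prl $ x) (prr $ x)).
  + by rewrite elD.
  + by rewrite -w0z pE; have [] := pinc x.
  + by rewrite -w0f pE; have [] := pinc x.
- by have [p <-] := w0s x; rewrite qE' zz' -w0z p1.
Qed.

Lemma baer_diagram_def (P : extSeq V (bip A A)) h q : el_ext F P ->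
  ext_mor P (ext_sum E1 E2) (idm (bip A A)) (diag V) h ->
  ext_mor P E3 (codiag A) g q ->
  forall p a1 a2, prl $ h $ p = inc E1 $ a1 -> prr $ h $ p = inc E2 $ a2 ->
    q $ p = inc E3 $ (a1 + a2).
Proof.
move=> eP hP [qi pq] p a1 a2 zp fp.
have [p1 p2 plift pinc] := baer_diagram_parts eP hP.
have -> : p = inc P $ (inl_ $ a1 + inr_ $ a2).
  apply: (diag_inj eP hP); rewrite [LHS]el_bip [RHS]el_bip zp fp.
  by have [-> ->] := pinc (inl_ $ a1 + inr_ $ a2); rewrite !apD !bipE.
by rewrite -elM qi elM elD !apD !bipE.
Qed.

End BaerDiagram.

Lemma is_baer_sumP (R A : C) (E1 E2 E3 : extSeq R A) :
  exact E1 -> exact E2 -> is_baer_sum E1 E2 E3 <-> ext_is_sum F E1 E2 E3.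
Proof.
move=> /(exact_el F) e1 /(exact_el F) e2; split.
- move=> [P [h [q [/(exact_el F) eP hP qP]]]].
  have [p1 p2 plift pinc] := baer_diagram_parts e1 e2 eP hP.
  exists (mid P), (prl ∘ h), (prr ∘ h), q; split=> /=.
  + by move=> p; rewrite elM p1 -elM (proj2 qP) comp1m.
  + by move=> p; rewrite !elM el1 p1 p2.
  + by move=> z0 e0; rewrite el1 => /plift [p [<- <-]]; exists p; rewrite !elM.
  + move=> p u a; rewrite !elM el1.
    exact: (baer_diagram_def e1 e2 eP hP qP).
- move=> [P0 [z [f [z' [zz' ze lft def]]]]].
  have [||||P [h [q [w0 [? ? ? _ _]]]]] := @baer_diagram _ _ _ E1 E2 E3 (idm R) e1 e2 P0 z f z'.
  + by move=> p; rewrite ze el1.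
  + by move=> p; rewrite el1 zz'.
  + by move=> z0 f0 zf; apply: lft; rewrite el1.
  + by move=> p a1 a2 zp fp; rewrite (def p a1 a2) // el1.
  by exists P, h, q.
Qed.

End Diagrams.

(** * Translation at a top object as a sum of blended extensions *)

Section TopTranslate.
Variables (K : fieldType) (C : tensCat K) (F : fiberFunctor C).
Variables (k : nat) (A : nat -> C) (l : nat).

Local Notation "f $ x" := (fmor F f x) (at level 30, right associativity).

Definition top_blend (Y : gext k A l) m d : blend (gX Y m d) (gX Y m.+1 d) :=
  Blend (mono Y m d) (epi Y m d).

(** [Y'] has its own truncation; conjugation by [f] turns its top object into a blend between the
    same [U] and [V] as that of [Y]. *)
Definition conj_blend (Y Y' : gext k A l) (f : giso (trunc Y) (trunc Y')) m d :
    blend (gX Y m d) (gX Y m.+1 d) :=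
  Blend (mono Y' m d ∘ gfun f m d) (ginv f m.+1 d ∘ epi Y' m d).

Definition top_base (Y : gext k A l) m d :=
  blend_base F (from_bot (mono Y) m d) (epi Y m d ∘ mono Y m d) (to_top (epi Y) m.+1 d).

(** [top_translate] first pulls [E] back to [V] and then adds extensions of [V] by [A], with [u]
    tracking the inclusion of [U]; [is_sum] does all of this at once over [R]. The canonical section
    [t], zero in [E], is what relates the two. *)
Lemma top_translateP (Y Y' : gext k A l) (f : giso (trunc Y) (trunc Y')) m d
    (E : ext (A (top m.+1 d)) (A m.+1)) :
  top_base Y m d -> el_ext F (hseq Y m d) ->
  mutually_inverse (gfun f m.+1 d) (ginv f m.+1 d) ->
  gfun f m d ∘ from_bot (mono Y) m d = from_bot (mono Y') m d ->
  top_translate f E <->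
  is_sum F (from_bot (mono Y) m d) (to_top (epi Y) m.+1 d)
    (top_blend Y m d) E (conj_blend f m d).
Proof.
move=> base eY [fK Kf] fbot.
have [bi0 bE wb0 wE ws] := base; have /(exact_el F) eE := ext_exact E.
have botE a : inc (hseq Y' m d) $ a =
    mono Y' m d $ gfun f m d $ from_bot (mono Y) m d $ a.
  by rewrite /= elM -fbot elM.
split.
- move=> [G [hG [P [h [q [t [u [[exG hGP] [exP hP] qP [tG t0] [hu qu]]]]]]]]].
  have /(exact_el F) eG := exG; have /(exact_el F) eP := exP.
  have [p1 p2 plift pinc] := baer_diagram_parts eY eG eP hP.
  exists (mid P), (prl ∘ h), (hG ∘ prr ∘ h), q; split=> /=.
  + move=> p; rewrite elM [LHS]p1 elM -[epi Y' m d $ q $ p]elM (proj2 qP) elM.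
    by rewrite -[RHS]elM fK el1.
  + by move=> p; rewrite !elM -[prj E $ _]elM (proj2 hGP) elM p2 -p1.
  + move=> z0 e0 ze0.
    have [|g [ge gz]] := ext_pullback_lift eE eG hGP (e := e0) (y := epi Y m d $ z0).
      by rewrite ze0.
    have [|p [pz pg]] := plift z0 g; first by rewrite gz.
    by exists p; rewrite !elM pz pg.
  + move=> p x a; rewrite !elM => zp gp.
    have gpE : prr $ h $ p = t $ x + inc G $ a.
      have [_ _ [piG _]] := eG.
      apply: (ext_pullback_inj eE eG hGP).
        rewrite gp apD -[hG $ t $ x]elM t0 el0 add0r.
        by rewrite -[hG $ _]elM (proj1 hGP) compm1.
      rewrite p2 -p1 zp apD piG addr0 -[prj G $ t $ x]elM tG elM.
      by [].
    (* An element lying over [U] and [A] is determined by its two components, and those of the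
       right-hand side are the same; [q] is then known on each summand. *)
    have -> : p = u $ x + inc P $ inr_ $ a.
      apply: (diag_inj eY eG eP hP); rewrite [LHS]el_bip zp gpE [h $ (_ + _)]apD.
      rewrite -[h $ u $ x]elM hu [h $ inc P $ _]el_bip.
      have [-> ->] := pinc (inr_ $ a).
      by rewrite !elE !bipE addrA.
    have qa : q $ inc P $ inr_ $ a = inc (hseq Y' m d) $ a.
      by rewrite -elM (proj1 qP) elM /codiag elD bipE el_prr_inr add0r.
    by rewrite apD qa botE -[q $ u $ x]elM qu !elM !apD.
- move=> [P0 [z [e [z' [zz' ze lft def]]]]]; rewrite /= in zz' ze lft def.
  have [G [exG [hG hGP]]] := ext_pullback F (to_top (epi Y) m.+1 d) (ext_exact E).
  have /(exact_el F) eG := exG.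
  (* [phi] lifts [e] to the pullback [G] of [E], so that [P0] covers the fibre product of the row of
     [Y] and [G] over [V]. *)
  have [|phi [phiz phie]] := ext_pullback_univ eE eG hGP (u := epi Y m d ∘ z) (v := e).
    by apply: (el_eq (F := F)) => p; rewrite !elM ze.
  have [|t [tG t0]] := ext_pullback_univ eE eG hGP
      (u := epi Y m d ∘ mono Y m d) (v := 0).
    by apply: (el_eq (F := F)) => p; rewrite !elM el0 ap0 -[epi Y m d $ _]elM wb0.
  have {}phiz p : prj G $ phi $ p = epi Y m d $ z $ p by rewrite -!elM phiz.
  have {}phie p : hG $ phi $ p = e $ p by rewrite -!elM phie.
  have lft2 z0 f0 : epi Y m d $ z0 = prj G $ f0 -> exists p, z $ p = z0 /\ phi $ p = f0.
    move=> zf; have [|p [pz pe]] := lft z0 (hG $ f0).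
      by rewrite zf -[prj E $ _]elM (proj2 hGP) elM.
    exists p; split=> //; apply: (ext_pullback_inj eE eG hGP); first by rewrite phie.
    by rewrite phiz pz.
  have [||||P [h [q [w0 [exP hP qP w0E qE]]]]] :=
    @baer_diagram _ _ F _ _ _ (hseq Y m d) G (hseq Y' m d) (gfun f m.+1 d) eY eG P0 z phi z'.
  + by move=> p; rewrite phiz.
  + by move=> p /=; rewrite zz' elM -[RHS]elM Kf el1.
  + exact: lft2.
  + move=> p a1 a2 zp fp.
    rewrite botE apD (def p (from_bot (mono Y) m d $ a1) a2) //.
    * by rewrite !elM.
    * by rewrite zp /= elM.
    * by rewrite -phie fp -elM (proj1 hGP) compm1.
  have /(exact_el F) eP := exP.
  have hinj := diag_inj eY eG eP hP.
  have [||u uE] := @lift _ _ F _ _ _ h (inl_ ∘ mono Y m d + inr_ ∘ t).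
  + by move=> x x0; apply: hinj; rewrite x0 ap0.
  + move=> x; have [|p [pz pf]] := lft2 (mono Y m d $ x) (t $ x).
      by rewrite -[prj G $ _]elM tG elM.
    by exists (w0 $ p); rewrite -elM w0E !elE pz pf.
  exists G, hG, P, h, q, t, u; split=> //; split=> //.
  apply: (el_eq (F := F)) => x; rewrite elM.
  have [|p [pz pf]] := lft2 (mono Y m d $ x) (t $ x).
    by rewrite -[prj G $ _]elM tG elM.
  have -> : u $ x = w0 $ p.
    by apply: hinj; rewrite -![h $ _]elM uE w0E !elE pz pf.
  rewrite -[q $ _]elM qE (def p x 0) //; first by rewrite ap0 addr0.
  by rewrite -phie pf -elM t0 el0 ap0.
Qed.

End TopTranslate.

(** * Generalized extensions with prescribed top objects *)

Section GextStructure.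
Variables (K : fieldType) (C : tensCat K) (F : fiberFunctor C).
Variables (k : nat) (A : nat -> C).

Local Notation "f $ x" := (fmor F f x) (at level 30, right associativity).

Lemma in_rangeS l m d : in_range k l m d.+1 -> in_range k l m.+1 d /\ in_range k l m d.
Proof. by rewrite /in_range; lia. Qed.

Lemma from_bot_inj l (Y : gext k A l) m d : in_range k l m d ->
  inj F (from_bot (mono Y) m d).
Proof.
elim: d => [|d IHd] r x /=; first by rewrite el1.
by rewrite elM => /(proj1 (is_mono_el F _) (monoP Y r)) /(IHd (proj2 (in_rangeS r))).
Qed.

(** Horizontal exactness follows from the vertical one by induction. An element killed by the
    epimorphism dies in [A_n], so it comes from [X_{m,n-1}]; by the square and the monomorphism one
    row up, it is in the kernel of the shorter horizontal sequence. *)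
Lemma hseq_el l (Y : gext k A l) m d : in_range k l m d.+1 -> el_ext F (hseq Y m d).
Proof.
elim: d => [|d IHd] r; split=> /=.
- exact: (from_bot_inj (Y := Y) (d := 1)).
- exact/is_epi_el/epiP.
- have [_ _ [v0 vE]] := short_exact_el F (vexactP Y r); split=> x.
    by have := v0 x; rewrite /= comp1m compm1.
  move=> x0; have [|y <-] := vE x; first by rewrite /= comp1m.
  by exists y; rewrite compm1.
- exact: (from_bot_inj (Y := Y) (d := d.+2)).
- exact/is_epi_el/epiP.
have [r1 r2] := in_rangeS r; have [_ _ [h0 hE]] := IHd r2.
have sq x : epi Y m d.+1 $ mono Y m d.+1 $ x = mono Y m.+1 d $ epi Y m d $ x.
  by rewrite -!elM squareP.
have [_ _ [v0 vE]] := short_exact_el F (vexactP Y r); split=> x.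
  by have /= hx := h0 x; rewrite elM sq hx ap0.
move=> x0; have [|y yE] := vE x; first by rewrite /= elM x0 ap0.
move: x0; rewrite -yE sq => /(proj1 (is_mono_el F _) (monoP Y r1)) /hE [a <-].
by exists a; rewrite elM.
Qed.

(** By the square, the middle arrow factors through [X_{m+1,n-1}], and the base is the splice there
    of a horizontal and a vertical sequence. *)
Lemma top_baseP l (Y : gext k A l) m d : in_range k l m d.+2 -> top_base F Y m d.+1.
Proof.
move=> r; have [r1 r2] := in_rangeS r.
have [hi hs [h0 hE]] := hseq_el Y r2.
have [_ ws [v0 vE]] := short_exact_el F (vexactP Y r1).
rewrite /top_base squareP //; split=> //.
- by move=> a; rewrite elM h0 ap0.
- by move=> u; rewrite elM => /(proj1 (is_mono_el F _) (monoP Y r1)) /hE.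
- by move=> u; rewrite elM v0.
- by move=> v /vE [y <-]; have [u <-] := hs y; exists u; rewrite elM.
Qed.

Lemma top_blendP l (Y : gext k A l) m d : in_range k l m d.+1 ->
  is_blend F (from_bot (mono Y) m d) (epi Y m d ∘ mono Y m d) (top_blend Y m d).
Proof.
move=> r; have [hi hs [h0 hE]] := hseq_el Y r; split=> //=.
- by move=> u; rewrite elM.
- by move=> a a0; apply: hi; rewrite /= elM.
- by move=> z /hE [a <-]; exists a; rewrite /= elM.
Qed.

Lemma gfun_from_bot l (X X' : gext k A l) (f : giso X X') m d : id_on_A f ->
  in_range k l m d -> gfun f m d ∘ from_bot (mono X) m d = from_bot (mono X') m d.
Proof.
move=> f1; elim: d => [|d IHd] r /=.
  by rewrite compm1 f1 //; move: r; rewrite /in_range; lia.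
have [_ fm] := gfun_mor f r; rewrite compA -fm -compA IHd //.
by have [] := in_rangeS r.
Qed.

Lemma gfun_to_top l (X X' : gext k A l) (f : giso X X') m d : id_on_A f ->
  in_range k l m d -> to_top (epi X') m d ∘ gfun f m d = to_top (epi X) m d.
Proof.
move=> f1; elim: d m => [|d IHd] m r /=.
  by rewrite comp1m f1 //; move: r; rewrite /in_range; lia.
have [fe _] := gfun_mor f r; rewrite -compA fe compA IHd //.
by have [] := in_rangeS r.
Qed.

Lemma conj_blendP l (Y Y' : gext k A l) (f : giso (trunc Y) (trunc Y')) m d :
  id_on_A f -> in_range k l m d.+2 -> d.+2 = l ->
  is_blend F (from_bot (mono Y) m d.+1) (epi Y m d.+1 ∘ mono Y m d.+1)
    (conj_blend f m d.+1).
Proof.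
move=> f1 r dl.
have r1 : in_range k l.-1 m d.+1 by move: r; rewrite /in_range; lia.
have r2 : in_range k l.-1 m.+1 d.+1 by move: r; rewrite /in_range; lia.
have [bm bs bi bE] := top_blendP Y' r.
have /= fb := gfun_from_bot f1 r1.
have fe : epi Y' m d ∘ gfun f m d.+1 = gfun f m.+1 d ∘ epi Y m d.
  by have [] := gfun_mor f r1.
have fm : mono Y' m.+1 d ∘ gfun f m.+1 d = gfun f m.+1 d.+1 ∘ mono Y m.+1 d.
  by have [] := gfun_mor f r2.
have /= [fK2 Kf2] := gfunK f r2; have /= [fK1 Kf1] := gfunK f r1.
split=> /=.
- move=> u; rewrite -!elM -compA [epi Y' m d.+1 ∘ _]compA.
  have -> : epi Y' m d.+1 ∘ mono Y' m d.+1 ∘ gfun f m d.+1 =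
      gfun f m.+1 d.+1 ∘ (epi Y m d.+1 ∘ mono Y m d.+1).
    by rewrite !squareP // -compA fe compA fm -compA.
  by rewrite compA fK2 comp1m.
- move=> v; have [z zE] := bs (gfun f m.+1 d.+1 $ v); exists z.
  by rewrite elM zE -elM fK2 el1.
- by move=> a; rewrite elM -[gfun f m d.+1 $ _]elM fb; exact: bi.
- move=> z; rewrite elM => z0; have [|a aE] := bE z.
    by rewrite /= -[LHS]el1 -Kf2 elM z0 ap0.
  by exists a; rewrite elM -[gfun f m d.+1 $ _]elM fb aE.
Qed.

Lemma ginv_is_gmor l (X X' : gext k A l) (f : gfam X X') (g : gfam X' X) :
  is_gmor f -> (forall m d, in_range k l m d -> mutually_inverse (f m d) (g m d)) ->
  is_gmor g.
Proof.
move=> fP fg m d r; have [fe fm] := fP m d r; have [r1 r2] := in_rangeS r.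
have [gf1 fg1] := fg _ _ r; have [gf2 fg2] := fg _ _ r1; have [gf3 fg3] := fg _ _ r2.
split.
- by rewrite -[LHS]comp1m -gf2 -compA [X in _ ∘ X]compA -fe -[X in _ ∘ X]compA fg1 compm1.
- by rewrite -[LHS]comp1m -gf1 -compA [X in _ ∘ X]compA -fm -[X in _ ∘ X]compA fg3 compm1.
Qed.

Lemma giso_extend l (Y Y' : gext k A l) (g : giso (trunc Y) (trunc Y')) : (0 < l)%N ->
  (forall m d, in_range k l m d.+1 -> d.+1 = l ->
     exists h : hom (gX Y m d.+1) (gX Y' m d.+1),
       [/\ is_iso h, epi Y' m d ∘ h = gfun g m.+1 d ∘ epi Y m d
         & h ∘ mono Y m d = mono Y' m d ∘ gfun g m d]) ->
  exists f : giso Y Y', forall m, gfun f m 0 = gfun g m 0.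
Proof.
move=> l0 H.
(* The pair gets the value 0 outside the top range, so that one choice can be made for all [m] and
   [d]. *)
have {}H m d : exists hh : hom (gX Y m d.+1) (gX Y' m d.+1) * hom (gX Y' m d.+1) (gX Y m d.+1),
    in_range k l m d.+1 -> d.+1 = l ->
    [/\ mutually_inverse hh.1 hh.2, epi Y' m d ∘ hh.1 = gfun g m.+1 d ∘ epi Y m d
      & hh.1 ∘ mono Y m d = mono Y' m d ∘ gfun g m d].
  have [[r dl]|nr] := pselect (in_range k l m d.+1 /\ d.+1 = l).
    by have [h [[h' hh'] he hm]] := H m d r dl; exists (h, h').
  by exists (0, 0) => r dl; case: nr.
pose hh m d := sval (cid (H m d)).
have hhP m d : in_range k l m d.+1 -> d.+1 = l ->
    [/\ mutually_inverse (hh m d).1 (hh m d).2,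
        epi Y' m d ∘ (hh m d).1 = gfun g m.+1 d ∘ epi Y m d
      & (hh m d).1 ∘ mono Y m d = mono Y' m d ∘ gfun g m d].
  by rewrite /hh; case: cid.
pose f m d : hom (gX Y m d) (gX Y' m d) :=
  if d is d'.+1 return hom (gX Y m d) (gX Y' m d)
  then if d'.+1 == l then (hh m d').1 else gfun g m d'.+1 else gfun g m 0.
pose f' m d : hom (gX Y' m d) (gX Y m d) :=
  if d is d'.+1 return hom (gX Y' m d) (gX Y m d)
  then if d'.+1 == l then (hh m d').2 else ginv g m d'.+1 else ginv g m 0.
have fE m d : (d == l) = false -> f m d = gfun g m d.
  by rewrite /f; case: d => // d ->.
have ff' m d : in_range k l m d -> mutually_inverse (f m d) (f' m d).
  have [dl|dl] := eqVneq d l; last first.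
    move=> r; have r' : in_range k l.-1 m d by move: r dl; rewrite /in_range; lia.
    have := gfunK g r'; rewrite /f /f'; case: d dl {r r'} => // d /negbTE -> //.
  case: d dl => [|d] dl r; first by exfalso; lia.
  by rewrite /f /f' (introT eqP dl); have [] := hhP m d r dl.
have fP : is_gmor (f : gfam Y Y').
  move=> m d r; have dl : (d == l) = false by move: r; rewrite /in_range; lia.
  rewrite !(fE _ d) //; have [dl'|dl'] := eqVneq d.+1 l.
    by have [_ he hm] := hhP m d r dl'; rewrite /f (introT eqP dl'); split.
  rewrite fE; last exact: negbTE.
  by apply: (gfun_mor g); move: r dl'; rewrite /in_range; lia.
by exists (GIso fP (ginv_is_gmor fP ff') ff').
Qed.

End GextStructure.

(** * Replacing the top objects *)

Section ReplaceTop.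
Variables (K : fieldType) (C : tensCat K) (F : fiberFunctor C).
Variables (k : nat) (A : nat -> C).

Local Notation "f $ x" := (fmor F f x) (at level 30, right associativity).

Lemma is_iso_comp (X Y Z : C) (f : hom X Y) (g : hom Y Z) :
  is_iso f -> is_iso g -> is_iso (g ∘ f).
Proof.
move=> [f' [f1 f2]] [g' [g1 g2]]; exists (f' ∘ g'); split.
  by rewrite -compA [g' ∘ _]compA g1 comp1m.
by rewrite -compA [f ∘ _]compA f2 comp1m.
Qed.

Lemma is_epi_comp (X Y Z : C) (f : hom X Y) (g : hom Y Z) :
  is_epi f -> is_epi g -> is_epi (g ∘ f).
Proof. by move=> ef eg V u v; rewrite !compA => /ef /eg. Qed.

Lemma is_mono_comp (X Y Z : C) (f : hom X Y) (g : hom Y Z) :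
  is_mono f -> is_mono g -> is_mono (g ∘ f).
Proof. by move=> mf mg V u v; rewrite -!compA => /mg /mf. Qed.

Lemma is_iso_epi (X Y : C) (f : hom X Y) : is_iso f -> is_epi f.
Proof. by move=> /(is_iso_el F) [_ /is_epi_el]. Qed.

Lemma is_iso_mono (X Y : C) (f : hom X Y) : is_iso f -> is_mono f.
Proof. by move=> /(is_iso_el F) [/is_mono_el]. Qed.

(* The object M m d.+1 is a boolean choice between the old and the new object,
   so that its identification with either of them is only available as a pair
   of mutually inverse morphisms (junk 0 for the object not chosen). *)
Lemma replace_objects (B : nat -> nat -> C) (Z : nat -> nat -> C) (l : nat) :
  exists (M : nat -> nat -> C)
    (j : forall m d, hom (gob A B m d) (gob A M m d))
    (j' : forall m d, hom (gob A M m d) (gob A B m d))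
    (z : forall m d, hom (Z m d) (M m d)) (z' : forall m d, hom (M m d) (Z m d)),
  [/\ forall m, j m 0 = idm (A m.+1), forall m, j' m 0 = idm (A m.+1),
      forall m d, (d == l) = false -> mutually_inverse (j m d) (j' m d)
    & forall m d, d.+1 = l -> mutually_inverse (z m d) (z' m d)].
Proof.
pose M (m d : nat) : C := if d.+1 == l then Z m d else B m d.
pose i0 (c : bool) (P Q : C) : hom P (if c then P else Q) :=
  if c return hom P (if c then P else Q) then idm P else 0.
pose i0' (c : bool) (P Q : C) : hom (if c then P else Q) P :=
  if c return hom (if c then P else Q) P then idm P else 0.
pose i1 (c : bool) (P Q : C) : hom Q (if c then P else Q) :=
  if c return hom Q (if c then P else Q) then 0 else idm Q.
pose i1' (c : bool) (P Q : C) : hom (if c then P else Q) Q :=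
  if c return hom (if c then P else Q) Q then 0 else idm Q.
exists M.
exists (fun m d => if d is d'.+1 return hom (gob A B m d) (gob A M m d)
                   then i1 (d'.+1 == l) (Z m d') (B m d') else idm (A m.+1)).
exists (fun m d => if d is d'.+1 return hom (gob A M m d) (gob A B m d)
                   then i1' (d'.+1 == l) (Z m d') (B m d') else idm (A m.+1)).
exists (fun m d => i0 (d.+1 == l) (Z m d) (B m d)).
exists (fun m d => i0' (d.+1 == l) (Z m d) (B m d)).
split=> //.
- move=> m [|d] dl; first by split; exact: comp1m.
  by rewrite /i1 /i1' /M /= dl; split; exact: comp1m.
- move=> m d dl; rewrite /i0 /i0' /M.
  by rewrite (introT eqP dl); split; exact: comp1m.
Qed.

(** Distinct top objects are joined by no arrow, so any blends may be put in their places
    simultaneously. The arrows [E] and [U] end and start at the old objects; [j] and [j'] transfer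
    them to the new family. *)
Lemma replace_top l (Y : gext k A l)
    (Z : forall m d, blend (gX Y m d) (gX Y m.+1 d)) : (1 < l)%N ->
  (forall m d, in_range k l m d.+1 -> d.+1 = l ->
     is_blend F (from_bot (mono Y) m d) (epi Y m d ∘ mono Y m d) (Z m d)) ->
  exists (Y' : gext k A l) (f : giso (trunc Y) (trunc Y')),
    id_on_A f /\ forall m d, in_range k l m d.+1 -> d.+1 = l ->
      exists h, @blend_mor _ _ _ _ (Z m d) (conj_blend f m d) h.
Proof.
move=> l1 bZ.
have [M [j [j' [z [z' [j0 j'0 jj' zz']]]]]] :=
  replace_objects (upper Y) (fun m d => bmid (Z m d)) l.
pose MM := gob A M.
have [E EE] : exists E : forall m d, hom (MM m d.+1) (gX Y m.+1 d), forall m d,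
    E m d = if d.+1 == l then bpi (Z m d) ∘ z' m d else epi Y m d ∘ j' m d.+1.
  by eexists (fun m d => if d.+1 == l then bpi (Z m d) ∘ z' m d else epi Y m d ∘ j' m d.+1).
have [U UE] : exists U : forall m d, hom (gX Y m d) (MM m d.+1), forall m d,
    U m d = if d.+1 == l then z m d ∘ bmu (Z m d) else j m d.+1 ∘ mono Y m d.
  by eexists (fun m d => if d.+1 == l then z m d ∘ bmu (Z m d) else j m d.+1 ∘ mono Y m d).
pose e m d : hom (MM m d.+1) (MM m.+1 d) := j m.+1 d ∘ E m d.
pose u m d : hom (MM m d) (MM m d.+1) := U m d ∘ j' m d.
have ndl m d : in_range k l m d.+1 -> (d == l) = false by rewrite /in_range; lia.
have ji m d : (d == l) = false -> is_iso (j m d) by move=> /(jj' m); exists (j' m d).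
have j'i m d : (d == l) = false -> is_iso (j' m d).
  by move=> /(jj' m) [jK Kj]; exists (j m d).
have zi m d : d.+1 = l -> is_iso (z m d) by move=> /(zz' m); exists (z' m d).
have z'i m d : d.+1 = l -> is_iso (z' m d).
  by move=> /(zz' m) [jK Kj]; exists (z m d).
have EU m d : in_range k l m d.+1 -> E m d ∘ U m d = epi Y m d ∘ mono Y m d.
  move=> r; rewrite EE UE; have [dl|dl] := eqVneq d.+1 l.
    have [zK _] := zz' m _ dl; rewrite -compA [z' m d ∘ _]compA zK comp1m.
    apply: (el_eq (F := F)) => x; rewrite elM.
    by have [-> _ _ _] := bZ _ _ r dl.
  have [jK _] := jj' m _ (negbTE dl).
  by rewrite -compA [j' m d.+1 ∘ _]compA jK comp1m.
have Eepi m d : in_range k l m d.+1 -> is_epi (E m d).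
  move=> r; rewrite EE; have [dl|dl] := eqVneq d.+1 l; apply: is_epi_comp.
  - exact/is_iso_epi/z'i.
  - by apply/(is_epi_el F); have [] := bZ _ _ r dl.
  - exact/is_iso_epi/j'i/negbTE.
  - exact: epiP.
have mumono m d : in_range k l m d.+1 -> d.+1 = l -> is_mono (bmu (Z m d)).
  move=> r dl; apply/(is_mono_el F); case: d r dl => [|d] r dl; first by exfalso; lia.
  exact: (blend_mu_inj (top_baseP F Y r)) (bZ _ _ r dl).
have Umono m d : in_range k l m d.+1 -> is_mono (U m d).
  move=> r; rewrite UE; have [dl|dl] := eqVneq d.+1 l; apply: is_mono_comp.
  - exact: mumono.
  - exact/is_iso_mono/zi.
  - exact: monoP.
  - exact/is_iso_mono/ji/negbTE.
(* A square sees a top object only through the composite of its two arrows, and by [EU] that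
   composite is unchanged. *)
have sq m d : in_range k l m d.+2 -> e m d.+1 ∘ u m d.+1 = u m.+1 d ∘ e m d.
  move=> r; have [r1 r2] := in_rangeS r.
  rewrite /e /u -!compA ![E _ _ ∘ (_ ∘ _)]compA EU // squareP //.
  rewrite EE UE (ndl _ _ r).
  have [jK _] := jj' m.+1 d (ndl _ _ r1); rewrite -!compA; congr (_ ∘ (_ ∘ _)).
  by rewrite compA jK comp1m.
have topE' m d : (d < l)%N ->
    model_top (M := MM) e (fun m => idm (A m.+1)) m d = to_top (epi Y) m d ∘ j' m d.
  elim: d m => [|d IHd] m dl /=; first by rewrite j'0 compm1.
  rewrite IHd; last by lia.
  have [jK _] : mutually_inverse (j m.+1 d) (j' m.+1 d) by apply: jj'; lia.
  rewrite /e -[LHS]compA [j' m.+1 d ∘ _]compA jK comp1m EE.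
  have -> : (d.+1 == l) = false by lia.
  by rewrite compA.
have vex m d : in_range k l m d.+1 ->
    short_exact (u m d) (model_top (M := MM) e (fun m => idm (A m.+1)) m d.+1).
  move=> r; rewrite /u UE; have [dl|dl] := eqVneq d.+1 l; last first.
    rewrite topE'; last by move: r dl; rewrite /in_range; lia.
    rewrite -compA; apply: (short_exact_mid F).
      by have [jK Kj] := jj' m d.+1 (negbTE dl); split.
    rewrite -[to_top _ _ _]comp1m; apply: short_exact_iso (vexactP Y r).
      exact/j'i/ndl/r.
    by exists (idm _); split; exact: comp1m.
  have -> : model_top (M := MM) e (fun m => idm (A m.+1)) m d.+1 =
      to_top (epi Y) m.+1 d ∘ bpi (Z m d) ∘ z' m d.
    rewrite /= topE'; last by lia.
    have [jK _] := jj' m.+1 d (ndl _ _ r).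
    rewrite /e -[LHS]compA [j' m.+1 d ∘ _]compA jK comp1m EE (introT eqP dl).
    by rewrite compA.
  have [zK Kz] := zz' m _ dl.
  rewrite -[z m d ∘ _ ∘ _]compA; apply: (short_exact_mid F); first by split.
  rewrite -[_ ∘ bpi _]comp1m; apply: short_exact_iso.
  - exact/j'i/ndl/r.
  - by exists (idm _); split; exact: comp1m.
  (* The top index is [d = l - 1 > 0], as [top_baseP] requires. Exactness at the new object then
     says that an element dying in [A_n] comes from [bmu], which is [blend_bot]. *)
  case: d r dl zK Kz => [|d] r dl zK Kz; first by exfalso; lia.
  have base := top_baseP F Y r; have [bi0 bE wb0 wE ws] := base.
  have [bm bs bi bk] := bZ _ _ r dl.
  apply: (el_short_exact (F := F)).
  - exact: (blend_mu_inj base (bZ _ _ r dl)).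
  - move=> y; have [v <-] := ws y; have [x <-] := bs v; exists x.
    by rewrite elM.
  split=> [x|y]; first by rewrite elM bm wb0.
  by rewrite elM => /(blend_bot base (bZ _ _ r dl)) [x ->]; exists x.
have [|||Y' [f [g [fg ef uf defY' f0]]]] := @gext_of_model _ _ F k A l MM e u
    (fun m => idm (A m.+1)) (fun m => idm (A m.+1)) _ _ _ sq vex.
- by move=> m _; split; exact: comp1m.
- by move=> m d r; apply: is_epi_comp; [exact: Eepi|exact/is_iso_epi/ji/ndl/r].
- by move=> m d r; apply: is_mono_comp; [exact/is_iso_mono/j'i/ndl/r|exact: Umono].
pose t m d : hom (gX Y m d) (gX Y' m d) := g m d ∘ j m d.
pose t' m d : hom (gX Y' m d) (gX Y m d) := j' m d ∘ f m d.
have rl m d : in_range k l.-1 m d -> in_range k l m d /\ (d == l) = false.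
  by rewrite /in_range; lia.
have tt' m d : in_range k l.-1 m d -> mutually_inverse (t m d) (t' m d).
  move=> /rl [/fg [fK Kf] /(jj' m) [jK Kj]]; split.
    by rewrite /t /t' -compA [f m d ∘ _]compA Kf comp1m.
  by rewrite /t /t' -compA [j m d ∘ _]compA Kj comp1m.
have tP : is_gmor (t : gfam (trunc Y) (trunc Y')).
  move=> m d r; have [r' dl] := rl _ _ r; have [r1 r2] := in_rangeS r'.
  have [-> ->] : epi (trunc Y') m d = g m.+1 d ∘ e m d ∘ f m d.+1 /\
                 mono (trunc Y') m d = g m d.+1 ∘ u m d ∘ f m d by exact: defY'.
  have [_ Kf] := fg _ _ r'; have [jK _] := jj' m _ dl.
  have [_ Kf2] := fg _ _ r2; have [jK2 _] := jj' m _ (ndl _ _ r').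
  rewrite /t /e /u EE UE dl -!compA; split.
    by rewrite [f m d.+1 ∘ _]compA Kf comp1m jK compm1.
  by rewrite [f m d ∘ _]compA Kf2 comp1m jK2 compm1.
exists Y', (GIso tP (ginv_is_gmor tP tt') tt'); split.
  by move=> m mk /=; rewrite /t j0 compm1; have [_ ->] := f0 m.
move=> m d r dl; exists (g m d.+1 ∘ z m d).
have [r1 r2] := in_rangeS r; have [_ Kf] := fg _ _ r; have [_ Kf2] := fg _ _ r2.
have [zK Kz] := zz' m _ dl; have [_ Kf1] := fg _ _ r1.
have [jK1 _] := jj' m.+1 _ (ndl _ _ r); have [jK2 _] := jj' m _ (ndl _ _ r).
have [eY' uY'] := defY' m d.
split=> /=.
- rewrite uY' /t /u UE (introT eqP dl) -!compA [f m d ∘ _]compA Kf2 comp1m jK2.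
  by rewrite compm1.
- rewrite eY' /t' /e EE (introT eqP dl) -!compA [f m d.+1 ∘ _]compA Kf comp1m zK.
  by rewrite compm1 [f m.+1 d ∘ _]compA Kf1 comp1m compA jK1 comp1m.
Qed.

End ReplaceTop.

(** * The torsor *)

(** Baer sum and action are available only as relations between classes; totality and
    single-valuedness turn them into functions by choice. Identity and inverse laws are asked for on
    one side, commutativity giving the other. *)
Lemma torsor_of_graph (G : Type) (add : G -> G -> G -> Prop) (e : G) (U : Type)
    (act : G -> U -> U -> Prop) (S : set U) :
  (forall a b, exists c, add a b c) ->
  (forall a b c c', add a b c -> add a b c' -> c = c') ->
  (forall a b c, add a b c -> add b a c) ->
  (forall a b c ab bc r, add a b ab -> add ab c r -> add b c bc -> add a bc r) ->
  (forall a, add a e a) -> (forall a, exists b, add a b e) ->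
  (forall g s t, S s -> act g s t -> S t) ->
  (forall g s, S s -> exists t, act g s t) ->
  (forall g s t t', S s -> act g s t -> act g s t' -> t = t') ->
  (forall s, S s -> act e s s) ->
  (forall g h k s t r, S s -> act g s t -> act h t r -> add g h k -> act k s r) ->
  (forall s t, S s -> S t -> exists g, act g s t) ->
  (forall g h s t, S s -> act g s t -> act h s t -> g = h) ->
  (S !=set0)%classic -> is_torsor add act S.
Proof.
move=> addT addF addC addA add0 addN actS actT actF act0 actD trans free S0.
have [op opP] := choice (fun ab : G * G => addT ab.1 ab.2).
have opE a b : add a b (op (a, b)) := opP (a, b).
have addE a b c : add a b c <-> op (a, b) = c.
  by split=> [abc|<-]; [exact: addF (opE a b) abc|exact: opE].
have [inv invE] := choice addN.
(* Off [S] the action returns its argument, since [is_torsor] asks for a total function. *)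
have actT' (gs : G * U) : exists t, S gs.2 -> act gs.1 gs.2 t.
  have [Ss|nS] := pselect (S gs.2); last by exists gs.2.
  by have [t gst] := actT gs.1 gs.2 Ss; exists t.
have [f fP] := choice actT'.
have fE g s : S s -> act g s (f (g, s)) := fP (g, s).
have actE g s t : S s -> act g s t <-> f (g, s) = t.
  move=> Ss; split=> [gst|<-]; last exact: fE.
  exact: actF Ss (fE g s Ss) gst.
exists (fun a b => op (a, b)), e, inv, (fun g s => f (g, s)); split=> //.
- split.
  + move=> a b c; apply/addE; exact: addA (opE a b) (opE _ c) (opE b c).
  + by move=> a b; apply/addE/addC/opE.
  + by move=> a; apply/addE/addC.
  + by move=> a; apply/addE/addC/invE.
- move=> g s Ss; split; last by move=> t; exact: actE.
  exact: actS Ss (fE g s Ss).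
- split=> [s Ss|g h s Ss]; first exact/actE/act0.
  apply/actE => //; have hs := fE h s Ss.
  by apply: (actD _ _ _ _ _ _ Ss hs (fE g _ (actS _ _ _ Ss hs))); apply/addC/opE.
- split=> // s t Ss St; have [g gst] := trans s t Ss St.
  exists g; split=> [|h /(actE h s t Ss) hst]; first exact/actE.
  exact: free Ss gst hst.
Qed.

(** * The group law on [Ext1] *)

Section ExtGroup.
Variables (K : fieldType) (C : tensCat K) (F : fiberFunctor C).
Variables (R A : C).
Implicit Types E : ext R A.

Lemma is_iso_idm (X : C) : is_iso (idm X).
Proof. by exists (idm X); split; exact: comp1m. Qed.

Lemma ext_equiv_equiv : is_equiv (@ext_equiv K C R A).
Proof.
split.
- move=> E; exists (idm _); split; first exact: is_iso_idm.
  by split; rewrite ?compm1 ?comp1m.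
- move=> E E' [h [[g [gh hg]] [hi ph]]]; exists g; split; first by exists h.
  rewrite compm1 in hi; rewrite comp1m in ph; split.
    by rewrite compm1 -hi compA gh comp1m.
  by rewrite comp1m -ph -compA hg compm1.
- move=> E1 E2 E3 [h [ih [hi ph]]] [g [ig [gi pg]]]; exists (g ∘ h).
  split; first exact: is_iso_comp.
  rewrite !compm1 in hi gi *; rewrite !comp1m in ph pg *; split.
    by rewrite -compA hi gi compm1.
  by rewrite compA pg ph comp1m.
Qed.

Lemma ext_elP E : el_ext F E.
Proof. exact/(exact_el F)/ext_exact. Qed.

Lemma ext_mor_equiv E E' h : ext_mor E E' (idm A) (idm R) h -> ext_equiv E E'.
Proof.
move=> hP; exists h; split=> //.
apply: (blend_mor_iso (F := F) (Z := ext_blend E) (Z' := ext_blend E')).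
- exact/is_ext_blend/ext_elP.
- exact/is_ext_blend/ext_elP.
- by have [hi ph] := hP; split; [rewrite /= hi compm1|rewrite /= ph comp1m].
Qed.

Lemma ext_class_equiv (x : Ext1 R A) E E' : sval x E -> sval x E' -> ext_equiv E E'.
Proof. by move=> xE; rewrite (class_refl ext_equiv_equiv xE). Qed.

Definition ext_class E : Ext1 R A :=
  exist _ [set E' | ext_equiv E E']%classic (ex_intro _ E erefl).

Lemma ext_classE E : sval (ext_class E) E.
Proof. by have [r _ _] := ext_equiv_equiv; exact: r. Qed.

(** The existential over representatives may be evaluated at any chosen ones, because [is_sum] is
    transported by equivalences of extensions. *)
Lemma baerP (x y z : Ext1 R A) E1 E2 E3 : sval x E1 -> sval y E2 -> sval z E3 ->
  baer x y z <-> ext_is_sum F E1 E2 E3.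
Proof.
move=> x1 y2 z3; split.
- move=> [E1' [E2' [E3' [x1' y2' z3']]]].
  move=> /(is_baer_sumP F _ (ext_exact E1') (ext_exact E2')) s.
  have [f [fi [f1 f2]]] := ext_class_equiv x1' x1.
  have [g [gi gP]] := ext_class_equiv y2' y2.
  have [h [hi [h1 h2]]] := ext_class_equiv z3' z3.
  have bf : blend_mor (Z := ext_blend E1') (Z' := ext_blend E1) f.
    by split; [rewrite /= f1 compm1|rewrite /= f2 comp1m].
  have bh : blend_mor (Z := ext_blend E3') (Z' := ext_blend E3) h.
    by split; [rewrite /= h1 compm1|rewrite /= h2 comp1m].
  exact: is_sum_mor s bf fi gP gi bh.
- move=> s; exists E1, E2, E3; split=> //.
  exact/(is_baer_sumP F _ (ext_exact E1) (ext_exact E2)).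
Qed.

Definition ext0 : ext R A :=
  @Ext K C R A (ExtSeq (@inl_ _ _ A R) prr) (bip_exact F A R).

Lemma ext_of_el (E : extSeq R A) : el_ext F E -> exists E' : ext R A, E' = E :> extSeq R A.
Proof. by move=> /(exact_el F) e; exists (Ext e). Qed.

Lemma baer_total (x y : Ext1 R A) : exists z, baer x y z.
Proof.
have [E1 x1] := class_inhabited ext_equiv_equiv x.
have [E2 y2] := class_inhabited ext_equiv_equiv y.
have /is_ext_blend b1 := ext_elP E1.
have [[M mu pi] [bZ s]] := is_sum_total (ext_blend_base F A R) b1 (ext_elP E2).
have /ext_of_el [E3 E3E] : el_ext F (ExtSeq mu pi) by apply/is_ext_blend.
exists (ext_class E3); apply/(baerP x1 y2 (ext_classE E3)).
by rewrite /ext_is_sum E3E.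
Qed.

Lemma baer_functional (x y z z' : Ext1 R A) : baer x y z -> baer x y z' -> z = z'.
Proof.
have [E1 x1] := class_inhabited ext_equiv_equiv x.
have [E2 y2] := class_inhabited ext_equiv_equiv y.
have [E3 z3] := class_inhabited ext_equiv_equiv z.
have [E3' z3'] := class_inhabited ext_equiv_equiv z'.
move=> /(baerP x1 y2 z3) s /(baerP x1 y2 z3') s'.
have [|||h [h1 h2]] := is_sum_functional (ext_blend_base F A R) _ (ext_elP E2) _ _ s s'.
- exact/is_ext_blend/ext_elP.
- exact/is_ext_blend/ext_elP.
- exact/is_ext_blend/ext_elP.
apply: (class_ext ext_equiv_equiv z3 z3').
apply: (ext_mor_equiv (h := h)); rewrite /= in h1 h2.
by split; rewrite ?h1 ?h2 ?compm1 ?comp1m.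
Qed.

Lemma baerC (x y z : Ext1 R A) : baer x y z -> baer y x z.
Proof.
have [E1 x1] := class_inhabited ext_equiv_equiv x.
have [E2 y2] := class_inhabited ext_equiv_equiv y.
have [E3 z3] := class_inhabited ext_equiv_equiv z.
move=> /(baerP x1 y2 z3) s; apply/(baerP y2 x1 z3).
exact: ext_is_sum_sym.
Qed.

Lemma baerA (x y z xy yz r : Ext1 R A) :
  baer x y xy -> baer xy z r -> baer y z yz -> baer x yz r.
Proof.
have [E1 e1] := class_inhabited ext_equiv_equiv x.
have [E2 e2] := class_inhabited ext_equiv_equiv y.
have [E3 e3] := class_inhabited ext_equiv_equiv z.
have [E12 e12] := class_inhabited ext_equiv_equiv xy.
have [E23 e23] := class_inhabited ext_equiv_equiv yz.
have [E e] := class_inhabited ext_equiv_equiv r.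
move=> /(baerP e1 e2 e12) s1 /(baerP e12 e3 e) s2 /(baerP e2 e3 e23) s3.
apply/(baerP e1 e23 e).
exact: (is_sum_add (ext_elP E2) (ext_elP E3) (ext_elP E23) s1 s2 s3).
Qed.

Lemma baer0 (x : Ext1 R A) : baer x (ext_class ext0) x.
Proof.
have [E1 x1] := class_inhabited ext_equiv_equiv x.
apply/(baerP x1 (ext_classE ext0) x1).
by apply: (is_sum0 (ext_blend_base F A R)); apply/is_ext_blend/ext_elP.
Qed.

(** Transitivity yields the inverse: some extension translates [E1] to the split one. *)
Lemma baerN (x : Ext1 R A) : exists y, baer x y (ext_class ext0).
Proof.
have [E1 x1] := class_inhabited ext_equiv_equiv x.
have [||E [eE s]] := is_sum_transitive (ext_blend_base F A R)
  (Z := ext_blend E1) (Z' := ext_blend ext0).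
- exact/is_ext_blend/ext_elP.
- exact/is_ext_blend/ext_elP.
have [E2 E2E] := ext_of_el eE; exists (ext_class E2).
apply/(baerP x1 (ext_classE E2) (ext_classE ext0)).
by rewrite /ext_is_sum E2E.
Qed.

End ExtGroup.

(** * Translating all top objects by a family of extension classes *)

Section Translate.
Variables (K : fieldType) (C : tensCat K) (F : fiberFunctor C).
Variables (k : nat) (A : nat -> C) (n : nat).

Local Notation "f $ x" := (fmor F f x) (at level 30, right associativity).
Local Notation l := n.+2.
Implicit Types Y : gext k A l.

(** Top objects have second index [l], so the arrows at them carry the index [n.+1 = l - 1]. *)
Definition top_sum (Y Y' : gext k A l) (f : giso (trunc Y) (trunc Y')) m
    (E : ext (A (top m.+1 n.+1)) (A m.+1)) :=
  is_sum F (from_bot (mono Y) m n.+1) (to_top (epi Y) m.+1 n.+1)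
    (top_blend Y m n.+1) E (conj_blend f m n.+1).

(** Every representative of [x m] is tested, which makes the predicate directly applicable;
    [translatesP] shows that one is enough. *)
Definition translates (x : prodExt1 k A l) (Y Y' : gext k A l)
    (f : giso (trunc Y) (trunc Y')) :=
  forall m : 'I_(k - l), forall E, sval (x m) E -> top_sum f E.

Lemma top_in_range m : (m < k - l)%N -> in_range k l m n.+2.
Proof. by rewrite /in_range; lia. Qed.

Lemma top_range (m : 'I_(k - l)) : in_range k l m n.+2.
Proof. exact/top_in_range/ltn_ord. Qed.

Lemma range_top m d : in_range k l m d.+1 -> d.+1 = l -> d = n.+1 /\ (m < k - l)%N.
Proof. by rewrite /in_range; lia. Qed.

Lemma blend_mor_id (U V : C) (Z : blend U V) : blend_mor (Z := Z) (Z' := Z) (idm _).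
Proof. by split; rewrite ?comp1m ?compm1. Qed.

Lemma ext_mor_id (R B : C) (E : extSeq R B) : ext_mor E E (idm _) (idm _) (idm _).
Proof. by split; rewrite ?comp1m ?compm1. Qed.

Lemma top_sum_ext Y Y' (f : giso (trunc Y) (trunc Y')) m
    (E E' : ext (A (top m.+1 n.+1)) (A m.+1)) :
  ext_equiv E E' -> top_sum f E -> top_sum f E'.
Proof.
move=> [h [hi hP]] s.
exact: is_sum_mor s (blend_mor_id _) (is_iso_idm _) hP hi (blend_mor_id _).
Qed.

Lemma translatesP (x : prodExt1 k A l) Y Y' (f : giso (trunc Y) (trunc Y')) :
  id_on_A f ->
  translates x f <->
  forall m : 'I_(k - l), exists2 E, sval (x m) E & top_translate f E.
Proof.
move=> f1.
have dict (m : 'I_(k - l)) E : top_translate (m := m) f E <-> top_sum (m := m) f E.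
  have r := top_range m.
  have r1 : in_range k l.-1 m n.+1 by move: r; rewrite /in_range; lia.
  have r2 : in_range k l.-1 m.+1 n.+1 by move: r; rewrite /in_range; lia.
  apply: top_translateP.
  - exact: top_baseP.
  - exact: hseq_el.
  - exact: gfunK.
  - exact: (gfun_from_bot (X := trunc Y) (X' := trunc Y')).
split=> H m.
- have [E xE] := class_inhabited (@ext_equiv_equiv K C _ _) (x m).
  by exists E => //; apply/dict/H.
- move=> E xE; have [E' xE' /dict] := H m.
  exact/top_sum_ext/(ext_class_equiv xE' xE).
Qed.

Lemma conj_mor (Y Y1 Y2 : gext k A l) (f : giso (trunc Y) (trunc Y1))
    (g : giso Y1 Y2) m : in_range k l m n.+2 ->
  blend_mor (Z := conj_blend f m n.+1)
    (Z' := conj_blend (giso_comp (trunc_iso g) f) m n.+1) (gfun g m n.+2).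
Proof.
move=> r; have [ge gm] := gfun_mor g r; have [r1 r2] := in_rangeS r.
have [gK _] := gfunK g r1; split=> /=; first by rewrite !compA gm.
by rewrite -!compA ge [X in _ ∘ X]compA gK comp1m.
Qed.

Lemma translates_right x Y Y1 Y2 (f : giso (trunc Y) (trunc Y1)) (g : giso Y1 Y2) :
  translates x f -> translates x (giso_comp (trunc_iso g) f).
Proof.
move=> xf m E xE; have s := xf m E xE.
exact: is_sum_mor s (blend_mor_id _) (is_iso_idm _) (ext_mor_id E) (is_iso_idm _)
  (conj_mor f g (top_range m)).
Qed.

(** A sum over the truncation of [Y1] becomes one over that of [Y]: [f] is the identity on the
    [A r], so it carries the arrows out of and into the [A r] for [Y] to those for [Y1]. *)
Lemma top_sum_base Y Y1 Y2 (f : giso (trunc Y) (trunc Y1))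
    (f' : giso (trunc Y1) (trunc Y2)) (m : 'I_(k - l)) E : id_on_A f ->
  top_sum f' (m := m) E ->
  is_sum F (from_bot (mono Y) m n.+1) (to_top (epi Y) m.+1 n.+1)
    (conj_blend f m n.+1) E (conj_blend (giso_comp f' f) m n.+1).
Proof.
move=> f1 s; have r := top_range m.
have r1 : in_range k l.-1 m n.+1 by move: r; rewrite /in_range; lia.
have r2 : in_range k l.-1 m.+1 n.+1 by move: r; rewrite /in_range; lia.
have [_ Kf] := gfunK f r2.
have wE : to_top (epi Y) m.+1 n.+1 ∘ ginv f m.+1 n.+1 = to_top (epi Y1) m.+1 n.+1.
  rewrite -(gfun_to_top (X := trunc Y) (X' := trunc Y1) f1 r2) -compA.
  by rewrite [X in _ ∘ X]Kf compm1.
have iE : gfun f m n.+1 ∘ from_bot (mono Y) m n.+1 = from_bot (mono Y1) m n.+1.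
  exact: (gfun_from_bot (X := trunc Y) (X' := trunc Y1) f1 r1).
rewrite /top_sum -iE -wE in s.
have := is_sum_base s; rewrite /conj_blend /= !compA.
by rewrite -[_ ∘ _ ∘ epi Y2 m n.+1]compA.
Qed.

Lemma translates_left x Y Y1 Y2 (g : giso Y Y1) (f : giso (trunc Y1) (trunc Y2)) :
  id_on_A g -> translates x f -> translates x (giso_comp f (trunc_iso g)).
Proof.
move=> g1 xf m E xE; have r := top_range m.
have s := top_sum_base (f := trunc_iso g) g1 (xf m E xE).
have [ge gm] := ginv_mor g r; have [r1 r2] := in_rangeS r.
have [gK _] := gfunK g r2.
have bm : blend_mor (Z := conj_blend (trunc_iso g) m n.+1)
    (Z' := top_blend Y m n.+1) (ginv g m n.+2).
  split=> /=; last by rewrite ge.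
  by rewrite compA -gm -compA gK compm1.
have gi : is_iso (ginv g m n.+2).
  by have [gK' Kg'] := gfunK g r; exists (gfun g m n.+2).
exact: is_sum_mor s bm gi (ext_mor_id E) (is_iso_idm _) (blend_mor_id _).
Qed.

Lemma translates_add (x y z : prodExt1 k A l) Y Y1 Y2
    (f : giso (trunc Y) (trunc Y1)) (f' : giso (trunc Y1) (trunc Y2)) :
  id_on_A f -> translates x f -> translates y f' -> prodExt1_add x y z ->
  translates z (giso_comp f' f).
Proof.
move=> f1 xf yf xyz m E zE.
have [E1 x1] := class_inhabited (@ext_equiv_equiv K C _ _) (x m).
have [E2 y2] := class_inhabited (@ext_equiv_equiv K C _ _) (y m).
have s1 := xf m E1 x1; have s2 := top_sum_base f1 (yf m E2 y2).
have /(baerP F x1 y2 zE) s3 := xyz m.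
exact: is_sum_add (ext_elP F E1) (ext_elP F E2) (ext_elP F E) s1 s2 s3.
Qed.

(** The identification [f2 ∘ f1^-1] of the truncations extends to each top object separately, by
    uniqueness of the sum there. *)
Lemma translates_functional x Y Y1 Y2 (f1 : giso (trunc Y) (trunc Y1))
    (f2 : giso (trunc Y) (trunc Y2)) : id_on_A f1 -> id_on_A f2 ->
  translates x f1 -> translates x f2 -> gisom' Y1 Y2.
Proof.
move=> f1A f2A x1 x2.
have [|f fE] := giso_extend (g := giso_comp f2 (giso_sym f1)) (ltn0Sn _).
  move=> m d r dl; have [dE mk] := range_top r dl; move: r; rewrite {}dE => r.
  pose m' := Ordinal mk.
  have [E xE] := class_inhabited (@ext_equiv_equiv K C _ _) (x m').
  have b := top_blendP F Y r; have b1 := conj_blendP F f1A r erefl.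
  have b2 := conj_blendP F f2A r erefl.
  have [h hP] := is_sum_functional (top_baseP F Y r) b (ext_elP F E) b1 b2
    (x1 m' E xE) (x2 m' E xE).
  exists h; split; first exact: blend_mor_iso b1 b2 hP.
    have [_ /= ph] := hP.
    have r1 : in_range k l.-1 m.+1 n.+1 by move: r; rewrite /in_range; lia.
    have [_ Kf2] := gfunK f2 r1.
    by rewrite gfun_sym -compA -ph !compA [X in X ∘ _ ∘ _]Kf2 comp1m.
  have [/= hm _] := hP.
  have r2 : in_range k l.-1 m n.+1 by move: r; rewrite /in_range; lia.
  have [_ Kf1] := gfunK f1 r2.
  by rewrite /= gfun_sym compA -hm -!compA [X in _ ∘ (_ ∘ X)]Kf1 compm1.
exists f => m mk; rewrite fE /= gfun_sym f2A // comp1m.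
exact: (ginv_id f1A).
Qed.

Lemma translates_total x Y : exists Y' (f : giso (trunc Y) (trunc Y')),
  id_on_A f /\ translates x f.
Proof.
have H m : exists Z : blend (gX Y m n.+1) (gX Y m.+1 n.+1),
    in_range k l m n.+2 ->
    is_blend F (from_bot (mono Y) m n.+1) (epi Y m n.+1 ∘ mono Y m n.+1) Z /\
    forall mk : (m < k - l)%N, exists2 E, sval (x (Ordinal mk)) E &
      is_sum F (from_bot (mono Y) m n.+1) (to_top (epi Y) m.+1 n.+1)
        (top_blend Y m n.+1) E Z.
  have [mk|/negP mk] := pselect (m < k - l)%N; last first.
    by exists (top_blend Y m n.+1) => r; exfalso; move: r mk; rewrite /in_range; lia.
  have r := top_in_range mk.
  have [E xE] := class_inhabited (@ext_equiv_equiv K C _ _) (x (Ordinal mk)).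
  have [Z [bZ s]] := is_sum_total (top_baseP F Y r) (top_blendP F Y r) (ext_elP F E).
  exists Z => _; split=> // mk'; exists E => //.
  by rewrite (bool_irrelevance mk' mk).
pose Z0 m := sval (cid (H m)).
have Z0P m := svalP (cid (H m)); rewrite -/(Z0 _) in Z0P.
(* The sums exist only at [d = n.+1], whereas [replace_top] takes a family over all [d]: hence the
   cast along the equality, and the blend of [Y] itself as default. *)
pose Z m d : blend (gX Y m d) (gX Y m.+1 d) :=
  if d =P n.+1 is ReflectT e then
    ecast d (blend (gX Y m d) (gX Y m.+1 d)) (esym e) (Z0 m)
  else top_blend Y m d.
have ZE m : Z m n.+1 = Z0 m.
  rewrite /Z; case: eqP => // e; by rewrite (eq_irrelevance e erefl).
have [||Y' [f [f1 fZ]]] := @replace_top _ _ F k A l Y Z => //.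
  move=> m d r dl; have [dE mk] := range_top r dl; move: r; rewrite {}dE => r.
  by rewrite ZE; have [] := Z0P m r.
exists Y', f; split=> // -[m mk] E xE.
have r := top_in_range mk; have [_ /(_ mk) [E' xE' s]] := Z0P m r.
apply: top_sum_ext (ext_class_equiv xE' xE) _.
have := fZ m n.+1 r erefl; rewrite ZE => -[h hP].
exact: is_sum_mor s (blend_mor_id _) (is_iso_idm _) (ext_mor_id E') (is_iso_idm _) hP.
Qed.

Lemma translates0 Y : translates (fun m => ext_class (ext0 F _ _)) (giso_id (trunc Y)).
Proof.
move=> m E [h [hi hP]]; have r := top_range m.
apply: (top_sum_ext (E := ext0 F _ _)); first by exists h.
rewrite /top_sum /conj_blend /= compm1 comp1m.
exact: (is_sum0 (top_baseP F Y r) (top_blendP F Y r)).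
Qed.

Lemma translates_transitive Y Y' (f : giso (trunc Y) (trunc Y')) : id_on_A f ->
  exists x, translates x f.
Proof.
move=> f1.
have H (m : 'I_(k - l)) : exists E : ext (A (top m.+1 n.+1)) (A m.+1), top_sum f E.
  have r := top_range m.
  have [E [eE s]] := is_sum_transitive (top_baseP F Y r) (top_blendP F Y r)
    (conj_blendP F f1 r erefl).
  by have [E' E'E] := ext_of_el eE; exists E'; rewrite /top_sum E'E.
exists (fun m => ext_class (sval (cid (H m)))) => m E /= eE.
exact: top_sum_ext eE (svalP (cid (H m))).
Qed.

(** Agreement of [f] and [f'] in range makes the two conjugated blends equal, so [is_sum_free]
    applies at each index. *)
Lemma translates_free x y Y Y' (f f' : giso (trunc Y) (trunc Y')) : id_on_A f ->
  (forall m d, in_range k l.-1 m d -> gfun f m d = gfun f' m d) ->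
  translates x f -> translates y f' -> x = y.
Proof.
move=> f1 ff' xf yf; apply: functional_extensionality_dep => m.
have r := top_range m.
have r1 : in_range k l.-1 m n.+1 by move: r; rewrite /in_range; lia.
have r2 : in_range k l.-1 m.+1 n.+1 by move: r; rewrite /in_range; lia.
have [E1 x1] := class_inhabited (@ext_equiv_equiv K C _ _) (x m).
have [E2 y2] := class_inhabited (@ext_equiv_equiv K C _ _) (y m).
have conjE : conj_blend f m n.+1 = conj_blend f' m n.+1.
  rewrite /conj_blend ff' //; congr (Blend _ (_ ∘ _)).
  have [fK _] := gfunK f r2; have [_ Kf'] := gfunK f' r2.
  by rewrite -[LHS]compm1 -Kf' compA -ff' // fK comp1m.
have s1 := xf m E1 x1; have s2 := yf m E2 y2; rewrite /top_sum -conjE in s2.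
have [h hP] := is_sum_free (top_baseP F Y r) (top_blendP F Y r)
  (conj_blendP F f1 r erefl) (ext_elP F E1) (ext_elP F E2) s1 s2.
exact: (class_ext (@ext_equiv_equiv K C _ _) x1 y2 (ext_mor_equiv F hP)).
Qed.

End Translate.

(** * The torsor structure on the fibre of [Theta] *)

Section Torsor.
Variables (K : fieldType) (T : filteredTannakian K) (F : fiberFunctor T).
Variables (k : nat) (A : nat -> T) (p : nat -> int).
Hypothesis A_nonzero : forall r : nat, (1 <= r <= k)%N -> ~ is_zero (A r).
Hypothesis A_pure : forall r : nat, (1 <= r <= k)%N -> pure (p r) (A r).
Hypothesis p_increasing :
  forall r s : nat, (1 <= r)%N -> (r < s)%N -> (s <= k)%N -> p r < p s.
Variable n : nat.
Local Notation l := n.+2.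
Hypothesis hl : (2 <= l <= k.-1)%N.
Variable eps' : gS' k A l.-1.
Hypothesis eps_tns : forall X, sval eps' X -> gext_totally_nonsplit X.

Let S := [set c : gS k A l | Theta c = forget eps']%classic.

Let eqv' := @gisom'_equiv K T k A l.
Let eqv1' := @gisom'_equiv K T k A l.-1.
Let eqv := @gisom_equiv K T k A l.
Let eqv1 := @gisom_equiv K T k A l.-1.

Lemma torsor_actP (x : prodExt1 k A l) (c c' : gS k A l) :
  torsor_act eps' x c c' <->
  exists (Y Y' : gext k A l) (f : giso (trunc Y) (trunc Y')),
    [/\ sval eps' (trunc Y), sval c Y, sval c' Y', id_on_A f & translates F x f].
Proof.
split.
- move=> [b [b' [be bc bc' [Y [Y' [f [bY bY' f1 xf]]]]]]]; exists Y, Y', f; split=> //.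
  + by rewrite -be; exists Y => //; have [r _ _] := eqv1'; exact: r.
  + by rewrite -bc; exists Y => //; have [r _ _] := eqv; exact: r.
  + by rewrite -bc'; exists Y' => //; have [r _ _] := eqv; exact: r.
  + exact/translatesP.
- move=> [Y [Y' [f [eY cY cY' f1 xf]]]].
  have [r _ _] := eqv'; have [r1 _ _] := eqv1'; have [r2 _ _] := eqv.
  exists (exist _ [set Z | gisom' Y Z]%classic (ex_intro _ Y erefl) : gS' k A l).
  exists (exist _ [set Z | gisom' Y' Z]%classic (ex_intro _ Y' erefl) : gS' k A l).
  split.
  + apply: (class_ext eqv1' (x := trunc Y) _ eY) => //.
    by exists Y; [exact: r|exact: r1].
  + apply: (class_ext eqv (x := Y) _ cY) => //.
    by exists Y; [exact: r|exact: r2].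
  + apply: (class_ext eqv (x := Y') _ cY') => //.
    by exists Y'; [exact: r|exact: r2].
  + exists Y, Y', f; split=> //; [exact: r|exact: r|].
    exact/(translatesP F).
Qed.

Lemma fibre_rep c : S c -> exists2 Y, sval c Y & sval eps' (trunc Y).
Proof.
move=> Sc; have [_ _ surj_] :=
  forget_bij F A_nonzero A_pure p_increasing hl eps_tns.
have [b /= be bc] := surj_ c Sc; have [Y bY] := class_inhabited eqv' b.
exists Y; first by rewrite -bc; exists Y => //; have [r _ _] := eqv; exact: r.
by rewrite -be; exists Y => //; have [r _ _] := eqv1'; exact: r.
Qed.

Lemma trunc_gisom' Y Y' : sval eps' (trunc Y) -> gisom' (trunc Y) (trunc Y') ->
  sval eps' (trunc Y' : gext k A l.-1).
Proof. by move=> eY; rewrite (class_refl eqv1' eY). Qed.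

Lemma fibre_rep_unique (c : gS k A l) (Y Y' : gext k A l) : sval c Y -> sval c Y' ->
  sval eps' (trunc Y) -> sval eps' (trunc Y') -> gisom' Y Y'.
Proof.
move=> cY cY' eY eY'.
apply: (gisom_trunc_isom' F A_nonzero A_pure p_increasing hl eps_tns) => //.
  by move: cY'; rewrite (class_refl eqv cY).
by move: eY'; rewrite (class_refl eqv1' eY).
Qed.

Lemma fibre_mem c Y : sval c Y -> sval eps' (trunc Y) -> S c.
Proof.
move=> cY eY; apply: (class_ext eqv1 (x := trunc Y) (y := trunc Y)).
- by exists Y => //; have [r _ _] := eqv1; exact: r.
- by exists (trunc Y) => //; have [r _ _] := eqv1; exact: r.
- by have [r _ _] := eqv1; exact: r.
Qed.

(* f^-1 f' is a scalar automorphism of trunc Y which is the identity on A_1. *)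
Lemma trunc_giso_unique (Y Y' : gext k A l) (f f' : giso (trunc Y) (trunc Y')) :
  sval eps' (trunc Y) -> id_on_A f -> id_on_A f' ->
  forall m d, in_range k l.-1 m d -> gfun f m d = gfun f' m d.
Proof.
move=> eY f1 f1'.
have [||c [c0 cE]] := gaut_scalar F A_nonzero A_pure p_increasing
  (giso_comp (giso_sym f) f') _ _ (eps_tns eY); try lia.
have r0 : in_range k l.-1 0 0 by rewrite /in_range; lia.
have k0 : (0 < k)%N by lia.
have c1 : c = 1.
  apply: (scale_idm_inj (A_nonzero (r := 1) _)); first by lia.
  have [+ _] := cE _ _ r0; rewrite /= gfun_sym (ginv_id f1) // f1' // comp1m scale1r.
  by move=> <-.
move=> m d r; have [+ _] := cE _ _ r; rewrite /= gfun_sym c1 scale1r => E.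
have [_ Kf] := gfunK f r.
by rewrite -[LHS]compm1 -E compA Kf comp1m.
Qed.

Lemma fibre_torsor : (S !=set0)%classic ->
  is_torsor (@prodExt1_add K T k A l) (torsor_act eps') S.
Proof.
have giso_id_A (X X' X'' : gext k A l.-1) (g : giso X' X'') (f : giso X X') :
    id_on_A g -> id_on_A f -> id_on_A (giso_comp g f).
  by move=> g1 f1 m mk; rewrite /= g1 // f1 // comp1m.
apply: (torsor_of_graph (e := fun m => ext_class (ext0 F _ _))).
- move=> a b; have H m := baer_total F (a m) (b m).
  by exists (fun m => sval (cid (H m))) => m; exact: svalP (cid (H m)).
- move=> a b c c' H H'; apply: functional_extensionality_dep => m.
  exact: baer_functional (H m) (H' m).
- by move=> a b c H m; exact: (baerC F (H m)).
- by move=> a b c ab bc r H1 H2 H3 m; exact: (baerA F (H1 m) (H2 m) (H3 m)).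
- by move=> a m; exact: (baer0 F (a m)).
- move=> a; have H m := baerN F (a m).
  by exists (fun m => sval (cid (H m))) => m; exact: svalP (cid (H m)).
- move=> g s t Ss /torsor_actP [Y [Y' [f [eY sY tY' f1 gf]]]].
  by apply: (fibre_mem tY'); apply: trunc_gisom' eY _; exists f.
- move=> g s /fibre_rep [Y sY eY]; have [Y' [f [f1 gf]]] := translates_total F g Y.
  have [r _ _] := eqv.
  exists (exist _ [set Z | gisom Y' Z]%classic (ex_intro _ Y' erefl)).
  by apply/torsor_actP; exists Y, Y', f; split=> //; exact: r.
- move=> g s t t' Ss /torsor_actP [Y1 [Y1' [f1 [eY1 sY1 tY1 f1A gf1]]]].
  move=> /torsor_actP [Y2 [Y2' [f2 [eY2 sY2 tY2 f2A gf2]]]].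
  (* The two actions may use different representatives of [s]; both truncate into [eps'], so they
     are isomorphic by the identity on the [A r], and the second action can be moved to [Y1]. *)
  have [h h1] := fibre_rep_unique sY1 sY2 eY1 eY2.
  apply: (class_ext eqv tY1 tY2); apply: gisom'W.
  apply: (translates_functional (F := F) f1A _ gf1 (translates_left h1 gf2)).
  exact: giso_id_A.
- move=> s /fibre_rep [Y sY eY]; apply/torsor_actP.
  by exists Y, Y, (giso_id _); split=> //; exact: translates0.
- move=> g h x s t r Ss /torsor_actP [Y1 [Y1' [f1 [eY1 sY1 tY1 f1A gf1]]]].
  move=> /torsor_actP [Y2 [Y2' [f2 [eY2 sY2 tY2 f2A gf2]]]] ghx.
  have eY1' : sval eps' (trunc Y1') by apply: trunc_gisom' eY1 _; exists f1.
  have [j j1] := fibre_rep_unique tY1 sY2 eY1' eY2.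
  apply/torsor_actP; exists Y1, Y2', (giso_comp (giso_comp f2 (trunc_iso j)) f1).
  split=> //; first by do 2?apply: (giso_id_A).
  exact: translates_add f1A gf1 (translates_left j1 gf2) ghx.
- move=> s t /fibre_rep [Y sY eY] /fibre_rep [Y' tY' eY'].
  have [f f1] : gisom' (trunc Y) (trunc Y') by move: eY'; rewrite (class_refl eqv1' eY).
  have [x xf] := translates_transitive F f1; exists x.
  by apply/torsor_actP; exists Y, Y', f.
- move=> g h s t Ss /torsor_actP [Y1 [Y1' [f1 [eY1 sY1 tY1 f1A gf1]]]].
  move=> /torsor_actP [Y2 [Y2' [f2 [eY2 sY2 tY2 f2A gf2]]]].
  have [j j1] := fibre_rep_unique sY1 sY2 eY1 eY2.
  have eY1' : sval eps' (trunc Y1') by apply: trunc_gisom' eY1 _; exists f1.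
  have eY2' : sval eps' (trunc Y2') by apply: trunc_gisom' eY2 _; exists f2.
  have [j' j'1] := fibre_rep_unique tY2 tY1 eY2' eY1'.
  (* Both translations now go from [Y1] to [Y1']; their identifications of truncations coincide by
     [trunc_giso_unique]. *)
  have gf2' := translates_right j' (translates_left j1 gf2).
  apply: (translates_free f1A _ gf1 gf2').
  by apply: trunc_giso_unique => //; do 2?apply: (giso_id_A).
Qed.

End Torsor.

Local Open Scope classical_set_scope.
Local Open Scope ring_scope.

Theorem proposition4p2p3 (K : fieldType) (charK : [pchar K] =i pred0)
    (T : filteredTannakian K) (k : nat) (hk : (2 <= k)%N)
    (A : nat -> T) (p : nat -> int)
    (A_nonzero : forall r : nat, (1 <= r <= k)%N -> ~ is_zero (A r))
    (A_pure : forall r : nat, (1 <= r <= k)%N -> pure (p r) (A r))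
    (p_increasing : forall r s : nat, (1 <= r)%N -> (r < s)%N -> (s <= k)%N -> p r < p s)
    (l : nat) (hl : (2 <= l <= k.-1)%N)
    (eps : gS k A l.-1) (eps' : gS' k A l.-1) (lift : forget eps' = eps)
    (eps_tns : class_totally_nonsplit eps) :
  [/\ forall (g : Gamma eps') (c : fiber' eps'), Gamma_act g c = c,
      set_bij [set c : gS' k A l | Theta' c = eps']
              [set c : gS k A l | Theta c = eps] (@forget K T k A l)
    & [set c : gS k A l | Theta c = eps] !=set0 ->
      is_torsor (@prodExt1_add K T k A l) (torsor_act eps')
                [set c : gS k A l | Theta c = eps]].
Proof.
have [F] := tann_fiber T.
(* With [l = n.+2] the index [l.-1] reduces, which is the form used for the torsor. *)
case: l hl eps eps' lift eps_tns => [|[|n]] // hl eps eps' <- tns.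
have {}tns X : sval eps' X -> gext_totally_nonsplit X.
  move=> eX; apply: tns; exists X => //.
  by have [r _ _] := @gisom_equiv K T k A n.+1; exact: r.
split.
- exact: (Gamma_act_trivial F A_nonzero A_pure p_increasing hl).
- exact: (forget_bij F A_nonzero A_pure p_increasing hl).
- exact: (fibre_torsor F A_nonzero A_pure p_increasing hl).
Qed.
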